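(* Suppose that $\beta>0$ and let $$\varphi_\beta(s):=1+\sum_{n=2}^\infty\frac{1}{\sqrt{n}(\log n)^\beta}\,n^{-s}.$$ (a) Let $2\le p<\infty$. Then $\varphi_\beta$ is in $\mathcal{H}^p$ if and only if $\beta>p/4$. (b) Let $0<p\le2$. If $\beta>1/p$, then $\varphi_\beta$ is in $(\mathcal{H}^p)^\ast$, and if $\beta<1/p$, then $\varphi_\beta$ is not in $(\mathcal{H}^p)^\ast$.
   Context: For $0<p<\infty$, $\mathcal{H}^p$ is the closure (completion) of the set of Dirichlet polynomials $f(s)=\sum_{n=1}^Na_nn^{-s}$ under the norm (quasi-norm if $0<p<1$) $$\|f\|_{\mathcal{H}^p}:=\Big(\lim_{T\to\infty}\frac1{2T}\int_{-T}^T|f(it)|^p\,dt\Big)^{1/p}=\Big(\int_{\mathbb{T}^\infty}|\mathcal{B}f(z)|^p\,d\mu_\infty(z)\Big)^{1/p},$$ where $\mu_\infty$ is the normalized product Lebesgue measure on $\mathbb{T}^\infty$ and $\mathcal{B}f(z)=\sum_na_nz^{\kappa(n)}$ is the Bohr lift, $\kappa(n)$ being the exponent vector of $n=p_1^{\kappa_1}p_2^{\kappa_2}\cdots$ in terms of the increasing sequence $(p_j)$ of primes. Coefficient functionals $f\mapsto a_n$ are continuous and an element of $\mathcal{H}^p$ is determined by its coefficients; a Dirichlet series $\sum_{n\ge1}a_nn^{-s}$ is said to be in $\mathcal{H}^p$ if $(a_n)$ is the coefficient sequence of an element of $\mathcal{H}^p$. We say that $\varphi_\beta$ is in $(\mathcal{H}^p)^\ast$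 if there is a constant $C>0$ such that $$\Big|a_1+\sum_{n=2}^N\frac{a_n}{\sqrt n(\log n)^\beta}\Big|\le C\|f\|_{\mathcal{H}^p}$$ for every Dirichlet polynomial $f(s)=\sum_{n=1}^Na_nn^{-s}$ (every $N$). *)

(* Defs.v *)
From HB Require Import structures.
From mathcomp Require Import all_boot all_order all_algebra.
From mathcomp Require Import all_classical all_reals all_analysis.
From mathcomp Require Import complex.

Set Implicit Arguments.
Unset Strict Implicit.
Unset Printing Implicit Defensive.

Import Order.TTheory GRing.Theory Num.Theory.
Import numFieldNormedType.Exports.

Local Open Scope classical_set_scope.
Local Open Scope ring_scope.
Local Open Scope complex_scope.

(* The modulus as a real number; MathComp's `|z| for z : R[i] lives in R[i]. *)
Definition cmod (R : realType) (z : R[i]) : R := ComplexField.Normc.normc z.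

(* n^{-s} = e^{- s log n} = e^{- Re s log n} (cos (Im s log n) - i sin (Im s log n)),
   for n >= 1. *)
Definition npow (R : realType) (n : nat) (s : R[i]) : R[i] :=
  (expR (- (complex.Re s * ln n%:R)))%:C *
  (cos (complex.Im s * ln n%:R) -i* sin (complex.Im s * ln n%:R)).

(* The list [:: a_1; ...; a_N] encodes the Dirichlet polynomial
   a_1 1^{-s} + ... + a_N N^{-s}.  Indices start at 1: dcoef P n is a_n for
   n >= 1 (and 0 for n > N); dcoef P 0 is meaningless and never used. *)
Definition dirpoly (R : realType) : Type := seq R[i].

Definition dcoef (R : realType) (P : dirpoly R) (n : nat) : R[i] := P`_n.-1.

Definition deval (R : realType) (P : dirpoly R) (s : R[i]) : R[i] :=
  \sum_(1 <= n < (size P).+1) dcoef P n * npow n s.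

(* ( lim_{T -> +oo} 1/(2T) \int_{-T}^{T} |f(it)|^p dt )^{1/p}.  It is only
   applied to Dirichlet polynomials and to their differences, for which the
   integrand is continuous and bounded and the limit exists. *)
Definition Hp_norm (R : realType) (p : R) (f : R[i] -> R[i]) : R :=
  (lim ((2 * T)^-1 *
        Rintegral (@lebesgue_measure R) `[- T, T]
          (fun t : R => cmod (f (0 +i* t)) `^ p) @[T --> +oo])) `^ p^-1.

Definition Hp_cauchy (R : realType) (p : R) (F : nat -> dirpoly R) : Prop :=
  forall e : R, 0 < e -> exists K : nat, forall j k : nat,
    (K <= j)%N -> (K <= k)%N ->
    Hp_norm p (fun s => deval (F j) s - deval (F k) s) < e.

(* An element of H^p, the completion of the Dirichlet polynomials, is the class
   of a Cauchy sequence F of Dirichlet polynomials; its n-th coefficient is, by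
   continuity of the coefficient functionals, the limit of the n-th coefficients
   of the F k.  So in_Hp p a says that a_1, a_2, ... is the coefficient sequence
   of an element of H^p; a 0 plays no role. *)
Definition in_Hp (R : realType) (p : R) (a : nat -> R[i]) : Prop :=
  exists F : nat -> dirpoly R,
    Hp_cauchy p F /\
    forall n : nat, (1 <= n)%N ->
      cmod (dcoef (F k) n - a n) @[k --> \oo] --> (0 : R).

(* 1 for n = 1 and 1 / (sqrt n (log n)^beta) for n >= 2. *)
Definition phi_coef (R : realType) (beta : R) (n : nat) : R :=
  if n == 1%N then 1 else (Num.sqrt n%:R * ln n%:R `^ beta)^-1.

Definition phi_in_Hp (R : realType) (p beta : R) : Prop :=
  in_Hp p (fun n => (phi_coef beta n)%:C).

Definition phi_in_Hp_dual (R : realType) (p beta : R) : Prop :=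
  exists C : R, 0 < C /\ forall P : dirpoly R,
    cmod (dcoef P 1 +
          \sum_(2 <= n < (size P).+1) dcoef P n * (phi_coef beta n)%:C)
    <= C * Hp_norm p (deval P).

(* Main.v *)
Require Import Defs.
From HB Require Import structures.
From mathcomp Require Import all_boot all_order all_algebra.
From mathcomp Require Import all_classical all_reals all_analysis.
From mathcomp Require Import complex.
From mathcomp Require Import ring lra zify.


(** Up to a constant, [(ln n) ^ (- beta)] is the integral over [s > 0] of
    [s ^ (beta - 1) * n ^ (- s)]. So [phi_beta - 1] is a superposition, with the
    density [s ^ (beta - 1)], of the series [Z_s - 1], where [Z_s] has the
    coefficients [n ^ (- 1 / 2 - s)], and both parts of the theorem ask whether a
    norm of [Z_s - 1], which decays exponentially for large [s], is integrable
    against this density near [s = 0]. The integral is used in the form of Riemann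
    sums whose weights are binomial coefficients ([superpos_limit],
    [superpos_bound]).

    In part (b), pairing with [Z_s] is evaluation at [1 / 2 + s], and the norm of
    this functional is [zeta (1 + 2 s) ^ (1 / p)], of order [s ^ (- 1 / p)]. The
    bound is proved by replacing the variables [q ^ (- i t)] of the primes [q] one
    after another by [q ^ (- 1 / 2 - s)]; each step costs the constant of point
    evaluation on the Hardy space of the disc ([disc_eval], [pmean_psubst],
    [point_eval]). Hence boundedness for [beta > 1 / p]
    ([phi_dual_bounded]). Conversely let [w] be the sum over the primes of
    [q ^ (- 1 / 2 - s) * q ^ (- i t)]. The function [exp (2 w / p)] has norm of order
    [s ^ (- 1 / p)], its pairing with [phi_beta] is at least of order
    [s ^ (beta - 2 / p)], and [s -> 0] excludes [beta < 1 / p]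
    ([phi_dual_unbounded]).

    In part (a), the norm of [Z_s] is of order [s ^ (- p / 4)]: [|Z_s| ^ p] is
    comparable to the square of an approximate exponential of [p / 2] times the
    logarithm of the Euler product, whose mean is explicit by orthogonality and is
    of order [exp (p ^ 2 / 4 * L)], where [L], the sum of the [q ^ (- 1 - 2 s)], is
    [- ln s] up to a constant ([zbox_bound]). For [beta > p / 4] this bounds the norms of
    the truncations of [phi_beta] to finitely many primes ([phi_box_bound]). The
    truncations form a martingale, and uniform convexity makes it converge
    ([box_increment], [phi_Hp_sufficient]). Conversely, if [phi_beta] is in the
    space, pair it with the function of modulus [|exp w| ^ (p - 1)] that is dual to
    [exp w]: the coefficients give at least [s ^ (beta - p ^ 2 / 4)], and
    approximating [phi_beta] by a polynomial shows that this is
    [o(s ^ (- p * (p - 1) / 4))], so [beta > p / 4] ([dual_test],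
    [phi_Hp_necessary]).

    All norms are means over the imaginary axis. They exist because a power of the
    modulus of a Dirichlet polynomial is a uniform limit of polynomials in the
    [n ^ (- i t)] and their conjugates, whose means are their diagonal terms
    ([form_approx], [mean_tev]); this also gives the independence of the variables
    attached to distinct primes. *)

Set Implicit Arguments.
Unset Strict Implicit.
Unset Printing Implicit Defensive.

Import Order.TTheory GRing.Theory Num.Theory.
Import numFieldNormedType.Exports.

Local Open Scope classical_set_scope.
Local Open Scope ring_scope.
Local Open Scope complex_scope.

Local Notation Re := complex.Re.
Local Notation Im := complex.Im.

Ltac nneg := repeat first
  [ done | exact: powR_ge0 | exact: expR_ge0 | exact: ler0n | exact: normr_ge0
  | exact: sqr_ge0 | exact: ltW | apply: mulr_ge0 | apply: addr_ge0
  | apply: exprn_ge0 | rewrite invr_ge0 ].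

(** * Inequalities for real powers, exponentials and logarithms *)

Section RealInequalities.
Variable R : realType.
Implicit Types x y p s u v : R.

Lemma ler_powR2 p x y : 0 <= p -> 0 <= x -> x <= y -> x `^ p <= y `^ p.
Proof.
move=> p0 x0 xy; apply: ge0_ler_powR => //; rewrite ?nnegrE //.
exact: le_trans xy.
Qed.

Lemma bernoulli_powR p x : 1 <= p -> 0 < x -> 1 + p * (x - 1) <= x `^ p.
Proof.
move=> p1 x0; have p0 : 0 < p by lra.
rewrite -(mulr_powRB1 (ltW x0) p0).
have h1 : 1 + (p - 1) * ln x <= x `^ (p - 1).
  by rewrite /powR (gt_eqF x0); exact: expR_ge1Dx.
have h2 : 1 - x^-1 <= ln x.
  have h : ln (1 + (x^-1 - 1)) <= x^-1 - 1.
    by apply: le_ln1Dx; rewrite ltrBrDl subrr invr_gt0.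
  move: h; rewrite [1 + _]addrC subrK lnV ?posrE // => h; lra.
apply: le_trans (ler_wpM2l (ltW x0) h1).
have h3 : (p - 1) * (1 - x^-1) <= (p - 1) * ln x by rewrite ler_wpM2l //; lra.
have -> : 1 + p * (x - 1) = x * (1 + (p - 1) * (1 - x^-1)).
  by field; rewrite gt_eqF.
by rewrite ler_wpM2l ?(ltW x0) // lerD2l.
Qed.

Lemma powR_tangent p x y : 1 <= p -> 0 <= x -> 0 <= y ->
  y `^ p + p * y `^ (p - 1) * (x - y) <= x `^ p.
Proof.
move=> p1 x0 y0; have p0 : 0 < p by lra.
have [->|yn0] := eqVneq y 0.
  rewrite powR0 ?gt_eqF // add0r subr0; have [->|pn1] := eqVneq p 1.
    by rewrite subrr powRr0 powRr1 // !mul1r.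
  by rewrite powR0 ?subr_eq0 // mulr0 mul0r powR_ge0.
have yp : 0 < y by rewrite lt_def yn0.
have [->|xn0] := eqVneq x 0.
  rewrite (powR0 (x := p)) ?gt_eqF // sub0r mulrN -mulrA [_ * y]mulrC.
  rewrite mulr_powRB1 //; have := powR_ge0 y p; nra.
have xp : 0 < x by rewrite lt_def xn0.
have := bernoulli_powR p1 (divr_gt0 xp yp).
rewrite powRM ?invr_ge0 // => h.
have h2 := ler_wpM2l (powR_ge0 y p) h.
apply: (le_trans (le_trans _ h2)).
  rewrite -(mulr_powRB1 y0 p0); set t := y `^ (p - 1).
  rewrite le_eqVlt; apply/orP; left; apply/eqP; field; exact: yn0.
rewrite mulrCA -powRM ?invr_ge0 // divff // powR1 mulr1 //.
Qed.

(** The tangent line at the weighted average lies below the convex power, and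
    summing it over [r] gives Jensen's inequality. The total mass of the weights
    is left arbitrary because the weights used below only have a bounded sum. *)
Lemma jensen_powR (I : Type) (r : seq I) (w f : I -> R) p : 1 <= p ->
  (forall i, 0 <= w i) -> (forall i, 0 <= f i) ->
  (\sum_(i <- r) w i * f i) `^ p <=
  (\sum_(i <- r) w i) `^ (p - 1) * \sum_(i <- r) w i * f i `^ p.
Proof.
move=> p1 w0 f0; have p0 : 0 < p by lra.
set W := \sum_(i <- r) w i; set S := \sum_(i <- r) w i * f i.
have W0 : 0 <= W by apply: sumr_ge0.
have S0 : 0 <= S by apply: sumr_ge0 => i _; rewrite mulr_ge0.
have [W00|Wn0] := eqVneq W 0.
  have S00 : S = 0.
    have key l : \sum_(i <- l) w i = 0 -> \sum_(i <- l) w i * f i = 0.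
      elim: l => [|a l ih]; rewrite ?big_nil // !big_cons => /eqP.
      rewrite paddr_eq0 ?sumr_ge0 // => /andP[/eqP-> /eqP /ih->].
      by rewrite mul0r add0r.
    exact: key.
  rewrite S00 powR0 ?gt_eqF // mulr_ge0 ?powR_ge0 //.
  by apply: sumr_ge0 => i _; rewrite mulr_ge0 ?powR_ge0.
have Wp : 0 < W by rewrite lt_def Wn0.
set y := S / W; have y0 : 0 <= y by rewrite divr_ge0.
have -> : S = W * y by rewrite /y mulrCA divff // mulr1.
rewrite powRM // -(mulr_powRB1 W0 p0) -mulrA mulrCA ler_wpM2l ?powR_ge0 //.
have -> : W * y `^ p = \sum_(i <- r) w i * (y `^ p + p * y `^ (p - 1) * (f i - y)).
  have -> : \sum_(i <- r) w i * (y `^ p + p * y `^ (p - 1) * (f i - y)) =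
     \sum_(i <- r) (w i * y `^ p + (p * y `^ (p - 1) * (w i * f i) - p * y `^ (p - 1) * y * w i)).
    by apply: eq_bigr => i _; ring.
  rewrite big_split /= -mulr_suml sumrB -!mulr_sumr -/S -/W.
  have -> : S = y * W by rewrite /y mulfVK.
  by ring.
by apply: ler_sum => i _; rewrite ler_wpM2l //; apply: powR_tangent.
Qed.

Lemma powR_superadd s u v : 1 <= s -> 0 <= u -> 0 <= v ->
  u `^ s + v `^ s <= (u + v) `^ s.
Proof.
move=> s1 u0 v0; have s0 : 0 < s by lra.
rewrite -(mulr_powRB1 u0 s0) -(mulr_powRB1 v0 s0) -(mulr_powRB1 (addr_ge0 u0 v0) s0).
rewrite mulrDl lerD // ler_wpM2l // ler_powR2 //; lra.
Qed.

Lemma powRD_le p x y : 0 <= p -> 0 <= x -> 0 <= y ->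
  (x + y) `^ p <= 2 `^ p * (x `^ p + y `^ p).
Proof.
move=> p0 x0 y0; wlog xy : x y x0 y0 / x <= y.
  move=> H; case: (leP x y) => [|/ltW] h; first exact: H.
  by rewrite addrC [x `^ p + _]addrC; apply: H.
rewrite mulrDr; have h : (x + y) `^ p <= 2 `^ p * y `^ p.
  by rewrite -powRM // ler_powR2 //; lra.
by apply: (le_trans h); rewrite lerDr mulr_ge0 ?powR_ge0.
Qed.

(** With [a], [b] the squared moduli of two complex numbers and [c], [d] those of
    their half difference and half sum, the hypothesis is the parallelogram law
    and the conclusion is Clarkson's inequality for the exponent [2 * s]. *)
Lemma clarkson_powR s (a b c d : R) : 1 <= s -> 0 <= a -> 0 <= b -> 0 <= c -> 0 <= d ->
  c + d = (a + b) / 2 -> c `^ s + d `^ s <= (a `^ s + b `^ s) / 2.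
Proof.
move=> s1 a0 b0 c0 d0 e.
apply: (le_trans (powR_superadd s1 c0 d0)); rewrite e.
have m0 : 0 <= (a + b) / 2 by lra.
have := powR_tangent s1 a0 m0; have := powR_tangent s1 b0 m0.
set M := _ `^ s; set K := s * _; nra.
Qed.

(** Compare [x] with [l * y]. With a weight [l] adapted to the norms, the mean of this
    inequality does the work of Hoelder's inequality. *)
Lemma powR_young p l x y : 1 < p -> 0 < l -> 0 <= x -> 0 <= y ->
  x * y `^ (p - 1) <= l * y `^ p + l `^ (1 - p) * x `^ p.
Proof.
move=> p1 l0 x0 y0; have p0 : 0 < p by lra.
case: (leP x (l * y)) => h.
  apply: (@le_trans _ _ (l * y `^ p)).
    by rewrite -(mulr_powRB1 y0 p0) mulrA ler_wpM2r ?powR_ge0.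
  by rewrite lerDl mulr_ge0 ?powR_ge0.
apply: (@le_trans _ _ (l `^ (1 - p) * x `^ p)); last first.
  by rewrite lerDr mulr_ge0 ?powR_ge0 ?ltW.
rewrite -(mulr_powRB1 x0 p0) mulrCA ler_wpM2l //.
have -> : 1 - p = - (p - 1) by ring.
rewrite powRN ler_pdivlMl ?powR_gt0 // -powRM ?(ltW l0) // ler_powR2 //; first lra.
- by rewrite mulr_ge0 // ltW.
- exact: ltW.
Qed.

Lemma powR_le_expR (a c : R) : 0 < a -> 0 < c ->
  exists2 K : R, 0 < K & forall x, 0 <= x -> x `^ a <= K * expR (c * x).
Proof.
move=> a0 c0; exists (expR (a * ln a - a * ln c)); first exact: expR_gt0.
move=> x; rewrite le_eqVlt => /predU1P[<-|x0].
  by rewrite powR0 ?gt_eqF // mulr_ge0 ?expR_ge0.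
rewrite /powR gt_eqF // -expRD ler_expR.
have : ln (c * x / a) <= c * x / a - 1.
  have := @le_ln1Dx R (c * x / a - 1).
  rewrite [1 + _]addrC subrK; apply; rewrite ltrBrDl subrr divr_gt0 // mulr_gt0 //.
rewrite ln_div ?posrE ?mulr_gt0 // lnM ?posrE // => h.
have h2 := ler_wpM2l (ltW a0) h.
have e : a * (c * x / a - 1) = c * x - a by field; rewrite gt_eqF.
rewrite e in h2; nra.
Qed.

Lemma ln1D_ge y : - 2^-1 <= y -> y - 2 * y ^+ 2 <= ln (1 + y).
Proof.
move=> hy; have p : 0 < 1 + y by lra.
have : ln (1 + - (y / (1 + y))) <= - (y / (1 + y)).
  apply: le_ln1Dx; rewrite ltrN2 ltr_pdivrMr // ; lra.
have -> : 1 + - (y / (1 + y)) = (1 + y)^-1 by field; rewrite gt_eqF.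
rewrite lnV ?posrE // lerN2; apply: le_trans.
rewrite ler_pdivlMr //; have : 0 <= y ^+ 2 * (1 + 2 * y) by rewrite mulr_ge0 ?sqr_ge0 //; lra.
by rewrite expr2; nra.
Qed.

Lemma expR_le_1D x : - 2^-1 <= x -> expR (x - 2 * x ^+ 2) <= 1 + x.
Proof.
move=> h; have p : 0 < 1 + x by lra.
by rewrite -ler_ln ?posrE ?expR_gt0 // expRK ln1D_ge.
Qed.

Lemma expR_ge_inv1B x : 0 <= x -> x <= 2^-1 -> (1 - x)^-1 <= expR (x + 2 * x ^+ 2).
Proof.
move=> x0 x1; have p : 0 < 1 - x by lra.
rewrite -[expR _]invrK lef_pV2 ?posrE ?invr_gt0 ?expR_gt0 // -expRN.
have -> : - (x + 2 * x ^+ 2) = (- x) - 2 * (- x) ^+ 2 by ring.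
by apply: expR_le_1D; lra.
Qed.

Lemma expR_le_inv1B x : x < 1 -> expR x <= (1 - x)^-1.
Proof.
move=> x1; rewrite -[expR x]invrK lef_pV2 ?posrE ?invr_gt0 ?expR_gt0 ?subr_gt0 //.
by rewrite -expRN; exact: expR_ge1Dx.
Qed.

End RealInequalities.

(** * The binomial series and polynomial approximation of powers *)

Section Binomial.
Variable R : realType.
Implicit Types b r y e : R.

Lemma geometric_small (c r : R) : 0 <= r -> r < 1 -> forall e, 0 < e ->
  exists N, forall n, (N <= n)%N -> c * r ^+ n <= e.
Proof.
move=> r0 r1 e e0.
have /cvgrPdist_le /(_ _ e0) : geometric c r @ \oo --> 0.
  by apply: cvg_geometric; rewrite ger0_norm.
case=> N _ H; exists N => n Nn; have := H n Nn.
by rewrite /geometric /= sub0r normrN => /(le_trans (ler_norm _)).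
Qed.

Lemma ratio_small (u : nat -> R) (r : R) (N : nat) : 0 <= r -> r < 1 ->
  (forall k, (N <= k)%N -> u k.+1 <= r * u k) ->
  forall e, 0 < e -> exists M, forall k, (M <= k)%N -> u k <= e.
Proof.
move=> r0 r1 H e e0.
have [M HM] := geometric_small (u N) r0 r1 e0.
exists (N + M)%N => k hk; have -> : k = (N + (k - N))%N by lia.
apply: le_trans (HM (k - N)%N _); last lia.
elim: (k - N)%N => [|n ih]; first by rewrite addn0 expr0 mulr1.
rewrite addnS; apply: (le_trans (H _ (leq_addr _ _))).
by rewrite exprS mulrCA ler_wpM2l.
Qed.

(** Rising factorial over [k`!], so that [(1 - y) `^ (- b)] is the sum of the
    [binc b k * y ^+ k]. *)
Definition binc b (k : nat) : R := \prod_(j < k) ((b + j%:R) / j.+1%:R).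

Definition binpoly b (n : nat) : {poly R} := \poly_(k < n.+1) binc b k.

Lemma binc0 b : binc b 0 = 1. Proof. by rewrite /binc big_ord0. Qed.

Lemma bincS b k : binc b k.+1 * k.+1%:R = binc b k * (b + k%:R).
Proof. by rewrite /binc big_ord_recr /= -mulrA divfK ?pnatr_eq0. Qed.

Lemma binc_ge0 b k : 0 <= b -> 0 <= binc b k.
Proof. by move=> b0; apply: prodr_ge0 => j _; rewrite divr_ge0 ?addr_ge0. Qed.

Lemma binpolyS b n : binpoly b n.+1 = binpoly b n + binc b n.+1 *: 'X^(n.+1).
Proof. by rewrite /binpoly !poly_def big_ord_recr. Qed.

Lemma horner_binpoly b n y : (binpoly b n).[y] = \sum_(k < n.+1) binc b k * y ^+ k.
Proof. by rewrite horner_poly. Qed.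

Lemma binpoly_ode b n y :
  (1 - y) * (binpoly b n)^`().[y] =
  b * (binpoly b n).[y] - n.+1%:R * binc b n.+1 * y ^+ n.
Proof.
elim: n => [|n ih].
  have -> : binpoly b 0 = 1%:P by rewrite /binpoly poly_def big_ord1 expr0 binc0 scale1r.
  rewrite derivC horner0 mulr0 hornerC expr0 mulr1.
  by rewrite [1%:R * _]mulrC bincS binc0; ring.
rewrite binpolyS derivD derivZ derivXn !(hornerD, hornerZ, hornerMn, hornerXn) mulrDr ih.
rewrite [n.+2%:R * _]mulrC bincS exprS /= -[y ^+ n *+ _]mulr_natl.
move: (binpoly b n).[y] (binc b n.+1) (y ^+ n) (n.+1%:R : R) => A c Y m.
by ring.
Qed.

Lemma powR_pred x b : 0 < x -> x `^ b = x * x `^ (b - 1).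
Proof.
move=> x0; rewrite -[X in X * _](powRr1 (ltW x0)) -powRD ?(gt_eqF x0) ?implybT //.
by rewrite addrC subrK.
Qed.

(** The derivative of [(1 - y) `^ b] times a partial sum of the series is a
    single monomial times a power, so the mean value theorem gives the error. *)
Lemma binpoly_remainder b n y : 0 <= y -> y < 1 ->
  exists2 x, 0 <= x <= y &
    (1 - y) `^ b * (binpoly b n).[y] - 1 =
    - ((1 - x) `^ (b - 1) * (n.+1%:R * binc b n.+1 * x ^+ n)) * y.
Proof.
move=> y0 y1.
pose h x := (1 - x) `^ b * (binpoly b n).[x].
pose dh x := - ((1 - x) `^ (b - 1) * (n.+1%:R * binc b n.+1 * x ^+ n)).
have dhP (x : R) : x < 1 -> is_derive x (1 : R) h (dh x).
  move=> x1; have p : 0 < 1 - x by lra.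
  have d1 : is_derive x (1 : R) (fun x : R => 1 - x) (-1).
    have := @is_deriveB R R R (cst 1) id x 1 0 1 (is_derive_cst _ _ _) (is_derive_id _ _).
    by rewrite sub0r.
  have d2 := @is_derive1_comp R (@powR R ^~ b) (fun x : R => 1 - x) x _ _
     (is_derive1_powR b p) d1.
  have d3 := is_deriveM d2 (is_derive_poly (binpoly b n) x).
  apply: (is_derive_eq d3); rewrite /dh /GRing.scale /=.
  have ode := binpoly_ode b n x; rewrite (powR_pred b p).
  have -> : n.+1%:R * binc b n.+1 * x ^+ n =
    b * (binpoly b n).[x] - (1 - x) * (binpoly b n)^`().[x] by rewrite ode; ring.
  ring.
have [||x xy e] := @MVT_segment R h dh 0 y y0.
- by move=> x; rewrite in_itv /= => /andP[_ xy]; apply: dhP; exact: lt_trans y1.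
- apply: derivable_within_continuous => x; rewrite in_itv /= => /andP[_ xy].
  by apply: ex_derive; apply: dhP; exact: le_lt_trans y1.
exists x; first by move: xy; rewrite in_itv.
move: e; rewrite /h /dh !subr0 powR1 mul1r => <-; congr (_ - _).
rewrite horner_binpoly big_ord_recl binc0 expr0 mul1r big1 ?addr0 // => i _.
by rewrite expr0n mulr0.
Qed.

Lemma binpoly_le b n y : 0 < b -> 0 <= y -> y < 1 ->
  (binpoly b n).[y] <= (1 - y) `^ (- b).
Proof.
move=> b0 y0 y1; have [x /andP[x0 xy] e] := binpoly_remainder b n y0 y1.
have p : 0 < (1 - y) `^ b by rewrite powR_gt0 // subr_gt0.
rewrite powRN -(ler_pM2l p) divff ?gt_eqF // -subr_le0 e mulNr oppr_le0.
rewrite !mulr_ge0 ?powR_ge0 ?exprn_ge0 // binc_ge0 // ltW //.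
Qed.

Lemma powR_bound (a d c : R) : 0 < d -> d <= a -> a <= 1 -> a `^ c <= d `^ (- `|c|).
Proof.
move=> d0 da a1; have a0 : 0 < a by exact: lt_le_trans da.
apply: (@le_trans _ _ (a `^ (- `|c|))).
  by apply: ger_powR; rewrite ?a0 //; have := ler_norm (- c); rewrite normrN lerNl.
rewrite !powRN lef_pV2 ?posrE ?powR_gt0 //; apply: ler_powR2 => //; exact: ltW.
Qed.

Lemma binpoly_cvg b r e : 0 <= r -> r < 1 -> 0 < e ->
  exists N, forall n, (N <= n)%N -> forall y, 0 <= y -> y <= r ->
    `|(binpoly b n).[y] - (1 - y) `^ (- b)| <= e.
Proof.
move=> r0 r1 e0.
pose u (k : nat) := k.+1%:R * `|binc b k.+1| * r ^+ k.
pose d := 1 - r; have d0 : 0 < d by rewrite subr_gt0.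
pose A := d `^ (- `|- b|) * d `^ (- `|b - 1|).
have A0 : 0 < A by rewrite mulr_gt0 ?powR_gt0.
have [N0 hN0] : exists N0 : nat, `|b| * r <= (1 - r) / 2 * N0%:R.
  have hp : 0 < (1 - r) / 2 by lra.
  exists (Num.truncn (((1 - r) / 2)^-1 * (`|b| * r))).+1.
  by rewrite -ler_pdivrMl // ltW // truncnS_gt.
have [N HN] : exists M, forall k, (M <= k)%N -> u k <= e / A.
  apply: (@ratio_small _ ((1 + r) / 2) N0); [lra|lra| |by rewrite divr_gt0].
  move=> k hk; rewrite /u.
  have -> : k.+2%:R * `|binc b k.+2| = `|binc b k.+1| * `|b + k.+1%:R|.
    by rewrite -[k.+2%:R in LHS]ger0_norm // -normrM mulrC bincS normrM.
  have h1 : `|b + k.+1%:R| <= `|b| + k.+1%:R.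
    by apply: (le_trans (ler_normD _ _)); rewrite [`|k.+1%:R|]ger0_norm.
  rewrite exprS.
  have -> : `|binc b k.+1| * `|b + k.+1%:R| * (r * r ^+ k) =
     (`|b + k.+1%:R| * r) * (`|binc b k.+1| * r ^+ k) by ring.
  have -> : (1 + r) / 2 * (k.+1%:R * `|binc b k.+1| * r ^+ k) =
     ((1 + r) / 2 * k.+1%:R) * (`|binc b k.+1| * r ^+ k) by ring.
  rewrite ler_wpM2r ?mulr_ge0 ?exprn_ge0 //.
  apply: (le_trans (ler_wpM2r r0 h1)).
  have h2 : (N0%:R : R) <= k.+1%:R by rewrite ler_nat; lia.
  have h3 : (1 - r) / 2 * N0%:R <= (1 - r) / 2 * k.+1%:R by rewrite ler_wpM2l //; lra.
  have h4 := le_trans hN0 h3; lra.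
exists N => n Nn y y0 yr; have y1 : y < 1 by exact: le_lt_trans r1.
have [x /andP[x0 xy] E] := binpoly_remainder b n y0 y1.
have p : 0 < (1 - y) `^ b by rewrite powR_gt0 // subr_gt0.
have -> : (binpoly b n).[y] - (1 - y) `^ (- b) =
  (1 - y) `^ (- b) * ((1 - y) `^ b * (binpoly b n).[y] - 1).
  by rewrite mulrBr mulr1 mulrA powRN mulVf ?gt_eqF // mul1r.
rewrite E mulNr mulrN normrN !normrM.
rewrite !(ger0_norm (powR_ge0 _ _)) [`|x ^+ n|]ger0_norm ?exprn_ge0 //.
rewrite [`|y|]ger0_norm // [`|n.+1%:R|]ger0_norm //.
have h1 : (1 - y) `^ (- b) <= d `^ (- `|- b|) by apply: powR_bound => //; rewrite /d; lra.
have h2 : (1 - x) `^ (b - 1) <= d `^ (- `|b - 1|) by apply: powR_bound => //; rewrite /d; lra.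
have h3 : n.+1%:R * `|binc b n.+1| * x ^+ n <= u n.
  by rewrite /u ler_wpM2l ?mulr_ge0 // lerXn2r ?nnegrE //; lra.
have h4 : n.+1%:R * `|binc b n.+1| * x ^+ n <= e / A by exact: le_trans (HN _ Nn).
apply: (@le_trans _ _ (A * (e / A))); last by rewrite mulrCA divff ?mulr1 // gt_eqF.
set q := e / A in h4 *.
have -> : A * q = d `^ (- `|- b|) * (d `^ (- `|b - 1|) * (q * 1)).
  by rewrite mulr1 mulrA.
rewrite -!mulrA; apply: ler_pM; [nneg|nneg|exact: h1|].
apply: ler_pM; [nneg|nneg|exact: h2|].
by rewrite !mulrA; apply: ler_pM; [nneg|nneg|exact: h4|exact: ltW].
Qed.

Lemma powR_subadd s (x h : R) : 0 < s -> s <= 1 -> 0 <= x -> 0 <= h ->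
  (x + h) `^ s <= x `^ s + h `^ s.
Proof.
move=> s0 s1 x0 h0; have si : 1 <= s^-1 by rewrite invf_ge1.
have := powR_superadd si (powR_ge0 x s) (powR_ge0 h s).
rewrite -!powRrM divff ?gt_eqF // !powRr1 // => H.
apply: (le_trans (ler_powR2 (ltW s0) _ H)); first by rewrite addr_ge0.
by rewrite -powRrM mulVf ?gt_eqF // powRr1 // addr_ge0 ?powR_ge0.
Qed.

Lemma powR_unif_cont s B e : 0 < s -> 0 <= B -> 0 < e ->
  exists2 d, 0 < d & forall x y, 0 <= x -> x <= B -> 0 <= y -> y <= B ->
    `|x - y| <= d -> `|x `^ s - y `^ s| <= e.
Proof.
move=> s0 B0 e0.
pose K := s * B `^ (s - 1) + 1.
have K0 : 0 < K by rewrite ltr_wpDl // mulr_ge0 ?powR_ge0 // ltW.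
exists (Num.min (e `^ s^-1) (e / K)); first by rewrite lt_min powR_gt0 ?divr_gt0.
move=> x y; wlog xy : x y / x <= y.
  move=> H x0 xB y0 yB h; case: (leP x y) => [xy|/ltW xy]; first exact: H.
  by rewrite distrC; apply: H => //; rewrite distrC.
move=> x0 xB y0 yB; rewrite [`|x - y|]distrC [`|x `^ s - _|]distrC.
rewrite !ger0_norm ?subr_ge0 // ?ler_powR2 ?(ltW s0) // le_min => /andP[h1 h2].
case: (leP s 1) => s1.
  have -> : y `^ s = (x + (y - x)) `^ s by rewrite addrC subrK.
  have yx : 0 <= y - x by rewrite subr_ge0.
  rewrite lerBlDl; apply: (le_trans (powR_subadd s0 s1 x0 yx)); rewrite lerD2l.
  apply: (le_trans (ler_powR2 (ltW s0) yx h1)).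
  by rewrite -powRrM mulVf ?gt_eqF // powRr1 // ltW.
have := powR_tangent (ltW s1) x0 y0; rewrite -lerBrDl => T.
have T2 : y `^ s - x `^ s <= s * y `^ (s - 1) * (y - x) by nra.
apply: (le_trans T2); apply: (@le_trans _ _ (K * (e / K))); last first.
  by rewrite mulrCA divff ?mulr1 // gt_eqF.
apply: ler_pM => //; rewrite ?subr_ge0 ?mulr_ge0 ?powR_ge0 ?(ltW s0) //.
rewrite /K ler_wpDr // ler_wpM2l ?(ltW s0) // ler_powR2 //; lra.
Qed.

(** The power is not smooth at [0], but its shift [(u + d) `^ s] is close to it for
    small [d > 0] and has a binomial series that converges uniformly on the whole
    interval. *)
Lemma powR_poly_approx s B e : 0 < s -> 0 < B -> 0 < e ->
  exists Q : {poly R}, forall u, 0 <= u -> u <= B -> `|Q.[u] - u `^ s| <= e.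
Proof.
move=> s0 B0 e0; have e2 : 0 < e / 2 by lra.
have B1 : 0 <= B + 1 by lra.
have [d0 d0p Hd] := powR_unif_cont s0 B1 e2.
pose d := Num.min d0 1; have dp : 0 < d by rewrite lt_min d0p ltr01.
have [dd0 d1] : d <= d0 /\ d <= 1 by rewrite /d !ge_min !lexx orbT.
pose A := B + d; have A0 : 0 < A by rewrite addr_gt0.
pose r := B / A; have r0 : 0 <= r by rewrite divr_ge0 // ltW.
have r1 : r < 1 by rewrite ltr_pdivrMr // mul1r ltrDl.
have As : 0 < A `^ s by rewrite powR_gt0.
have [N HN] := binpoly_cvg (- s) r0 r1 (divr_gt0 e2 As).
(* The substituted argument [y] satisfies [1 - y = (u + d) / A] and [0 <= y <= r]. *)
exists (A `^ s *: (binpoly (- s) N \Po ((B / A)%:P - A^-1 *: 'X))) => u u0 uB.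
rewrite hornerZ horner_comp !(hornerD, hornerN, hornerC, hornerZ, hornerX).
set y := _ - _ * u.
have yE : 1 - y = (u + d) / A by rewrite /y /A; field; rewrite gt_eqF.
have y0 : 0 <= y by rewrite /y [_ * u]mulrC -mulrBl divr_ge0 ?subr_ge0 // ltW.
have yr : y <= r by rewrite /y /r gerBl mulr_ge0 // invr_ge0 ltW.
have := HN _ (leqnn N) y y0 yr; rewrite opprK yE => h.
have -> : A `^ s * (binpoly (- s) N).[y] - u `^ s =
  A `^ s * ((binpoly (- s) N).[y] - ((u + d) / A) `^ s) + ((u + d) `^ s - u `^ s).
  rewrite mulrBr -powRM ?divr_ge0 ?(ltW A0) ?addr_ge0 ?(ltW dp) // mulrCA divff ?gt_eqF // mulr1.
  by ring.
apply: (le_trans (ler_normD _ _)).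
have -> : e = e / 2 + e / 2 by lra.
apply: lerD.
  rewrite normrM ger0_norm ?(ltW As) //.
  apply: (le_trans (ler_wpM2l (ltW As) h)).
  by rewrite mulrCA divff ?mulr1 // gt_eqF.
apply: Hd; try lra.
by rewrite addrAC subrr add0r ger0_norm // ltW.
Qed.

Lemma harmonic_le_ln n : \sum_(1 <= j < n.+2) (j%:R : R)^-1 <= 1 + ln n.+1%:R.
Proof.
elim: n => [|n ih]; first by rewrite big_nat1 invr1 ln1 addr0.
rewrite big_nat_recr //=; apply: (le_trans (lerD ih (lexx _))).
have h : ln (1 + (- n.+2%:R^-1)) <= - n.+2%:R^-1 :> R.
  by apply: le_ln1Dx; rewrite ltrN2 invf_lt1 ?ltr0n // ltr1n.
have e : 1 + (- n.+2%:R^-1) = n.+1%:R / n.+2%:R :> R.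
  by rewrite -[n.+2%:R]natr1 -[n.+1%:R]natr1; field; rewrite natr1 natr1 pnatr_eq0.
move: h; rewrite e ln_div ?posrE ?ltr0n //.
by move: (ln _) (ln _) (_^-1) => *; lra.
Qed.

(** The quotient of the two coefficients is a product of factors
    [1 + g / (d + j)], and the harmonic sum is logarithmic: this trades a power of
    [k] for a change of the exponent of the binomial series. *)
Lemma binc_shift d g : 0 < d -> 0 <= g -> exists2 C, 0 < C &
  forall k, binc (d + g) k.+1 <= C * k.+1%:R `^ g * binc d k.+1.
Proof.
move=> d0 g0.
have c0 : 0 < 1 + g / d by rewrite ltr_pwDl // divr_ge0 // ltW.
exists ((1 + g / d) * expR g); first by rewrite mulr_gt0 ?expR_gt0.
move=> k.
have H : binc (d + g) k.+1 <=
    (1 + g / d) * expR (g * \sum_(1 <= j < k.+1) j%:R^-1) * binc d k.+1.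
  elim: k => [|k ih].
    rewrite big_geq // mulr0 expR0 mulr1 /binc !big_ord1 !addr0 !divr1.
    by rewrite le_eqVlt; apply/orP; left; apply/eqP; field; rewrite gt_eqF.
  rewrite -(@ler_pM2r _ k.+2%:R) ?ltr0n // bincS -[_ * binc d k.+2 * _]mulrA bincS.
  rewrite big_nat_recr //= [g * (_ + _)]mulrDr expRD.
  set E := expR (g * \sum_(_ <= _ < _) _) in ih *.
  have -> : (1 + g / d) * (E * expR (g / k.+1%:R)) * (binc d k.+1 * (d + k.+1%:R)) =
    ((1 + g / d) * E * binc d k.+1) * (expR (g / k.+1%:R) * (d + k.+1%:R)) by ring.
  have dk : 0 < d + k.+1%:R by rewrite addr_gt0 ?ltr0n.
  apply: ler_pM => //; rewrite ?binc_ge0 ?addr_ge0 // ?(ltW d0) //.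
  rewrite -ler_pdivrMr //; apply: (le_trans _ (expR_ge1Dx _)).
  have -> : d + g + k.+1%:R = (d + k.+1%:R) + g by ring.
  rewrite mulrDl divff ?gt_eqF // lerD2l ler_wpM2l // lef_pV2 ?posrE ?ltr0n //.
  by rewrite lerDr ltW.
apply: (le_trans H); rewrite ler_wpM2r ?binc_ge0 ?(ltW d0) // -mulrA ler_wpM2l ?(ltW c0) //.
rewrite /powR pnatr_eq0 /= -expRD ler_expR.
have -> : g + g * ln k.+1%:R = g * (1 + ln k.+1%:R) by ring.
rewrite ler_wpM2l //; apply: le_trans (harmonic_le_ln k).
by rewrite [leRHS]big_nat_recr //= lerDl invr_ge0.
Qed.

End Binomial.

(** * The complex modulus; approximating exponentials and logarithms *)

Section Modulus.
Variable R : realType.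
Local Notation C := R[i].
Implicit Types z w x : C.

Lemma cmod_ge0 z : 0 <= cmod z. Proof. by case: z => a b; rewrite sqrtr_ge0. Qed.

Lemma cmodM z w : cmod (z * w) = cmod z * cmod w.
Proof. exact: ComplexField.Normc.normcM. Qed.

Lemma cmodD z w : cmod (z + w) <= cmod z + cmod w.
Proof. exact: le_normcD. Qed.

Lemma cmodN z : cmod (- z) = cmod z. Proof. exact: normcN. Qed.

Lemma cmodB z w : cmod (z - w) <= cmod z + cmod w.
Proof. by rewrite -(cmodN w) cmodD. Qed.

Lemma cmod0 : cmod (0 : C) = 0. Proof. exact: ComplexField.Normc.normc0. Qed.

Lemma cmod1 : cmod (1 : C) = 1. Proof. exact: ComplexField.Normc.normc1. Qed.

Lemma cmodV z : cmod z^-1 = (cmod z)^-1.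
Proof. exact: ComplexField.Normc.normcV. Qed.

Lemma cmod_eq0 z : (cmod z == 0) = (z == 0).
Proof.
by apply/eqP/eqP => [/ComplexField.Normc.eq0_normc //|->]; exact: cmod0.
Qed.

Lemma cmodX z n : cmod (z ^+ n) = cmod z ^+ n.
Proof. by elim: n => [|n ih]; rewrite ?expr0 ?cmod1 // !exprS cmodM ih. Qed.

Lemma cmod_real (a : R) : cmod a%:C = `|a|.
Proof. by rewrite /cmod /= expr0n /= addr0 sqrtr_sqr. Qed.

Lemma cmod_sq z : cmod z ^+ 2 = Re z ^+ 2 + Im z ^+ 2.
Proof. by case: z => a b /=; rewrite sqr_sqrtr // addr_ge0 ?sqr_ge0. Qed.

Lemma cmodJ z : cmod (conjc z) = cmod z.
Proof. by case: z => a b; rewrite /cmod /= sqrrN. Qed.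

Lemma mulJ z : z * (conjc z) = (cmod z ^+ 2)%:C.
Proof.
rewrite cmod_sq; case: z => a b; rewrite /=; apply/eqP; rewrite eq_complex /=.
by apply/andP; split; apply/eqP; ring.
Qed.

Lemma cmod_sum (I : Type) (r : seq I) (P : pred I) (F : I -> C) :
  cmod (\sum_(i <- r | P i) F i) <= \sum_(i <- r | P i) cmod (F i).
Proof.
elim/big_rec2: _ => [|i a b _ h]; first by rewrite cmod0.
by apply: (le_trans (cmodD _ _)); rewrite lerD2l.
Qed.

Lemma cmod_prod (I : Type) (r : seq I) (P : pred I) (F : I -> C) :
  cmod (\prod_(i <- r | P i) F i) = \prod_(i <- r | P i) cmod (F i).
Proof. by elim/big_rec2: _ => [|i a b _ h]; rewrite ?cmod1 // cmodM h. Qed.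

Lemma ReD z w : Re (z + w) = Re z + Re w. Proof. by case: z; case: w. Qed.

Lemma ReN z : Re (- z) = - Re z. Proof. by case: z. Qed.

Lemma Re_realM (a : R) z : Re (a%:C * z) = a * Re z.
Proof. by case: z => b c /=; rewrite mul0r subr0. Qed.

Lemma Re_sum (I : Type) (r : seq I) (P : pred I) (F : I -> C) :
  Re (\sum_(i <- r | P i) F i) = \sum_(i <- r | P i) Re (F i).
Proof. by elim/big_rec2: _ => // i a b _ <-; rewrite ReD. Qed.

Lemma Re_le_cmod z : `|Re z| <= cmod z.
Proof.
rewrite -(@ler_pXn2r _ 2) ?nnegrE ?cmod_ge0 // cmod_sq real_normK ?num_real //.
by rewrite lerDl sqr_ge0.
Qed.

Lemma cmod_dist z w : `|cmod z - cmod w| <= cmod (z - w).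
Proof.
rewrite ler_norml; apply/andP; split; last first.
  by rewrite lerBlDr; apply: le_trans (cmodD _ _); rewrite subrK.
rewrite lerNl opprB lerBlDr -[cmod (z - w)]cmodN opprB; apply: le_trans (cmodD _ _).
by rewrite subrK.
Qed.

Lemma cmod_gt0 z : z != 0 -> 0 < cmod z.
Proof. by move=> z0; rewrite lt_def cmod_eq0 z0 cmod_ge0. Qed.

Lemma cmodD_sq z w : cmod (z + w) ^+ 2 = cmod z ^+ 2 + 2 * Re ((conjc z) * w) + cmod w ^+ 2.
Proof. by rewrite !cmod_sq; case: z => a b; case: w => c d /=; ring. Qed.

Lemma conj_sum (I : Type) (r : seq I) (F : I -> C) :
  (conjc (\sum_(i <- r) F i)) = \sum_(i <- r) (conjc (F i)).
Proof. by rewrite raddf_sum. Qed.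

Lemma real_complex_sum (I : Type) (r : seq I) (F : I -> R) :
  (\sum_(i <- r) F i)%:C = \sum_(i <- r) (F i)%:C.
Proof. by rewrite rmorph_sum. Qed.

(** The squared modulus of [1 + x / m] is [1 + 2 Re x / m + O(m ^ (- 2))]. Uniformity
    in [x] lets a polynomial [(1 + x / m) ^+ m] replace the exponential of a
    Dirichlet polynomial at every point of the imaginary axis at once. *)
Lemma euler_exp (B e : R) : 0 <= B -> 0 < e ->
  exists N, forall m, (N < m)%N -> forall x, cmod x <= B ->
    expR (Re x - e) <= cmod (1 + x * (m%:R^-1)%:C) ^+ m <= expR (Re x + e).
Proof.
move=> B0 e0; pose D := 2 * B + B ^+ 2 + 1.
have D1 : 1 <= D by rewrite /D; have := sqr_ge0 B; lra.
pose X := 2 * D + D ^+ 2 / e + B ^+ 2 / e.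
have X0 : 0 <= X by rewrite !addr_ge0 ?divr_ge0 ?sqr_ge0 ?(ltW e0) //; lra.
exists (Num.truncn X).+1 => m hm x xB.
have m0 : (0 : R) < m%:R by rewrite ltr0n; lia.
have Xm : X <= m%:R.
  apply: (le_trans (ltW (truncnS_gt X))); rewrite ler_nat; exact: ltnW.
have [h1 h2 h3] : [/\ 2 * D <= m%:R, D ^+ 2 / e <= m%:R & B ^+ 2 / e <= m%:R].
  have a1 : 0 <= D ^+ 2 / e by rewrite divr_ge0 ?sqr_ge0 // ltW.
  have a2 : 0 <= B ^+ 2 / e by rewrite divr_ge0 ?sqr_ge0 // ltW.
  by split; rewrite /X in Xm; lra.
pose k := m%:R^-1 : R; have k0 : 0 < k by rewrite invr_gt0.
have mk : m%:R * k = 1 by rewrite /k divff // gt_eqF.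
have k1 : D * k <= 2^-1.
  by rewrite /k ler_pdivrMr // mulrC -ler_pdivrMr ?invr_gt0 // invrK mulrC.
have k2 : D ^+ 2 * k <= e.
  by rewrite ler_pdivrMr // mulrC -ler_pdivrMr.
have k3 : B ^+ 2 * k <= e.
  by rewrite ler_pdivrMr // mulrC -ler_pdivrMr.
pose y := 2 * Re x * k + cmod x ^+ 2 * k ^+ 2.
have yE : cmod (1 + x * k%:C) ^+ 2 = 1 + y.
  rewrite cmodD_sq cmod1 cmodM cmod_real ger0_norm ?(ltW k0) // expr1n exprMn.
  rewrite rmorph1 mul1r [x * _]mulrC Re_realM /y; ring.
have xx := cmod_ge0 x.
have Rx := le_trans (Re_le_cmod x) xB.
have xB2 : cmod x ^+ 2 <= B ^+ 2 by rewrite lerXn2r ?nnegrE.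
have kk1 : k <= 1.
  have kD : k <= D * k by rewrite ler_peMl // ltW.
  lra.
have ny : `|y| <= D * k.
  apply: (le_trans (ler_normD _ _)).
  rewrite 2!normrM (ger0_norm (ltW k0)) [`|2|]ger0_norm //.
  rewrite [`|_ * k ^+ 2|]ger0_norm; last by nneg.
  have -> : D * k = 2 * B * k + (B ^+ 2 * k + k) by rewrite /D; ring.
  apply: lerD.
    by rewrite ler_wpM2r ?(ltW k0) // ler_wpM2l.
  apply: (@le_trans _ _ (B ^+ 2 * k)); last by rewrite lerDl ltW.
  apply: ler_pM; [nneg|nneg|exact: xB2|].
  by rewrite expr2 ler_piMl // ltW.
have yh : - 2^-1 <= y by move: (le_trans ny k1); rewrite ler_norml => /andP[].
have p : 0 < 1 + y by lra.
have E2 : (cmod (1 + x * k%:C) ^+ m) ^+ 2 = (1 + y) ^+ m by rewrite exprAC yE.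
apply/andP; split; rewrite -(@ler_pXn2r _ 2) ?nnegrE ?expR_ge0 ?exprn_ge0 ?cmod_ge0 // E2.
  apply: (@le_trans _ _ (expR (y - 2 * y ^+ 2) ^+ m)); last first.
    by rewrite lerXn2r ?nnegrE ?expR_ge0 ?(ltW p) // expR_le_1D.
  rewrite -!expRM_natr ler_expR.
  have y2 : y ^+ 2 <= (D * k) ^+ 2.
    by rewrite -[y ^+ 2]real_normK ?num_real // lerXn2r ?nnegrE // mulr_ge0 ?ltW //; lra.
  have e1 : 2 * y ^+ 2 * m%:R <= 2 * e.
    rewrite -mulrA ler_wpM2l //; apply: (le_trans (ler_wpM2r (ltW m0) y2)).
    rewrite (_ : (D * k) ^+ 2 * m%:R = D ^+ 2 * k * (m%:R * k)); last by ring.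
    by rewrite mk mulr1.
  have e2 : y * m%:R = 2 * Re x + cmod x ^+ 2 * k.
    rewrite /y (_ : _ * m%:R = 2 * Re x * (m%:R * k) + cmod x ^+ 2 * k * (m%:R * k)); last by ring.
    by rewrite mk; ring.
  rewrite [(y - _) * _]mulrBl e2.
  have : 0 <= cmod x ^+ 2 * k by rewrite mulr_ge0 ?sqr_ge0 // ltW.
  lra.
apply: (@le_trans _ _ (expR y ^+ m)).
  by rewrite lerXn2r ?nnegrE ?expR_ge0 ?(ltW p) // expR_ge1Dx.
rewrite -!expRM_natr ler_expR.
have e2 : y * m%:R = 2 * Re x + cmod x ^+ 2 * k.
  rewrite /y (_ : _ * m%:R = 2 * Re x * (m%:R * k) + cmod x ^+ 2 * k * (m%:R * k)); last by ring.
  by rewrite mk; ring.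
have : cmod x ^+ 2 * k <= B ^+ 2 * k by rewrite ler_wpM2r // ltW.
rewrite e2; lra.
Qed.

Definition nlog1B (n : nat) z : C := \sum_(k < n) z ^+ k.+1 * (k.+1%:R^-1)%:C.

(** [nlog1B n] is a partial sum of the series of [- log (1 - z)]. By the mean value
    theorem along the segment [s * z], [0 <= s <= 1], the error is controlled by
    its derivative, the tail of a geometric series. *)
Lemma nlog1B_approx n z : cmod z < 1 ->
  `|Re (nlog1B n z) + ln (cmod (1 - z))| <= cmod z ^+ n.+1 / (1 - cmod z).
Proof.
move=> z1; pose P : {poly R} := \sum_(k < n) (Re (z ^+ k.+1) / k.+1%:R) *: 'X^(k.+1).
pose q : {poly R} := 1%:P - (2 * Re z) *: 'X + (cmod z ^+ 2) *: 'X^2.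
have qE s : q.[s] = cmod (1 - s%:C * z) ^+ 2.
  rewrite /q !(hornerD, hornerN, hornerC, hornerZ, hornerX, hornerXn) -[1 - _%:C * _]/(1 + - _).
  rewrite cmodD_sq cmod1 cmodN cmodM cmod_real exprMn real_normK ?num_real // rmorph1 mul1r ReN Re_realM.
  ring.
have low (s : R) : 0 <= s -> s <= 1 -> 1 - cmod z <= cmod (1 - s%:C * z).
  move=> s0 s1; have := cmod_dist 1 (s%:C * z); rewrite cmod1 cmodM cmod_real (ger0_norm s0).
  move=> /(le_trans (ler_norm _)); apply: le_trans.
  by rewrite lerD2l lerN2 ler_piMl // cmod_ge0.
have zp : 0 < 1 - cmod z by rewrite subr_gt0.
have q0 (s : R) : 0 <= s -> s <= 1 -> 0 < q.[s].
  by move=> s0 s1; rewrite qE exprn_gt0 //; exact: lt_le_trans (low _ s0 s1).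
pose h s := P.[s] + 2^-1 * ln q.[s].
pose dh s := P^`().[s] + 2^-1 * (q.[s]^-1 * q^`().[s]).
have hD (s : R) : 0 <= s -> s <= 1 -> is_derive s (1 : R) h (dh s).
  move=> s0 s1; rewrite /h /dh; apply: is_deriveD.
  by apply: is_deriveZ; apply: is_derive1_comp; exact: is_derive1_ln (q0 _ s0 s1).
have [||s + e] := @MVT_segment R h dh 0 1 ler01.
- by move=> s; rewrite in_itv /= => /andP[a b]; apply: hD; exact: ltW.
- apply: derivable_within_continuous => s; rewrite in_itv /= => /andP[a b].
  by apply: ex_derive; exact: hD.
rewrite in_itv /= => /andP[s0 s1].
have P1 : P.[1] = Re (nlog1B n z).
  rewrite /P /nlog1B Re_sum horner_sum; apply: eq_bigr => k _.
  by rewrite hornerZ hornerXn expr1n mulr1 [_ * _%:C]mulrC Re_realM mulrC.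
have P0 : P.[0] = 0.
  by rewrite /P horner_sum big1 // => k _; rewrite hornerZ hornerXn expr0n mulr0.
have cp : 0 < cmod (1 - z) by have := low 1 ler01 (lexx _); rewrite rmorph1 mul1r; apply: lt_le_trans.
have h1 : h 1 = Re (nlog1B n z) + ln (cmod (1 - z)).
  rewrite /h P1 qE rmorph1 mul1r lnXn // [ln _ *+ 2]mulr2n; congr (_ + _).
  by move: (ln _) => l; lra.
have h0 : h 0 = 0 by rewrite /h P0 qE mul0r subr0 cmod1 expr1n ln1 mulr0 addr0.
move: e; rewrite h1 h0 !subr0 mulr1 => ->.
pose G := \sum_(k < n) (s%:C * z) ^+ k.
have PE : P^`().[s] = Re (z * G).
  rewrite /P /G mulr_sumr Re_sum raddf_sum horner_sum; apply: eq_bigr => k _.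
  rewrite [X in X.[_]](_ : _ = ((Re (z ^+ k.+1) / k.+1%:R) *: ('X^(k.+1) : {poly R}))^`()) // derivZ derivXn hornerZ hornerMn hornerXn /= -[s ^+ _ *+ _]mulr_natl mulrA divfK ?pnatr_eq0 //.
  rewrite exprMn -rmorphXn mulrCA -exprS Re_realM mulrC //.
have GE : (1 - s%:C * z) * G = 1 - (s%:C * z) ^+ n by rewrite /G -[1 - s%:C * z]opprB mulNr -subrX1 opprB.
have qD : 2^-1 * q^`().[s] = - Re (z * (conjc (1 - s%:C * z))).
  rewrite /q derivD derivB derivC !derivZ derivX derivXn !(hornerD, hornerN, hornerZ, hornerX, hornerMn, hornerC, hornerXn).
  rewrite cmod_sq; case: (z) => a b /=; rewrite -mulr_natl; field => //.
have dE : dh s * q.[s] = - Re (z * (s%:C * z) ^+ n * (conjc (1 - s%:C * z))).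
  have -> : dh s * q.[s] = P^`().[s] * q.[s] + 2^-1 * q^`().[s].
    by rewrite /dh; field; rewrite gt_eqF ?q0.
  rewrite qD PE.
  have -> : Re (z * G) * q.[s] = Re (z * (1 - (s%:C * z) ^+ n) * (conjc (1 - s%:C * z))).
    rewrite qE mulrC -Re_realM -mulJ -GE; congr Re; ring.
  rewrite -ReN -ReD -ReN; congr Re; ring.
have cs : 0 < cmod (1 - s%:C * z) by exact: lt_le_trans (low _ s0 s1).
have : `|dh s| * q.[s] <= cmod z ^+ n.+1 * cmod (1 - s%:C * z).
  rewrite -[q.[s]]ger0_norm ?(ltW (q0 _ s0 s1)) // -normrM dE normrN.
  apply: (le_trans (Re_le_cmod _)); rewrite 2!cmodM cmodJ cmodX cmodM cmod_real ger0_norm //.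
  rewrite ler_wpM2r ?cmod_ge0 // exprS ler_wpM2l ?cmod_ge0 // exprMn ler_piMl ?exprn_ge0 ?cmod_ge0 //.
  by rewrite exprn_ile1.
rewrite qE expr2 mulrA ler_pM2r // -ler_pdivlMr // => /le_trans; apply.
by rewrite ler_wpM2l ?exprn_ge0 ?cmod_ge0 // lef_pV2 ?posrE // low.
Qed.

End Modulus.

(** * Mean values over the real line *)

Section Means.
Variable R : realType.
Implicit Types (g h : R -> R) (T m e : R).

Definition avg g T : R :=
  (2 * T)^-1 * Rintegral (@lebesgue_measure R) `[- T, T] g.

Definition is_mean g m : Prop := avg g T @[T --> +oo] --> m.

Lemma cont_integrable g T : continuous g ->
  (@lebesgue_measure R).-integrable `[- T, T] (EFin \o g).
Proof.
move=> cg; apply: continuous_compact_integrable; first exact: segment_compact.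
exact: continuous_subspaceT.
Qed.

Lemma avgD g h T : continuous g -> continuous h ->
  avg (fun t => g t + h t) T = avg g T + avg h T.
Proof.
move=> cg ch; rewrite /avg RintegralD ?mulrDr //; exact: cont_integrable.
Qed.

Lemma avgZ (c : R) g T : continuous g -> avg (fun t => c * g t) T = c * avg g T.
Proof.
move=> cg; rewrite /avg RintegralZl //; [by rewrite mulrCA|exact: cont_integrable].
Qed.

Lemma avg_cst (c : R) T : 0 < T -> avg (fun=> c) T = c.
Proof.
move=> T0; rewrite /avg Rintegral_cst //=.
rewrite lebesgue_measure_itv /= lte_fin.
rewrite gtrN // opprK /= mulrCA.
have -> : T + T = 2 * T by rewrite mulr_natl mulr2n.
by rewrite mulVf ?mulr1 // mulf_neq0 // gt_eqF.
Qed.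

Lemma avg_le g h T : 0 < T -> continuous g -> continuous h ->
  (forall t, g t <= h t) -> avg g T <= avg h T.
Proof.
move=> T0 cg ch gh; rewrite /avg ler_wpM2l ?invr_ge0 ?mulr_ge0 ?(ltW T0) //.
by apply: le_Rintegral => //; exact: cont_integrable.
Qed.

Lemma cont_cst (c : R) : continuous (fun _ : R => c).
Proof. by move=> x; exact: cvg_cst. Qed.

Lemma avg_dist g h T e : 0 < T -> continuous g -> continuous h ->
  (forall t, `|g t - h t| <= e) -> `|avg g T - avg h T| <= e.
Proof.
move=> T0 cg ch H.
have cD (f : R -> R) (c : R) : continuous f -> continuous (fun t => f t + c).
  by move=> cf x; apply: cvgD; [exact: cf|exact: cvg_cst].
have key (f1 f2 : R -> R) : continuous f1 -> continuous f2 -> (forall t, f1 t <= f2 t + e) ->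
    avg f1 T <= avg f2 T + e.
  move=> c1 c2 h12; rewrite -[X in _ + X](avg_cst e T0) -avgD //; last exact: cont_cst.
  by apply: avg_le => //; exact: cD.
rewrite ler_distl lerBlDr; apply/andP; split; apply: key => // t;
  by have := H t; rewrite ler_distl => /andP[h1 h2]; lra.
Qed.

Lemma mean_uniq g m1 m2 : is_mean g m1 -> is_mean g m2 -> m1 = m2.
Proof. by move=> h1 h2; exact: (cvg_unique _ h1 h2). Qed.

Lemma mean_ext g h m : g =1 h -> is_mean g m -> is_mean h m.
Proof. by move=> /funext ->. Qed.

Lemma mean_cst (c : R) : is_mean (fun=> c) c.
Proof.
apply: cvg_near_cst; near=> T; apply: avg_cst; near: T; exact: nbhs_pinfty_gt.
Unshelve. all: by end_near. Qed.

Lemma meanD g h m1 m2 : continuous g -> continuous h ->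
  is_mean g m1 -> is_mean h m2 -> is_mean (fun t => g t + h t) (m1 + m2).
Proof.
move=> cg ch h1 h2; rewrite /is_mean (_ : avg _ = fun T => avg g T + avg h T).
  exact: cvgD.
by apply/funext => T; exact: avgD.
Qed.

Lemma meanZ (c : R) g m : continuous g -> is_mean g m -> is_mean (fun t => c * g t) (c * m).
Proof.
move=> cg h1; rewrite /is_mean (_ : avg _ = fun T => c * avg g T).
  by apply: cvgM => //; exact: cvg_cst.
by apply/funext => T; exact: avgZ.
Qed.

Lemma cont_sum (I : Type) (r : seq I) (F : I -> R -> R) :
  (forall i, continuous (F i)) -> continuous (fun t => \sum_(i <- r) F i t).
Proof.
move=> cF; elim: r => [|i r ih].
  by rewrite (_ : (fun t => _) = fun=> 0) ?[X in continuous X]funeqE //;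
     [exact: cont_cst|apply/funext => t; rewrite big_nil].
rewrite (_ : (fun t => _) = fun t => F i t + \sum_(j <- r) F j t).
  by move=> x; apply: cvgD; [exact: cF|exact: ih].
by apply/funext => t; rewrite big_cons.
Qed.

Lemma mean_sum (I : Type) (r : seq I) (F : I -> R -> R) (m : I -> R) :
  (forall i, continuous (F i)) -> (forall i, is_mean (F i) (m i)) ->
  is_mean (fun t => \sum_(i <- r) F i t) (\sum_(i <- r) m i).
Proof.
move=> cF hF; elim: r => [|i r ih].
  rewrite big_nil; apply: (@mean_ext (fun=> 0)); last exact: mean_cst.
  by move=> t; rewrite big_nil.
rewrite big_cons; apply: (@mean_ext (fun t => F i t + \sum_(j <- r) F j t)).
  by move=> t; rewrite big_cons.
by apply: meanD => //; exact: cont_sum.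
Qed.

Lemma mean_le g h m1 m2 : continuous g -> continuous h -> is_mean g m1 -> is_mean h m2 ->
  (forall t, g t <= h t) -> m1 <= m2.
Proof.
move=> cg ch h1 h2 gh; apply: (ler_cvg_to h1 h2).
near=> T; apply: avg_le => //; near: T; exact: nbhs_pinfty_gt.
Unshelve. all: by end_near. Qed.

(** Averages over the same interval of uniformly close functions are close, so the
    averages of [g] satisfy the Cauchy criterion. *)
Lemma mean_exists g : continuous g ->
  (forall e, 0 < e -> exists h m,
     [/\ continuous h, is_mean h m & forall t, `|g t - h t| <= e]) ->
  exists m, is_mean g m.
Proof.
move=> cg H; suff : cvg (avg g T @[T --> +oo]) by move=> c; eexists; exact: c.
apply/cauchy_cvgP; apply: cauchy_exP => e e0.
have e2 : 0 < e / 2 by lra.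
have [h [m [ch hm gh]]] := H _ e2.
exists m; have /cvgrPdist_lt /(_ _ e2) := hm.
have : \forall T \near +oo, (0 : R) < T by exact: nbhs_pinfty_gt.
apply: filterS2 => T T0 hT; rewrite /ball /=.
have := avg_dist T0 cg ch gh => gT.
have -> : m - avg g T = (m - avg h T) + (avg h T - avg g T) by ring.
apply: (le_lt_trans (ler_normD _ _)).
rewrite [ltRHS](_ : e = e / 2 + e / 2); last by lra.
by apply: ltr_leD; [exact: hT|rewrite distrC].
Qed.

(** By the fundamental theorem of calculus the integrals stay bounded while the
    length of the interval grows; this gives the means of sines and cosines. *)
Lemma mean_derivative (F g : R -> R) (B : R) : continuous g ->
  (forall t : R, is_derive t (1 : R) F (g t)) -> (forall t, `|F t| <= B) -> is_mean g 0.
Proof.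
move=> cg dF bF.
have cF : continuous F.
  move=> x; apply: differentiable_continuous; apply/derivable1_diffP.
  by apply: ex_derive; exact: dF.
have avgE T : 0 < T -> avg g T = (2 * T)^-1 * (F T - F (- T)).
  move=> T0; rewrite /avg /Rintegral (@continuous_FTC2 R g F) //.
  - by rewrite gtrN.
  - exact: continuous_subspaceT.
  - split; first by move=> x _; apply: ex_derive; exact: dF.
    + by apply: cvg_at_right_filter; exact: cF.
    + by apply: cvg_at_left_filter; exact: cF.
  - by move=> x _; rewrite derive1E; apply: derive_val; exact: dF.
apply/cvgrPdist_le => e e0; near=> T.
have T0 : 0 < T by near: T; exact: nbhs_pinfty_gt.
have TB : B / e <= T by near: T; apply: nbhs_pinfty_ge; exact: num_real.
rewrite sub0r normrN avgE // normrM ger0_norm ?invr_ge0 ?mulr_ge0 ?(ltW T0) //.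
rewrite ler_pdivrMl ?mulr_gt0 //; apply: (le_trans (ler_normB _ _)).
apply: (le_trans (lerD (bF _) (bF _))).
rewrite ler_pdivrMr // in TB; nra.
Unshelve. all: by end_near. Qed.

Lemma cont_mull (c : R) : continuous (fun t : R => t * c).
Proof. by move=> x; apply: cvgM; [exact: cvg_id|exact: cvg_cst]. Qed.

Lemma cont_cosM (c : R) : continuous (fun t : R => cos (t * c)).
Proof.
move=> x; have := @continuous_comp R R R (fun t : R => t * c) (@cos R) x.
by apply; [exact: cont_mull|exact: continuous_cos].
Qed.

Lemma cont_sinM (c : R) : continuous (fun t : R => sin (t * c)).
Proof.
move=> x; have := @continuous_comp R R R (fun t : R => t * c) (@sin R) x.
by apply; [exact: cont_mull|exact: continuous_sin].
Qed.

Lemma derive_mull (c t : R) : is_derive t (1 : R) (fun t : R => t * c) c.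
Proof.
have h := @is_deriveZ R R R id c t 1 1 (is_derive_id _ _).
apply: (@is_derive_eq R R R _ _ _ c (c *: 1)); last by rewrite /GRing.scale /= mulr1.
by rewrite (_ : (fun t => t * c) = c \*: id) //; apply/funext => u; rewrite /= mulrC.
Qed.

Lemma mean_cosM (c : R) : is_mean (fun t => cos (t * c)) (c == 0)%:R.
Proof.
have [->|c0] := eqVneq c 0.
  by apply: (@mean_ext (fun=> 1)); [move=> t; rewrite mulr0 cos0|exact: mean_cst].
apply: (@mean_derivative (fun t => c^-1 * sin (t * c)) _ `|c^-1|); first exact: cont_cosM.
  move=> t.
  have h1 := @is_derive1_comp R sin (fun t => t * c) t _ _ (is_derive_sin _) (derive_mull c t).
  have h2 := @is_deriveZ R R R _ c^-1 t 1 _ h1.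
  by apply: (is_derive_eq h2); rewrite /GRing.scale /= mulrC -mulrA divff ?mulr1.
move=> t; rewrite normrM ler_piMr // ler_norml sin_geN1 sin_le1 //.
Qed.

Lemma mean_sinM (c : R) : is_mean (fun t => sin (t * c)) 0.
Proof.
have [->|c0] := eqVneq c 0.
  by apply: (@mean_ext (fun=> 0)); [move=> t; rewrite mulr0 sin0|exact: mean_cst].
apply: (@mean_derivative (fun t => - c^-1 * cos (t * c)) _ `|c^-1|); first exact: cont_sinM.
  move=> t.
  have h1 := @is_derive1_comp R cos (fun t => t * c) t _ _ (is_derive_cos _) (derive_mull c t).
  have h2 := @is_deriveZ R R R _ (- c^-1) t 1 _ h1.
  apply: (is_derive_eq h2); rewrite /GRing.scale /=; field; exact: c0.
move=> t; rewrite normrM normrN ler_piMr // ler_norml cos_geN1 cos_le1 //.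
Qed.

End Means.

(** * Dirichlet polynomials and trigonometric forms *)

Section Forms.
Variable R : realType.
Local Notation C := R[i].
Implicit Types (z w : C) (t u p : R) (chi : nat -> C).

Lemma conjM z w : (conjc (z * w)) = (conjc z) * (conjc w).
Proof. exact: rmorphM. Qed.

(** [n ^ (- i t)]. *)
Definition nchar (t : R) (n : nat) : C := cos (t * ln n%:R) -i* sin (t * ln n%:R).

Definition unichar chi : Prop :=
  (forall m n, (0 < m)%N -> (0 < n)%N -> chi (m * n)%N = chi m * chi n) /\
  (forall n, (0 < n)%N -> cmod (chi n) = 1).

Lemma lnM_nat m n : (0 < m)%N -> (0 < n)%N ->
  ln (m * n)%:R = ln m%:R + ln n%:R :> R.
Proof. by move=> m0 n0; rewrite natrM lnM ?posrE ?ltr0n. Qed.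

Lemma ncharM t m n : (0 < m)%N -> (0 < n)%N -> nchar t (m * n) = nchar t m * nchar t n.
Proof.
move=> m0 n0; rewrite /nchar lnM_nat // mulrDr cosD sinD.
by apply/eqP; rewrite eq_complex /=; apply/andP; split; apply/eqP; ring.
Qed.

Lemma cmod_nchar t n : cmod (nchar t n) = 1.
Proof.
apply/eqP; rewrite -(@eqrXn2 _ 2) ?cmod_ge0 // cmod_sq /= sqrrN.
by rewrite cos2Dsin2 expr1n.
Qed.

Lemma nchar_unichar t : unichar (nchar t).
Proof. by split; [exact: ncharM|move=> n _; exact: cmod_nchar]. Qed.

Lemma ncharX t q k : (0 < q)%N -> nchar t (q ^ k) = nchar t q ^+ k.
Proof.
move=> q0; elim: k => [|k ih]; last by rewrite expnS ncharM ?expn_gt0 ?q0 // ih exprS.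
rewrite expn0 expr0 /nchar ln1 mulr0 cos0 sin0 oppr0.
by apply/eqP; rewrite eq_complex /= !eqxx.
Qed.

Lemma unichar_unit chi n : unichar chi -> (0 < n)%N -> chi n * (conjc (chi n)) = 1.
Proof. by move=> [_ h] n0; rewrite mulJ h // expr1n. Qed.

(** A Dirichlet polynomial as a list of terms. Repeated and unordered indices are
    allowed, so that products, sums and substitutions are plain list operations. *)
Definition dlist := seq (C * nat).

Definition dpos (D : dlist) := all (fun x => 0 < x.2)%N D.

Definition ev (D : dlist) chi : C := \sum_(x <- D) x.1 * chi x.2.

Definition dsize (D : dlist) : R := \sum_(x <- D) cmod x.1.

Lemma dsize_ge0 D : 0 <= dsize D.
Proof. by apply: sumr_ge0 => i _; exact: cmod_ge0. Qed.

Lemma ev_le D chi : unichar chi -> dpos D -> cmod (ev D chi) <= dsize D.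
Proof.
move=> [_ h]; rewrite /ev /dsize; elim: D => [|a D ih] /=; first by rewrite !big_nil cmod0.
move=> /andP[a0 D0]; rewrite !big_cons; apply: (le_trans (cmodD _ _)).
by rewrite lerD ?ih // cmodM h // mulr1.
Qed.

(** Polynomials in the values of a character and their conjugates; the means of
    these are explicit. *)
Definition tform := seq (C * (nat * nat)).

Definition tpos (P : tform) := all (fun x => (0 < x.2.1) && (0 < x.2.2))%N P.

Definition tev (P : tform) chi : C := \sum_(x <- P) x.1 * (chi x.2.1 * (conjc (chi x.2.2))).

Definition tmean (P : tform) : C := \sum_(x <- P | x.2.1 == x.2.2) x.1.

Lemma Re_term c t m n : Re (c * (nchar t m * (conjc (nchar t n)))) =
  Re c * cos (t * (ln m%:R - ln n%:R)) + Im c * sin (t * (ln m%:R - ln n%:R)).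
Proof. by rewrite mulrBr cosB sinB; case: c => a b /=; ring. Qed.

Lemma cont_term c m n : continuous (fun t => Re (c * (nchar t m * (conjc (nchar t n))))).
Proof.
rewrite (_ : (fun t => _) = fun t => Re c * cos (t * (ln m%:R - ln n%:R)) +
   Im c * sin (t * (ln m%:R - ln n%:R))); last by apply/funext => t; exact: Re_term.
move=> x; apply: cvgD; apply: cvgM; try exact: cvg_cst; [exact: cont_cosM|exact: cont_sinM].
Qed.

Lemma cont_tev P : continuous (fun t => Re (tev P (nchar t))).
Proof.
rewrite (_ : (fun t => _) =
    fun t => \sum_(x <- P) Re (x.1 * (nchar t x.2.1 * (conjc (nchar t x.2.2))))).
  by apply: cont_sum => i; exact: cont_term.
by apply/funext => t; rewrite /tev Re_sum.
Qed.

Lemma ln_nat_inj m n : (0 < m)%N -> (0 < n)%N ->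
  (ln m%:R - ln n%:R == 0 :> R) = (m == n).
Proof.
move=> m0 n0; rewrite subr_eq0; apply/eqP/eqP => [/ln_inj|-> //].
by rewrite !posrE !ltr0n => /(_ m0 n0) /eqP; rewrite eqr_nat => /eqP.
Qed.

(** Orthogonality: [m ^ (- i t) * n ^ (i t)] is an oscillation of frequency
    [ln n - ln m], whose mean vanishes unless [m = n]. *)
Lemma mean_tev P : tpos P -> is_mean (fun t => Re (tev P (nchar t))) (Re (tmean P)).
Proof.
move=> P0; pose m (x : C * (nat * nat)) : R := if ((0 < x.2.1) && (0 < x.2.2))%N then
   (x.2.1 == x.2.2)%:R * Re x.1 else 0.
have -> : Re (tmean P) = \sum_(x <- P) m x.
  rewrite /tmean Re_sum big_mkcond [RHS]big_seq [LHS]big_seq; apply: eq_bigr => x xP.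
  by rewrite /m (allP P0 _ xP); case: eqP; rewrite ?mul1r ?mul0r.
pose F (x : C * (nat * nat)) (t : R) : R := if ((0 < x.2.1) && (0 < x.2.2))%N then
   Re (x.1 * (nchar t x.2.1 * (conjc (nchar t x.2.2)))) else 0.
apply: (@mean_ext _ (fun t => \sum_(x <- P) F x t)).
  move=> t; rewrite /tev Re_sum big_seq [RHS]big_seq; apply: eq_bigr => x xP.
  by rewrite /F (allP P0 _ xP).
have cF x : continuous (F x).
  by rewrite /F; case: (_ && _); [exact: cont_term|exact: cont_cst].
apply: mean_sum => // x; rewrite /F /m.
case: (boolP ((0 < x.2.1) && (0 < x.2.2))%N) => [/andP[a b]|_]; last exact: mean_cst.
apply: (@mean_ext _ (fun t => Re x.1 * cos (t * (ln x.2.1%:R - ln x.2.2%:R)) +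
   Im x.1 * sin (t * (ln x.2.1%:R - ln x.2.2%:R)))).
  by move=> t; rewrite Re_term.
have -> : (x.2.1 == x.2.2)%:R * Re x.1 =
    Re x.1 * (ln x.2.1%:R - ln x.2.2%:R == 0 :> R)%:R + Im x.1 * 0.
  by rewrite ln_nat_inj // mulr0 addr0 mulrC.
apply: meanD.
- by move=> y; apply: cvgM; [exact: cvg_cst|exact: cont_cosM].
- by move=> y; apply: cvgM; [exact: cvg_cst|exact: cont_sinM].
- apply: meanZ; [exact: cont_cosM|exact: mean_cosM].
- apply: meanZ; [exact: cont_sinM|exact: mean_sinM].
Qed.

Definition is_form (G : (nat -> C) -> C) : Prop :=
  exists P, tpos P /\ forall chi, unichar chi -> G chi = tev P chi.

Lemma form_cst c : is_form (fun=> c).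
Proof.
exists [:: (c, (1, 1)%N)]; split=> // chi u.
by rewrite /tev big_seq1 /= unichar_unit ?mulr1.
Qed.

Lemma formD G H : is_form G -> is_form H -> is_form (fun chi => G chi + H chi).
Proof.
move=> [P [P0 hP]] [Q [Q0 hQ]]; exists (P ++ Q); split; first by rewrite /tpos all_cat; apply/andP.
by move=> chi u; rewrite /tev big_cat /= hP // hQ.
Qed.

Lemma formM G H : is_form G -> is_form H -> is_form (fun chi => G chi * H chi).
Proof.
move=> [P [P0 hP]] [Q [Q0 hQ]].
exists [seq (x.1 * y.1, ((x.2.1 * y.2.1)%N, (x.2.2 * y.2.2)%N)) | x <- P, y <- Q]; split.
  apply/allP => z /allpairsP[[x y] /= [xP yQ ->]] /=.
  by have /andP[a b] := allP P0 _ xP; have /andP[c d] := allP Q0 _ yQ; rewrite !muln_gt0 a b c d.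
move=> chi u; rewrite hP // hQ // /tev big_allpairs_dep /= mulr_suml.
rewrite big_seq [RHS]big_seq; apply: eq_bigr => x xP; rewrite mulr_sumr.
rewrite big_seq [RHS]big_seq; apply: eq_bigr => y yQ /=.
have /andP[a b] := allP P0 _ xP; have /andP[c d] := allP Q0 _ yQ.
by have [m _] := u; rewrite !m // rmorphM /=; ring.
Qed.

Lemma form_sum (I : Type) (r : seq I) (G : I -> (nat -> C) -> C) :
  (forall i, is_form (G i)) -> is_form (fun chi => \sum_(i <- r) G i chi).
Proof.
move=> h; elim: r => [|i r [P [P0 hP]]].
  by have [P [P0 hP]] := form_cst 0; exists P; split=> // chi u; rewrite big_nil (hP _ u).
have [Q [Q0 hQ]] := formD (h i) (ex_intro _ P (conj P0 (fun chi _ => erefl (tev P chi)))).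
by exists Q; split=> // chi u; rewrite big_cons (hP _ u) (hQ _ u).
Qed.

Lemma formX G n : is_form G -> is_form (fun chi => G chi ^+ n).
Proof.
move=> h; elim: n => [|n ih]; first exact: form_cst.
have [P [P0 hP]] := formM h ih; exists P; split=> // chi u.
by rewrite exprS (hP _ u).
Qed.

Lemma form_ev D : dpos D -> is_form (ev D).
Proof.
move=> D0; exists [seq (x.1, (x.2, 1%N)) | x <- D]; split.
  by apply/allP => y /mapP[x xD ->] /=; rewrite (allP D0 _ xD).
move=> chi [m u]; have c1 : chi 1%N = 1.
  have := m 1%N 1%N erefl erefl; rewrite mul1n => e.
  have n0 : chi 1%N != 0 by rewrite -cmod_eq0 u // oner_eq0.
  by apply: (mulfI n0); rewrite mulr1 -e.
rewrite /ev /tev big_map; apply: eq_bigr => x _ /=.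
by rewrite c1 rmorph1 mulr1.
Qed.

Lemma formJ G : is_form G -> is_form (fun chi => (conjc (G chi))).
Proof.
move=> [P [P0 hP]]; exists [seq (conjc x.1, (x.2.2, x.2.1)) | x <- P]; split.
  by apply/allP => y /mapP[x xP ->] /=; rewrite andbC (allP P0 _ xP).
move=> chi u; rewrite hP // /tev conj_sum big_map; apply: eq_bigr => x _.
by rewrite !conjM conjcK /= [X in _ = _ * X]mulrC.
Qed.

(** [x `^ (p / 2)] is a uniform limit of polynomials in [x], and [|ev D| ^+ 2] is a
    form. The approximation is uniform over all characters, which is what later
    allows to change the character at one prime only. *)
Lemma form_approx D p (e : R) : dpos D -> 0 < p -> 0 < e ->
  exists P, tpos P /\ forall chi, unichar chi ->
    `|cmod (ev D chi) `^ p - Re (tev P chi)| <= e.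
Proof.
move=> D0 p0 e0; pose B := dsize D ^+ 2 + 1.
have B0 : 0 < B by rewrite ltr_wpDl ?sqr_ge0.
have [Q HQ] := powR_poly_approx (divr_gt0 p0 (ltr0Sn R 1)) B0 e0.
have [P [P0 hP]] : is_form (fun chi => \sum_(i <- index_iota 0 (size Q))
    (Q`_i)%:C * (ev D chi * (conjc (ev D chi))) ^+ i).
  apply: form_sum => i; apply: formM; first exact: form_cst.
  by apply: formX; apply: formM; [exact: form_ev|apply: formJ; exact: form_ev].
exists P; split=> // chi u; rewrite -hP // mulJ.
have -> : Re (\sum_(i <- index_iota 0 (size Q)) (Q`_i)%:C * (cmod (ev D chi) ^+ 2)%:C ^+ i)
    = Q.[cmod (ev D chi) ^+ 2].
  rewrite Re_sum horner_coef big_mkord; apply: eq_bigr => i _.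
  by rewrite -rmorphXn Re_realM.
rewrite distrC.
have -> : cmod (ev D chi) `^ p = (cmod (ev D chi) ^+ 2) `^ (p / 2).
  rewrite -powR_mulrn ?cmod_ge0 // -powRrM; congr (_ `^ _); field => //.
apply: HQ; first exact: sqr_ge0.
rewrite /B ler_wpDr // lerXn2r ?nnegrE ?cmod_ge0 ?dsize_ge0 //; exact: ev_le.
Qed.

Lemma cont_powR (f : R -> R) (s : R) : 0 < s -> (forall t, 0 <= f t) ->
  continuous f -> continuous (fun t => f t `^ s).
Proof.
move=> s0 f0 cf x; apply/cvgrPdist_le => e e0.
have B0 : 0 <= f x + 1 by rewrite addr_ge0.
have [d d0 H] := powR_unif_cont s0 B0 e0.
have /cvgrPdist_le /(_ (Num.min d 1)) := cf x.
rewrite lt_min d0 ltr01 => /(_ erefl) h; near=> y.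
have : `|f x - f y| <= Num.min d 1 by near: y.
rewrite le_min => /andP[h1 h2]; apply: H => //; first by rewrite lerDl.
by move: h2; rewrite ler_distl => /andP[h2 h3]; lra.
Unshelve. all: by end_near. Qed.

Lemma cmod_ev_sq D : dpos D -> exists P, tpos P /\ forall chi, unichar chi ->
  cmod (ev D chi) ^+ 2 = Re (tev P chi).
Proof.
move=> D0; have [P [P0 hP]] := formM (form_ev D0) (formJ (form_ev D0)).
by exists P; split=> // chi u; rewrite -hP // mulJ.
Qed.

Lemma cont_cmod_ev D p : dpos D -> 0 < p -> continuous (fun t => cmod (ev D (nchar t)) `^ p).
Proof.
move=> D0 p0; have [P [P0 hP]] := cmod_ev_sq D0.
rewrite (_ : (fun t => _) = fun t => Re (tev P (nchar t)) `^ (p / 2)).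
  apply: cont_powR; [by rewrite divr_gt0| |exact: cont_tev].
  by move=> t; rewrite -hP ?sqr_ge0 //; exact: nchar_unichar.
apply/funext => t; rewrite -hP; last exact: nchar_unichar.
rewrite -powR_mulrn ?cmod_ge0 // -powRrM; congr (_ `^ _); field => //.
Qed.

Definition pmean p (D : dlist) : R :=
  lim (avg (fun t => cmod (ev D (nchar t)) `^ p) T @[T --> +oo]).

Lemma pmeanP p D : dpos D -> 0 < p ->
  is_mean (fun t => cmod (ev D (nchar t)) `^ p) (pmean p D).
Proof.
move=> D0 p0; have [m hm] : exists m, is_mean (fun t => cmod (ev D (nchar t)) `^ p) m.
  apply: mean_exists; first exact: cont_cmod_ev.
  move=> e e0; have [P [P0 hP]] := form_approx D0 p0 e0.
  exists (fun t => Re (tev P (nchar t))), (Re (tmean P)); split.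
  - exact: cont_tev.
  - exact: mean_tev.
  - by move=> t; apply: hP; exact: nchar_unichar.
by rewrite /pmean (cvg_lim (@Rhausdorff R) hm).
Qed.

Lemma pmean_ge0 p D : dpos D -> 0 < p -> 0 <= pmean p D.
Proof.
move=> D0 p0; have := @mean_le R (fun=> 0) _ 0 _ (@cont_cst R 0) (cont_cmod_ev D0 p0)
  (@mean_cst R 0) (pmeanP D0 p0).
apply.
by move=> t; exact: powR_ge0.
Qed.

Lemma pmean_ext p D E : dpos D -> dpos E -> 0 < p ->
  (forall t, cmod (ev D (nchar t)) = cmod (ev E (nchar t))) -> pmean p D = pmean p E.
Proof.
move=> D0 E0 p0 h; apply: (mean_uniq (pmeanP D0 p0)).
by apply: mean_ext (pmeanP E0 p0) => t; rewrite h.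
Qed.

Lemma pmean_le_sum (I : Type) (r : seq I) (c q : I -> R) (E : I -> dlist) (a p : R) D :
  dpos D -> 0 < p -> (forall i, dpos (E i)) -> (forall i, 0 < q i) ->
  (forall t, cmod (ev D (nchar t)) `^ p <=
     a + \sum_(i <- r) c i * cmod (ev (E i) (nchar t)) `^ q i) ->
  pmean p D <= a + \sum_(i <- r) c i * pmean (q i) (E i).
Proof.
move=> D0 p0 E0 q0 H.
have cE i : continuous (fun t => c i * cmod (ev (E i) (nchar t)) `^ q i).
  by move=> x; apply: cvgM; [exact: cvg_cst|apply: cont_cmod_ev].
have cl := cont_cmod_ev D0 p0; have ml := pmeanP D0 p0.
refine (@mean_le R _ _ _ _ cl _ ml _ H).
  by move=> x; apply: cvgD; [exact: cvg_cst|exact: cont_sum].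
apply: meanD; [exact: cont_cst|exact: cont_sum|exact: mean_cst|].
apply: mean_sum => // i; apply: meanZ; [exact: cont_cmod_ev|exact: pmeanP].
Qed.

Lemma pmean_le p q c D E : dpos D -> dpos E -> 0 < p -> 0 < q ->
  (forall t, cmod (ev D (nchar t)) `^ p <= c * cmod (ev E (nchar t)) `^ q) ->
  pmean p D <= c * pmean q E.
Proof.
move=> D0 E0 p0 q0 H.
have := @pmean_le_sum unit [:: tt] (fun=> c) (fun=> q) (fun=> E) 0 p D D0 p0 (fun=> E0) (fun=> q0).
by rewrite big_seq1 add0r; apply=> t; rewrite big_seq1 add0r.
Qed.

Lemma pmean2E D : dpos D ->
  pmean 2 D = Re (\sum_(x <- D) \sum_(y <- D | x.2 == y.2) x.1 * conjc y.1).
Proof.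
move=> D0; pose P : tform := [seq (x.1 * conjc y.1, (x.2, y.2)) | x <- D, y <- D].
have P0 : tpos P.
  apply/allP => z /allpairsP[[x y] /= [xP yQ ->]] /=.
  by rewrite (allP D0 _ xP) (allP D0 _ yQ).
have h := pmeanP D0 (ltr0Sn R 1).
rewrite (mean_uniq h (m2 := Re (tmean P))).
  congr Re; rewrite /tmean big_mkcond big_allpairs_dep /=; apply: eq_bigr => x _.
  by rewrite [RHS]big_mkcond.
apply: mean_ext (mean_tev P0) => t.
rewrite powR_mulrn ?cmod_ge0 //.
rewrite -[LHS]/(Re _) -[RHS]/(Re ((cmod (ev D (nchar t)) ^+ 2)%:C)) -mulJ; congr Re.
rewrite /tev big_allpairs_dep /= /ev conj_sum mulr_suml; apply: eq_bigr => x _.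
by rewrite mulr_sumr; apply: eq_bigr => y _; rewrite conjM mulrACA.
Qed.

End Forms.

(** * Point evaluation in one variable *)

Section OneVariable.
Variable R : realType.
Local Notation C := R[i].
Implicit Types (z w a b : C) (f g h : {poly C}) (p e : R).

Lemma cauchy_schwarz (I : Type) (r : seq I) (x y : I -> R) :
  (\sum_(i <- r) x i * y i) ^+ 2 <= (\sum_(i <- r) x i ^+ 2) * (\sum_(i <- r) y i ^+ 2).
Proof.
rewrite -subr_ge0 -(pmulr_rge0 _ (ltr0Sn R 1)).
have -> : 2 * ((\sum_(i <- r) x i ^+ 2) * (\sum_(i <- r) y i ^+ 2)
    - (\sum_(i <- r) x i * y i) ^+ 2) =
    \sum_(i <- r) \sum_(j <- r) (x i * y j - x j * y i) ^+ 2.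
  set X := \sum_(i <- r) x i ^+ 2; set Y := \sum_(i <- r) y i ^+ 2.
  set S := \sum_(i <- r) x i * y i.
  transitivity (\sum_(i <- r) (x i ^+ 2 * Y + (y i ^+ 2 * X - 2 * (x i * y i) * S))).
    rewrite big_split sumrB /= -!mulr_suml -/X -/Y -mulr_sumr -/S; ring.
  apply: eq_bigr => i _; rewrite !mulr_sumr -sumrB -big_split /=.
  by apply: eq_bigr => j _; ring.
by apply: sumr_ge0 => i _; apply: sumr_ge0 => j _; exact: sqr_ge0.
Qed.

Lemma le_expR_eps (x y : R) : 0 <= y -> (forall e, 0 < e -> x <= expR e * y) -> x <= y.
Proof.
move=> y0 H; apply/ler_addgt0Pr => d d0.
have k0 : 0 < y + d + 1 by lra.
have e0 : 0 < d / (y + d + 1) by rewrite divr_gt0.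
apply: (le_trans (H _ e0)).
have lt1 : d / (y + d + 1) < 1 by rewrite ltr_pdivrMr //; lra.
apply: (le_trans (ler_wpM2r y0 (expR_le_inv1B lt1))).
have -> : 1 - d / (y + d + 1) = (y + 1) / (y + d + 1) by field; rewrite gt_eqF.
rewrite invf_div mulrC mulrA ler_pdivrMr; nra.
Qed.

Lemma iota_index n : iota 0 n = index_iota 0 n.
Proof. by rewrite /index_iota subn0. Qed.

Definition dpoly (n : nat) f : dlist R := [seq (f`_k, (n ^ k)%N) | k <- iota 0 (size f)].

Lemma dpoly_pos n f : (0 < n)%N -> dpos (dpoly n f).
Proof. by move=> n0; apply/allP => x /mapP[k _ ->] /=; rewrite expn_gt0 n0. Qed.

Lemma ev_dpoly n f t : (0 < n)%N -> ev (dpoly n f) (nchar t) = f.[nchar t n].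
Proof.
move=> n0; rewrite /ev big_map horner_coef iota_index big_mkord.
by apply: eq_bigr => k _ /=; rewrite ncharX.
Qed.

Lemma pmean2_dpoly n f : (1 < n)%N ->
  pmean 2 (dpoly n f) = \sum_(k < size f) cmod f`_k ^+ 2.
Proof.
move=> n1; rewrite pmean2E; last by apply: dpoly_pos; exact: ltnW.
rewrite Re_sum big_map iota_index big_mkord.
apply: eq_bigr => k _; rewrite big_map /= iota_index big_mkord.
rewrite (bigD1 k) //= big1 ?addr0; last first.
  by move=> j /andP[/eqP /(expnI n1) e]; rewrite -val_eqE /= e eqxx.
by rewrite mulJ.
Qed.

Lemma horner_le f z : cmod z <= 1 -> cmod f.[z] <= \sum_(k < size f) cmod f`_k.
Proof.
move=> z1; rewrite horner_coef; apply: (le_trans (cmod_sum _ _ _)).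
apply: ler_sum => k _; rewrite cmodM cmodX ler_piMr ?cmod_ge0 //.
by rewrite exprn_ile1 // cmod_ge0.
Qed.

Lemma horner_sq_le f z : cmod z < 1 ->
  cmod f.[z] ^+ 2 * (1 - cmod z ^+ 2) <= \sum_(k < size f) cmod f`_k ^+ 2.
Proof.
move=> z1; have z0 := cmod_ge0 z.
have q0 : 0 < 1 - cmod z ^+ 2 by rewrite subr_gt0 expr_lt1.
rewrite -ler_pdivlMr //.
apply: (@le_trans _ _ ((\sum_(k < size f) cmod f`_k * cmod z ^+ k) ^+ 2)).
  rewrite lerXn2r ?nnegrE ?cmod_ge0 //; first by apply: sumr_ge0 => i _; rewrite mulr_ge0 ?exprn_ge0 ?cmod_ge0.
  rewrite horner_coef; apply: (le_trans (cmod_sum _ _ _)).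
  by apply: ler_sum => k _; rewrite cmodM cmodX.
apply: (le_trans (cauchy_schwarz _ _ _)); apply: ler_wpM2l.
  by apply: sumr_ge0 => i _; exact: sqr_ge0.
rewrite -[leRHS]mul1r ler_pdivlMr // (eq_bigr (fun k : 'I_(size f) => (cmod z ^+ 2) ^+ k)); last first.
  by move=> k _; rewrite exprAC.
rewrite mulrC -[1 - _]opprB mulNr -subrX1 opprB gerBl; nneg.
Qed.

(** Replace each root [a] inside the disc by its reflection [1 / conjc a] (division
    by a Blaschke product): the modulus is unchanged on the unit circle and does
    not decrease inside, since
    [|1 - conjc a * w| ^ 2 - |w - a| ^ 2 = (1 - |a| ^ 2) * (1 - |w| ^ 2)]. *)
Lemma reflect_roots h : h != 0 -> exists c (bs : seq C), [/\ 0 < c,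
  all (fun b => cmod b <= 1) bs,
  (forall z, cmod z = 1 -> cmod h.[z] = c * \prod_(b <- bs) cmod (1 - b * z)) &
  (forall w, cmod w <= 1 -> cmod h.[w] <= c * \prod_(b <- bs) cmod (1 - b * w))].
Proof.
move=> h0; have [r hr] := closed_field_poly_normal h.
have hE z : cmod h.[z] = cmod (lead_coef h) * \prod_(a <- r) cmod (z - a).
  rewrite {1}hr hornerZ cmodM horner_prod cmod_prod; congr (_ * _).
  by apply: eq_bigr => a _; rewrite hornerXsubC.
have l0 : 0 < cmod (lead_coef h) by rewrite cmod_gt0 // lead_coef_eq0.
suff [c [bs [c0 b1 e1 e2]]] : exists c (bs : seq C), [/\ 0 < c,
  all (fun b => cmod b <= 1) bs,
  (forall z, cmod z = 1 -> \prod_(a <- r) cmod (z - a) = c * \prod_(b <- bs) cmod (1 - b * z)) &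
  (forall w, cmod w <= 1 -> \prod_(a <- r) cmod (w - a) <= c * \prod_(b <- bs) cmod (1 - b * w))].
  exists (cmod (lead_coef h) * c), bs; split => //; first exact: mulr_gt0.
    by move=> z z1; rewrite hE e1 // mulrA.
  by move=> w w1; rewrite hE -mulrA ler_pM2l // e2.
elim: r {hr hE} => [|a r [c [bs [c0 b1 e1 e2]]]].
  by exists 1, [::]; split => // z _; rewrite !big_nil mulr1.
have pr0 (l : seq C) (F : C -> C) : 0 <= \prod_(i <- l) cmod (F i).
  by apply: prodr_ge0 => i _; exact: cmod_ge0.
case: (ltP (cmod a) 1) => a1; last first.
  have an0 : a != 0 by rewrite -cmod_eq0 gt_eqF //; exact: lt_le_trans a1.
  have E z : cmod (z - a) = cmod a * cmod (1 - a^-1 * z).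
    rewrite -cmodM mulrBr mulr1 mulrA divff // mul1r -cmodN opprB //.
  exists (cmod a * c), (a^-1 :: bs); split => //.
  - by rewrite mulr_gt0 // cmod_gt0.
  - by rewrite /= b1 andbT cmodV invf_le1 // cmod_gt0.
  - by move=> z z1; rewrite !big_cons e1 // E; ring.
  - move=> w w1; rewrite !big_cons E mulrACA ler_wpM2l ?mulr_ge0 ?cmod_ge0 //.
    exact: e2.
have E w : cmod w <= 1 -> cmod (w - a) <= cmod (1 - conjc a * w).
  move=> w1; rewrite -(@ler_pXn2r _ 2) ?nnegrE ?cmod_ge0 // -subr_ge0.
  have -> : cmod (1 - conjc a * w) ^+ 2 - cmod (w - a) ^+ 2 =
     (1 - cmod a ^+ 2) * (1 - cmod w ^+ 2).
    by rewrite !cmod_sq; case: (a) => a2 a3; case: (w) => w2 w3 /=; ring.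
  by rewrite mulr_ge0 // subr_ge0 exprn_ile1 ?cmod_ge0 // ltW.
have E1 z : cmod z = 1 -> cmod (z - a) = cmod (1 - conjc a * z).
  move=> z1; apply/eqP; rewrite -(@eqrXn2 _ 2) ?cmod_ge0 // -subr_eq0 -oppr_eq0 opprB.
  have -> : cmod (1 - conjc a * z) ^+ 2 - cmod (z - a) ^+ 2 =
     (1 - cmod a ^+ 2) * (1 - cmod z ^+ 2).
    by rewrite !cmod_sq; case: (a) => a2 a3; case: (z) => w2 w3 /=; ring.
  by rewrite z1 expr1n subrr mulr0.
exists c, (conjc a :: bs); split => //.
- by rewrite /= b1 cmodJ ltW.
- by move=> z z1; rewrite !big_cons e1 // E1 // mulrCA.
- move=> w w1; rewrite !big_cons mulrCA; apply: ler_pM; rewrite ?cmod_ge0 ?pr0 //; [exact: E|exact: e2].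
Qed.

(** Without roots in a larger disc, [f ^ (p / 2)] has a holomorphic branch; up to a
    factor [expR e] it is replaced by a polynomial [g], an approximate exponential
    of [p / 2] times a truncated logarithm of [f]. This reduces the exponent [p] to
    the exponent [2]. *)
Lemma zero_free_power f p e (c : R) (bs : seq C) (rho : R) :
  0 < c -> 0 < p -> 0 < e -> 0 <= rho -> rho < 1 -> all (fun b => cmod b <= rho) bs ->
  (forall z, cmod f.[z] = c * \prod_(b <- bs) cmod (1 - b * z)) ->
  exists g, forall z, cmod z <= 1 ->
    cmod f.[z] `^ p <= expR e * cmod g.[z] ^+ 2 /\
    cmod g.[z] ^+ 2 <= expR e * cmod f.[z] `^ p.
Proof.
move=> c0 p0 e0 r0 r1 bsr fE.
have e4 : 0 < e / 4 by lra.
have [K HK] := geometric_small (p / 2 * (size bs)%:R / (1 - rho)) r0 r1 e4.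
pose L b : {poly C} := \sum_(k < K) (b ^+ k.+1 * (k.+1%:R^-1)%:C) *: 'X^(k.+1).
have LE b z : (L b).[z] = nlog1B K (b * z).
  rewrite /L horner_sum; apply: eq_bigr => k _; rewrite hornerZ hornerXn exprMn; ring.
(* [Re A] approximates [p / 2 * ln |f|] on the closed disc. *)
pose A : {poly C} := ((p / 2 * ln c)%:C)%:P - (p / 2)%:C *: \sum_(b <- bs) L b.
have bz b z : b \in bs -> cmod z <= 1 -> cmod (b * z) <= rho.
  move=> bb z1; rewrite cmodM -[rho]mulr1; apply: ler_pM => //; rewrite ?cmod_ge0 //.
  exact: (allP bsr).
have fac b z : b \in bs -> cmod z <= 1 -> 0 < cmod (1 - b * z).
  move=> bb z1; have := cmod_dist 1 (b * z); rewrite cmod1 => /(le_trans (ler_norm _)).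
  apply: lt_le_trans; rewrite subr_gt0; exact: le_lt_trans (bz _ _ bb z1) r1.
have AE z : cmod z <= 1 -> `|Re A.[z] - p / 2 * ln (cmod f.[z])| <= e / 4.
  move=> z1; rewrite fE lnM ?posrE //; last first.
    by rewrite big_seq; apply: prodr_gt0 => b bb; exact: fac.
  have -> : ln (\prod_(b <- bs) cmod (1 - b * z)) = \sum_(b <- bs) ln (cmod (1 - b * z)).
    elim: (bs) fac => [|b l ih] fac'; first by rewrite !big_nil ln1.
    rewrite !big_cons lnM ?ih ?posrE //.
    - by move=> b' z' bl; apply: fac'; rewrite inE bl orbT.
    - by apply: fac' => //; rewrite inE eqxx.
    - rewrite big_seq; apply: prodr_gt0 => b' bl; apply: fac' => //.
      by rewrite inE bl orbT.
  rewrite hornerD hornerC hornerN hornerZ horner_sum ReD ReN Re_realM Re_sum /= mulrDr opprD.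
  rewrite addrACA subrr add0r -opprD normrN -mulrDr normrM -big_split /=.
  rewrite ger0_norm; last by nneg.
  apply: le_trans (HK K.+1 (leqnSn K)).
  have -> : p / 2 * (size bs)%:R / (1 - rho) * rho ^+ K.+1 =
     p / 2 * ((size bs)%:R * ((1 - rho)^-1 * rho ^+ K.+1)) by rewrite !mulrA.
  apply: ler_wpM2l; first by nneg.
  apply: (le_trans (ler_norm_sum _ _ _)).
  apply: (@le_trans _ _ (\sum_(b <- bs) ((1 - rho)^-1 * rho ^+ K.+1))); last first.
    by rewrite big_const_seq count_predT iter_addr_0 [leRHS]mulr_natl.
  rewrite big_seq [leRHS]big_seq; apply: ler_sum => b bb; rewrite LE.
  have b1 : cmod (b * z) < 1 by exact: le_lt_trans (bz _ _ bb z1) r1.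
  apply: (le_trans (nlog1B_approx K b1)); rewrite mulrC.
  apply: ler_pM; rewrite ?exprn_ge0 ?cmod_ge0 ?invr_ge0 ?subr_ge0 ?(ltW b1) //.
    by rewrite lef_pV2 ?posrE ?subr_gt0 // lerD2l lerN2 bz.
  by rewrite lerXn2r ?nnegrE ?cmod_ge0 // bz.
have B0 : 0 <= \sum_(k < size A) cmod A`_k by apply: sumr_ge0 => k _; exact: cmod_ge0.
have [N HN] := euler_exp B0 e4.
exists ((1 + (N.+1%:R^-1)%:C *: A) ^+ N.+1) => z z1.
have gE : cmod ((1 + (N.+1%:R^-1)%:C *: A) ^+ N.+1).[z] =
   cmod (1 + A.[z] * (N.+1%:R^-1)%:C) ^+ N.+1.
  by rewrite horner_exp cmodX hornerD hornerZ hornerC [_%:C * _]mulrC.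
have /andP[g1 g2] := HN N.+1 (ltnSn N) _ (horner_le A z1).
have := AE _ z1; rewrite ler_distl => /andP[a1 a2].
have f0 : 0 < cmod f.[z].
  rewrite fE mulr_gt0 // big_seq; apply: prodr_gt0 => b bb; exact: fac.
have fp : cmod f.[z] `^ p = expR (p * ln (cmod f.[z])) by rewrite /powR gt_eqF.
rewrite gE fp; set G := cmod (1 + _) ^+ _ in g1 g2 *.
have G0 : 0 <= G by rewrite exprn_ge0 ?cmod_ge0.
split.
  apply: (@le_trans _ _ (expR e * expR (Re A.[z] - e / 4) ^+ 2)); last first.
    by rewrite ler_wpM2l ?expR_ge0 // lerXn2r ?nnegrE ?expR_ge0.
  rewrite -expRM_natr -expRD ler_expR; lra.
apply: (@le_trans _ _ (expR (Re A.[z] + e / 4) ^+ 2)).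
  by rewrite lerXn2r ?nnegrE ?expR_ge0.
rewrite -expRM_natr -expRD ler_expR; lra.
Qed.

Lemma zero_free_eval n f p (c : R) (bs : seq C) (rho : R) w :
  (1 < n)%N -> 0 < c -> 0 < p -> 0 <= rho -> rho < 1 -> all (fun b => cmod b <= rho) bs ->
  (forall z, cmod f.[z] = c * \prod_(b <- bs) cmod (1 - b * z)) -> cmod w < 1 ->
  cmod f.[w] `^ p * (1 - cmod w ^+ 2) <= pmean p (dpoly n f).
Proof.
move=> n1 c0 p0 r0 r1 bsr fE w1; have n0 := ltnW n1.
have q0 : 0 <= 1 - cmod w ^+ 2 by rewrite subr_ge0 exprn_ile1 ?cmod_ge0 // ltW.
apply: le_expR_eps; first by apply: pmean_ge0 => //; exact: dpoly_pos.
move=> e e0; have e2 : 0 < e / 2 by lra.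
have [g Hg] := zero_free_power c0 p0 e2 r0 r1 bsr fE.
have [h1 _] := Hg _ (ltW w1).
apply: (le_trans (ler_wpM2r q0 h1)); rewrite -mulrA.
apply: (le_trans (ler_wpM2l (expR_ge0 _) (horner_sq_le g w1))).
have -> : expR e = expR (e / 2) * expR (e / 2) by rewrite -expRD; congr expR; lra.
rewrite -mulrA ler_wpM2l ?expR_ge0 // -(pmean2_dpoly g n1).
apply: pmean_le => //; try exact: dpoly_pos; move=> t.
rewrite !ev_dpoly // powR_mulrn ?cmod_ge0 //.
have c1 : cmod (nchar t n) <= 1 by rewrite cmod_nchar.
by have [_ h2] := Hg _ c1.
Qed.

Lemma horner_scale_dist f (rho : R) z : 0 <= rho -> rho <= 1 -> cmod z <= 1 ->
  cmod (f.[rho%:C * z] - f.[z]) <= (1 - rho) * \sum_(k < size f) k%:R * cmod f`_k.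
Proof.
move=> r0 r1 z1; rewrite !horner_coef -sumrB mulr_sumr.
apply: (le_trans (cmod_sum _ _ _)); apply: ler_sum => k _.
have -> : f`_k * (rho%:C * z) ^+ k - f`_k * z ^+ k = (f`_k * z ^+ k) * (rho ^+ k - 1)%:C.
  by rewrite exprMn rmorphB rmorph1 rmorphXn /=; ring.
have rk : 1 - rho ^+ k <= k%:R * (1 - rho).
  elim: (nat_of_ord k) => [|j ih]; first by rewrite expr0 subrr mul0r.
  rewrite exprS -natr1 mulrDl mul1r.
  have : rho * (1 - rho ^+ j) <= 1 - rho ^+ j.
    by rewrite ler_piMl // subr_ge0 exprn_ile1.
  lra.
rewrite !cmodM cmodX cmod_real distrC ger0_norm ?subr_ge0 ?exprn_ile1 //.
apply: (@le_trans _ _ (cmod f`_k * (k%:R * (1 - rho)))); last first.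
  by rewrite le_eqVlt; apply/orP; left; apply/eqP; ring.
rewrite -mulrA; apply: ler_wpM2l; first exact: cmod_ge0.
apply: le_trans rk; rewrite ler_piMl ?subr_ge0 ?exprn_ile1 //; exact: cmod_ge0.
Qed.

(** Sharp point evaluation on the Hardy space of the disc. For [p = 2] this is the
    Cauchy-Schwarz inequality for the coefficients; a polynomial without roots in
    a larger disc is the case [p = 2] of [f ^ (p / 2)], and reflecting the roots of
    [h] inside the disc can only increase the value at [w]. *)
Lemma disc_eval n h p w : (1 < n)%N -> 0 < p -> cmod w < 1 ->
  cmod h.[w] `^ p * (1 - cmod w ^+ 2) <= pmean p (dpoly n h).
Proof.
move=> n1 p0 w1; have n0 := ltnW n1.
have q0 : 0 <= 1 - cmod w ^+ 2 by rewrite subr_ge0 exprn_ile1 ?cmod_ge0 // ltW.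
have q1 (x : R) : 0 <= x -> x * (1 - cmod w ^+ 2) <= x.
  by move=> x0; rewrite ler_piMr // gerBl sqr_ge0.
have [->|h0] := eqVneq h 0.
  by rewrite horner0 cmod0 powR0 ?gt_eqF // mul0r pmean_ge0 // dpoly_pos.
have [c [bs [c0 b1 E1 E2]]] := reflect_roots h0.
pose f : {poly C} := c%:C *: \prod_(b <- bs) (1 - b *: 'X).
have fE z : cmod f.[z] = c * \prod_(b <- bs) cmod (1 - b * z).
  rewrite /f hornerZ cmodM cmod_real ger0_norm ?(ltW c0) // horner_prod cmod_prod.
  congr (_ * _); apply: eq_bigr => b _.
  by rewrite hornerD hornerN hornerZ hornerX hornerC.
pose B := \sum_(k < size f) cmod f`_k.
have B0 : 0 <= B by apply: sumr_ge0 => k _; exact: cmod_ge0.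
pose K := \sum_(k < size f) k%:R * cmod f`_k.
have K0 : 0 <= K by apply: sumr_ge0 => k _; rewrite mulr_ge0 ?cmod_ge0.
apply/ler_addgt0Pr => d d0; have d2 : 0 < d / 2 by lra.
have [e e0 He] := powR_unif_cont p0 B0 d2.
(* Dilating by [rho < 1] moves the roots away from the unit circle. *)
pose rho := 1 - Num.min (e / (K + 1)) 2^-1.
have K1 : 0 < K + 1 by lra.
have m0 : 0 < Num.min (e / (K + 1)) 2^-1 by rewrite lt_min divr_gt0 //= invr_gt0.
have m1 : Num.min (e / (K + 1)) 2^-1 <= 2^-1 by rewrite ge_min lexx orbT.
have m2 : Num.min (e / (K + 1)) 2^-1 <= e / (K + 1) by rewrite ge_min lexx.
have r0 : 0 <= rho by rewrite /rho; lra.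
have r1 : rho < 1 by rewrite /rho; lra.
have close z : cmod z <= 1 -> `|cmod f.[rho%:C * z] `^ p - cmod f.[z] `^ p| <= d / 2.
  move=> z1; apply: He; rewrite ?cmod_ge0 ?horner_le //.
    by rewrite cmodM cmod_real ger0_norm // mulr_ile1 // ?cmod_ge0 // ltW.
  apply: (le_trans (cmod_dist _ _)).
  apply: (le_trans (horner_scale_dist f r0 (ltW r1) z1)).
  rewrite -/K /rho opprB addrCA subrr addr0.
  apply: (@le_trans _ _ (e / (K + 1) * (K + 1))); last by rewrite divfK // gt_eqF.
  by apply: ler_pM => //; rewrite ?(ltW m0) //; lra.
pose fr := f \Po (rho%:C *: 'X).
have frE z : fr.[z] = f.[rho%:C * z] by rewrite /fr horner_comp; congr horner; rewrite hornerZ hornerX.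
have := @zero_free_eval n fr p c [seq rho%:C * b | b <- bs] rho w n1 c0 p0 r0 r1.
have H1 : all (fun b => cmod b <= rho) [seq rho%:C * b | b <- bs].
  apply/allP => x /mapP[b bb ->]; rewrite cmodM cmod_real ger0_norm // ler_piMr //.
  exact: (allP b1).
have H2 z : cmod fr.[z] = c * \prod_(b <- [seq rho%:C * b | b <- bs]) cmod (1 - b * z).
  rewrite frE fE big_map; congr (_ * _); apply: eq_bigr => b _.
  by rewrite mulrCA mulrA.
move=> /(_ H1 H2 w1) H.
have h1 : cmod h.[w] `^ p <= cmod fr.[w] `^ p + d / 2.
  apply: (@le_trans _ _ (cmod f.[w] `^ p)).
    by rewrite ler_powR2 ?cmod_ge0 ?(ltW p0) // fE; apply: E2; exact: ltW.
  by rewrite frE; have := close _ (ltW w1); rewrite ler_distl => /andP[+ _]; rewrite lerBlDr.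
have h2 : pmean p (dpoly n fr) <= d / 2 + 1 * pmean p (dpoly n h).
  have := @pmean_le_sum R unit [:: tt] (fun=> 1) (fun=> p) (fun=> dpoly n h) (d / 2) p (dpoly n fr).
  rewrite big_seq1; apply => //; try by move=> *; exact: dpoly_pos.
  move=> t; rewrite big_seq1 mul1r !ev_dpoly // frE.
  have c1 : cmod (nchar t n) = 1 by exact: cmod_nchar.
  rewrite (E1 _ c1) -fE; have : cmod (nchar t n) <= 1 by rewrite c1.
  by move=> /close; rewrite ler_distl => /andP[_]; rewrite addrC.
have h3 := q1 _ (ltW d2).
have := ler_wpM2r q0 h1; rewrite mulrDl => h4; rewrite mul1r in h2.
move: (le_trans H h2) h3 h4.
move: (cmod h.[w] `^ p * _) (cmod fr.[w] `^ p * _) (d / 2 * _) (pmean p _) => x y z m.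
by clear => *; lra.
Qed.

End OneVariable.

(** * Eliminating one prime at a time *)

Section Substitution.
Variable R : realType.
Local Notation C := R[i].
Implicit Types (D E : dlist R) (w s : C) (q n : nat) (p : R).

Local Notation qpart q n := (n`_q)%N.
Local Notation qcopart q n := (n`_(q^'))%N.

(** As a function on the infinite torus a Dirichlet polynomial is a polynomial in
    one variable per prime; here the variable of [q] is given the value [w]. *)
Definition psubst q w D : dlist R :=
  [seq (x.1 * w ^+ logn q x.2, (qcopart q x.2)) | x <- D].

Lemma psubst_pos q w D : dpos (psubst q w D).
Proof. by apply/allP => x /mapP[y _ ->] /=; rewrite part_gt0. Qed.

Definition twisted q (t u : R) n : C := nchar t n * nchar u (qpart q n).

Lemma twisted_unichar q (t u : R) : unichar (twisted q t u).
Proof.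
split=> [m n m0 n0|n n0]; last by rewrite cmodM !cmod_nchar mulr1.
by rewrite /twisted partnM // !ncharM ?part_gt0 // mulrACA.
Qed.

Lemma nchar_split q (t : R) n : prime q -> (0 < n)%N ->
  nchar t n = nchar t q ^+ logn q n * nchar t (qcopart q n).
Proof.
move=> qp n0; rewrite -{1}(partnC q n0) ncharM ?part_gt0 // p_part ncharX //.
exact: prime_gt0.
Qed.

(** For each fixed [t], bound the value at [w] of the polynomial in the variable of
    [q] by its mean over the circle. It remains to see that the iterated mean over
    [t] and over the angle [u] of that variable is the mean over [t] alone, which
    expresses the independence of the variables: for an approximating form both
    pick out the same diagonal terms. *)
Lemma pmean_psubst q w D p : prime q -> dpos D -> 0 < p -> cmod w < 1 ->
  pmean p (psubst q w D) * (1 - cmod w ^+ 2) <= pmean p D.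
Proof.
move=> qp D0 p0 w1; have q0 := prime_gt0 qp.
have S0 := psubst_pos q w D.
apply/ler_addgt0Pr => d d0; have d2 : 0 < d / 2 by lra.
have [P [P0 HP]] := form_approx D0 p0 d2.
(* The terms that survive the mean over the angle at [q]. *)
pose P' : tform R := [seq x <- P | (qpart q x.2.1) == (qpart q x.2.2)].
have P'0 : tpos P' by rewrite /tpos all_filter; apply: sub_all P0 => x /= ->; rewrite implybT.
have up t : cmod (ev (psubst q w D) (nchar t)) `^ p * (1 - cmod w ^+ 2) <=
    Re (tev P' (nchar t)) + d / 2.
  pose h : {poly C} := \sum_(x <- D) (x.1 * nchar t x.2) *: 'X^(logn q x.2).
  have hE z : h.[z] = \sum_(x <- D) (x.1 * nchar t x.2) * z ^+ logn q x.2.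
    by rewrite horner_sum; apply: eq_bigr => x _; rewrite hornerZ hornerXn.
  have hu u : h.[nchar u q] = ev D (twisted q t u).
    rewrite hE /ev; apply: eq_bigr => x _.
    by rewrite /twisted p_part ncharX // mulrA.
  (* [psubst] removes the factor [nchar t q] along with the variable, hence the
     rotation of [w], which leaves its modulus unchanged. *)
  have hw : h.[w * conjc (nchar t q)] = ev (psubst q w D) (nchar t).
    rewrite hE /ev big_map big_seq [RHS]big_seq; apply: eq_bigr => x xD /=.
    have x0 := allP D0 _ xD; rewrite (nchar_split t qp x0) exprMn.
    have c1 : nchar t q ^+ logn q x.2 * conjc (nchar t q) ^+ logn q x.2 = 1.
      by rewrite -exprMn (unichar_unit (nchar_unichar t) q0) expr1n.
    rewrite -[LHS]/(x.1 * (nchar t q ^+ logn q x.2 * nchar t (qcopart q x.2)) *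
      (w ^+ logn q x.2 * conjc (nchar t q) ^+ logn q x.2)).
    transitivity (x.1 * w ^+ logn q x.2 * nchar t (qcopart q x.2) *
      (nchar t q ^+ logn q x.2 * conjc (nchar t q) ^+ logn q x.2)); first by ring.
    by rewrite c1 mulr1.
  have wc : cmod (w * conjc (nchar t q)) = cmod w by rewrite cmodM cmodJ cmod_nchar mulr1.
  have := @disc_eval R q h p (w * conjc (nchar t q)) (prime_gt1 qp) p0.
  rewrite wc hw => /(_ w1) /le_trans; apply.
  pose T : tform R := [seq (x.1 * (nchar t x.2.1 * conjc (nchar t x.2.2)),
     ((qpart q x.2.1), (qpart q x.2.2))) | x <- P].
  have T0 : tpos T by apply/allP => x /mapP[y _ ->] /=; rewrite !part_gt0.
  have TE u : tev T (nchar u) = tev P (twisted q t u).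
    rewrite /tev big_map; apply: eq_bigr => x _.
    by rewrite /twisted conjM [in RHS]mulrACA [RHS]mulrA.
  have -> : Re (tev P' (nchar t)) = Re (tmean T).
    by congr Re; rewrite /tmean big_map /= /tev big_filter.
  have dp := dpoly_pos h q0.
  apply: (@mean_le R (fun u => cmod (ev (dpoly q h) (nchar u)) `^ p)
     (fun u => Re (tev T (nchar u)) + d / 2) _ _ _ _ (pmeanP dp p0)).
  - exact: cont_cmod_ev.
  - by move=> x; apply: cvgD; [exact: cont_tev|exact: cvg_cst].
  - apply: meanD; [exact: cont_tev|exact: cont_cst|exact: mean_tev|exact: mean_cst].
  - move=> u; rewrite ev_dpoly // hu TE.
    have := HP _ (twisted_unichar q t u); rewrite ler_distl => /andP[_].
    by rewrite addrC.
have E : Re (tmean P') = Re (tmean P).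
  congr Re; rewrite /tmean big_filter_cond [RHS]big_mkcond [LHS]big_mkcond.
  by apply: eq_bigr => x _; case: (x.2.1 =P x.2.2) => [->|]; rewrite ?eqxx ?andbF.
have h1 : pmean p (psubst q w D) * (1 - cmod w ^+ 2) <= Re (tmean P') + d / 2.
  rewrite mulrC; apply: (@mean_le R (fun t => (1 - cmod w ^+ 2) *
     cmod (ev (psubst q w D) (nchar t)) `^ p)
     (fun t => Re (tev P' (nchar t)) + d / 2)).
  - by move=> x; apply: cvgM; [exact: cvg_cst|exact: cont_cmod_ev].
  - by move=> x; apply: cvgD; [exact: cont_tev|exact: cvg_cst].
  - by apply: meanZ; [exact: cont_cmod_ev|exact: pmeanP].
  - apply: meanD; [exact: cont_tev|exact: cont_cst|exact: mean_tev|exact: mean_cst].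
  - by move=> t; rewrite mulrC; exact: up.
have h2 : Re (tmean P) <= pmean p D + d / 2.
  apply: (@mean_le R (fun t => Re (tev P (nchar t)))
     (fun t => cmod (ev D (nchar t)) `^ p + d / 2)).
  - exact: cont_tev.
  - by move=> x; apply: cvgD; [exact: cont_cmod_ev|exact: cvg_cst].
  - exact: mean_tev.
  - apply: meanD; [exact: cont_cmod_ev|exact: cont_cst|exact: pmeanP|exact: mean_cst].
  - move=> t; have := HP _ (nchar_unichar t); rewrite ler_distl => /andP[+ _].
    by rewrite lerBlDr.
rewrite E in h1; apply: (le_trans h1); move: h2.
by move: (Re _) (pmean _ _) => x y; clear => *; lra.
Qed.

(** Substituting [0] for the variable of [q] is a conditional expectation. *)
Lemma pmean_kill q D p : prime q -> dpos D -> 0 < p ->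
  pmean p (psubst q 0 D) <= pmean p D.
Proof.
move=> qp D0 p0; have := @pmean_psubst q 0 D p qp D0 p0.
by rewrite cmod0 expr0n /= subr0 mulr1; apply; exact: ltr01.
Qed.

Lemma npowM m n s : (0 < m)%N -> (0 < n)%N -> npow (m * n) s = npow m s * npow n s.
Proof.
move=> m0 n0; rewrite /npow lnM_nat // !mulrDr opprD expRD cosD sinD.
by apply/eqP; rewrite eq_complex /=; apply/andP; split; apply/eqP; ring.
Qed.

Lemma npow1 s : npow 1 s = 1.
Proof.
rewrite /npow ln1 !mulr0 oppr0 expR0 cos0 sin0 oppr0.
by apply/eqP; rewrite eq_complex /= !mulr0 mul0r !mul1r subr0 addr0 !eqxx.
Qed.

Lemma npowX q k s : (0 < q)%N -> npow (q ^ k) s = npow q s ^+ k.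
Proof.
move=> q0; elim: k => [|k ih]; first by rewrite expn0 npow1.
by rewrite expnS npowM ?expn_gt0 ?q0 // ih exprS.
Qed.

Lemma cmod_npow n s : cmod (npow n s) = expR (- (Re s * ln n%:R)).
Proof.
rewrite /npow cmodM cmod_real ger0_norm ?expR_ge0 //.
suff -> : forall x : R, cmod (cos x -i* sin x) = 1 by rewrite mulr1.
move=> x; apply/eqP; rewrite -(@eqrXn2 _ 2) ?cmod_ge0 // cmod_sq /= sqrrN.
by rewrite cos2Dsin2 expr1n.
Qed.

Lemma ev_psubst q s D : prime q -> dpos D ->
  ev (psubst q (npow q s) D) (@npow R ^~ s) = ev D (@npow R ^~ s).
Proof.
move=> qp D0; rewrite /ev big_map big_seq [RHS]big_seq; apply: eq_bigr => x xD /=.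
have x0 := allP D0 _ xD; rewrite -mulrA; congr (_ * _).
by rewrite -{3}(partnC q x0) npowM ?part_gt0 // p_part npowX // prime_gt0.
Qed.

Definition psubsts (qs : seq nat) s D := foldr (fun q E => psubst q (npow q s) E) D qs.

Lemma psubstsP qs s D p : all prime qs -> dpos D -> 0 < p -> 0 < Re s ->
  [/\ dpos (psubsts qs s D), ev (psubsts qs s D) (@npow R ^~ s) = ev D (@npow R ^~ s),
    (forall r y, prime r -> y \in psubsts qs s D -> (r %| y.2)%N ->
       r \notin qs /\ exists2 x, x \in D & (r %| x.2)%N) &
    pmean p (psubsts qs s D) * \prod_(q <- qs) (1 - cmod (npow q s) ^+ 2) <= pmean p D].
Proof.
move=> + D0 p0 s0; elim: qs => [|q qs ih] /=.
  move=> _; split => //; last by rewrite big_nil mulr1.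
  by move=> r y _ yD ry; split=> //; exists y.
move=> /andP[qp /ih[E0 e h1 h2]]; split.
- exact: psubst_pos.
- by rewrite ev_psubst.
- move=> r y rp /mapP[x xE ->] /= ry.
  have rx : (r %| x.2)%N by apply: dvdn_trans ry _; exact: dvdn_part.
  have [rqs Hx] := h1 _ _ rp xE rx; split=> //; rewrite inE negb_or rqs andbT.
  apply/eqP => rq; have := pnat_dvd ry (part_pnat _ _).
  by rewrite rq pnatE // !inE eqxx.
- have w1 : cmod (npow q s) < 1.
    rewrite cmod_npow expR_lt1 oppr_lt0 mulr_gt0 // ln_gt0 // ltr1n.
    exact: prime_gt1.
  rewrite big_cons mulrA; apply: le_trans h2; apply: ler_wpM2r.
    apply: prodr_ge0 => i _; rewrite subr_ge0.
    have c1 : cmod (npow i s) <= 1.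
      rewrite cmod_npow expR_le1 oppr_le0 mulr_ge0 ?(ltW s0) //.
      by case: i => [|i]; [rewrite ln0|rewrite ln_ge0 // ler1n].
    by rewrite exprn_ile1 // cmod_ge0.
  exact: pmean_psubst.
Qed.

(** Substituting the value [q ^ (- s)] for one prime after another, the sharp
    one-variable constants multiply to an Euler product. *)
Lemma point_eval qs s D p : all prime qs -> dpos D -> 0 < p -> 0 < Re s ->
  (forall x r, x \in D -> prime r -> (r %| x.2)%N -> r \in qs) ->
  cmod (ev D (@npow R ^~ s)) `^ p * \prod_(q <- qs) (1 - cmod (npow q s) ^+ 2) <= pmean p D.
Proof.
move=> qsp D0 p0 s0 cover; have [E0 e h1 h2] := psubstsP qsp D0 p0 s0.
have one y : y \in psubsts qs s D -> y.2 = 1%N.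
  move=> yE; have y0 := allP E0 _ yE; apply/eqP; apply/negPn/negP => y1.
  have y2 : (1 < y.2)%N by rewrite ltn_neqAle eq_sym y1.
  have [rqs [x xD rx]] := h1 _ _ (pdiv_prime y2) yE (pdiv_dvd _).
  by move: rqs; rewrite (cover _ _ xD (pdiv_prime y2) rx).
have ec chi : chi 1%N = 1 -> ev (psubsts qs s D) chi = \sum_(x <- psubsts qs s D) x.1.
  move=> c1; rewrite /ev big_seq [RHS]big_seq; apply: eq_bigr => x xD.
  by rewrite one // c1 mulr1.
have m1 : pmean p (psubsts qs s D) = cmod (ev D (@npow R ^~ s)) `^ p.
  apply: (mean_uniq (pmeanP E0 p0)).
  apply: mean_ext (@mean_cst R _) => t /=.
  by rewrite -e !ec ?npow1 // -[1%N]/(2 ^ 0)%N ncharX.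
by rewrite -m1.
Qed.

End Substitution.

(** * Smooth numbers and the Euler product *)

Fixpoint plist (N : nat) : seq nat :=
  if N is n.+1 then (if prime n.+1 then n.+1 :: plist n else plist n) else [::].

Lemma mem_plist N q : (q \in plist N) = prime q && (q <= N)%N.
Proof.
elim: N => [|n ih] /=.
  by rewrite in_nil; case: q => // q; rewrite ltn0 andbF.
case: ifP => hp; rewrite ?inE ih; case: (eqVneq q n.+1) => [->|qn] /=.
- by rewrite hp leqnn.
- by rewrite [(q <= n.+1)%N]leq_eqVlt (negbTE qn) ltnS.
- by rewrite hp.
- by rewrite [(q <= n.+1)%N]leq_eqVlt (negbTE qn) ltnS.
Qed.

Lemma plist_prime N : all prime (plist N).
Proof. by apply/allP => q; rewrite mem_plist => /andP[]. Qed.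

Lemma plist_uniq N : uniq (plist N).
Proof.
elim: N => //= n ih; case: ifP => //= _; rewrite ih andbT mem_plist.
by rewrite ltnn andbF.
Qed.

(** The smooth numbers with bounded exponents: sums over them are finite and factor
    over the primes. *)
Definition box (qs : seq nat) (K : nat) : seq nat :=
  foldr (fun q s => [seq (q ^ k * n)%N | k <- index_iota 0 K.+1, n <- s]) [:: 1%N] qs.

Lemma box_cons q qs K :
  box (q :: qs) K = [seq (q ^ k * n)%N | k <- index_iota 0 K.+1, n <- box qs K].
Proof. by []. Qed.

Lemma box_nil K : box [::] K = [:: 1%N]. Proof. by []. Qed.

Lemma box_pos qs K n : all prime qs -> n \in box qs K -> (0 < n)%N.
Proof.
elim: qs n => [|q qs ih] n; rewrite ?box_nil ?box_cons; first by rewrite inE => _ /eqP->.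
move=> /andP[qp /ih h] /allpairsP[[k m] /= [_ /h m0 ->]].
by rewrite muln_gt0 expn_gt0 prime_gt0.
Qed.

Lemma box_primes qs K n r : all prime qs -> n \in box qs K -> prime r -> (r %| n)%N ->
  r \in qs.
Proof.
move=> + + rp; elim: qs n => [|q qs ih] n; rewrite ?box_nil ?box_cons.
  by rewrite inE => _ /eqP->; rewrite dvdn1 => /eqP r1; rewrite r1 in rp.
move=> /andP[qp /ih h] /allpairsP[[k m] /= [_ /h{}h ->]].
rewrite inE Euclid_dvdM // => /orP[|/h->]; last by rewrite orbT.
by rewrite Euclid_dvdX // => /andP[]; rewrite dvdn_prime2 // => ->.
Qed.

Lemma box_logn0 qs K n q : all prime qs -> prime q -> q \notin qs -> n \in box qs K ->
  logn q n = 0%N.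
Proof.
move=> qsp qp qn nb; apply/eqP; rewrite -leqn0 leqNgt logn_gt0 mem_primes.
by apply/and3P => -[_ _ /(box_primes qsp nb qp)]; exact/negP.
Qed.

Lemma box_uniq qs K : all prime qs -> uniq qs -> uniq (box qs K).
Proof.
elim: qs => // q qs ih /andP[qp qsp] /andP[qn u]; rewrite box_cons.
apply: allpairs_uniq; [exact: iota_uniq|exact: ih|].
move=> [k m] [l n] /allpairsP[[k' m'] [_ + [-> ->]]] /allpairsP[[l' n'] [_ + [-> ->]]].
rewrite /= => mb nb e.
have [m0 n0] := (box_pos qsp mb, box_pos qsp nb); have q0 := prime_gt0 qp.
have := congr1 (logn q) e.
rewrite !lognM ?expn_gt0 ?q0 // !pfactorK // (box_logn0 qsp qp qn mb) (box_logn0 qsp qp qn nb) !addn0 => kl.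
by move: e; rewrite kl => /eqP; rewrite eqn_pmul2l ?expn_gt0 ?q0 // => /eqP->.
Qed.

Lemma mem_box qs K n : all prime qs -> uniq qs -> (0 < n)%N ->
  (forall r, prime r -> (r %| n)%N -> r \in qs) -> (forall r, (logn r n <= K)%N) ->
  n \in box qs K.
Proof.
move=> + + + + lK; elim: qs n lK => [|q qs ih] n lK; rewrite ?box_nil ?box_cons.
  move=> _ _ n0 h; rewrite inE; apply/eqP/eqP/negPn/negP => n1.
  have n2 : (1 < n)%N by rewrite ltn_neqAle eq_sym n1.
  by have := h _ (pdiv_prime n2) (pdiv_dvd n); rewrite in_nil.
move=> /andP[qp qsp] /andP[qn u] n0 h; apply/allpairsP.
exists (logn q n, n`_(q^'))%N => /=; split.
- by rewrite mem_index_iota /= ltnS.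
- apply: ih => //; rewrite ?part_gt0 //.
  + by move=> r; apply: leq_trans (lK r); apply: dvdn_leq_log => //; exact: dvdn_part.
  + move=> r rp rn; have := h _ rp (dvdn_trans rn (dvdn_part _ _)).
    rewrite inE => /orP[/eqP rq|//]; have := pnat_dvd rn (part_pnat _ _).
    by rewrite rq pnatE // !inE eqxx.
- by rewrite -p_part partnC.
Qed.

Lemma mem_box_plist N K n : (0 < n)%N -> (n <= N)%N -> (n <= K)%N -> n \in box (plist N) K.
Proof.
move=> n0 nN nK; apply: mem_box => //; [exact: plist_prime|exact: plist_uniq| |].
  by move=> r rp rn; rewrite mem_plist rp (leq_trans (dvdn_leq n0 rn)).
by move=> r; apply: leq_trans nK; exact: ltnW (ltn_logl _ n0).
Qed.

Definition multiplicative_on_pos (A : comNzRingType) (f : nat -> A) :=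
  f 1%N = 1 /\ forall m n, (0 < m)%N -> (0 < n)%N -> f (m * n)%N = f m * f n.

Lemma mulposX (A : comNzRingType) (f : nat -> A) q k :
  multiplicative_on_pos f -> (0 < q)%N -> f (q ^ k)%N = f q ^+ k.
Proof.
move=> [f1 fM] q0; elim: k => [|k ih]; first by rewrite expn0 f1.
by rewrite expnS fM ?expn_gt0 ?q0 // ih exprS.
Qed.

Lemma box_sum (A : comNzRingType) (f : nat -> A) qs K :
  multiplicative_on_pos f -> all prime qs ->
  \sum_(n <- box qs K) f n = \prod_(q <- qs) \sum_(k < K.+1) f q ^+ k.
Proof.
move=> mf; have [f1 fM] := mf; elim: qs => [|q qs ih]; first by rewrite box_nil big_seq1 big_nil f1.
rewrite box_cons => /andP[qp qsp]; rewrite big_cons -(ih qsp) big_allpairs_dep.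
rewrite big_mkord mulr_suml; apply: eq_bigr => k _.
rewrite mulr_sumr big_seq [RHS]big_seq; apply: eq_bigr => n nb.
have q0 := prime_gt0 qp; have qk : (0 < q ^ k)%N by rewrite expn_gt0 q0.
by rewrite (fM _ _ qk (box_pos qsp nb)) (mulposX k mf q0).
Qed.

Section Zeta.
Variable R : realType.
Implicit Types (x t : R) (n : nat).

Definition rpow x n : R := n%:R `^ (- x).

Lemma rpow_ge0 x n : 0 <= rpow x n. Proof. exact: powR_ge0. Qed.

Lemma rpow_mul x : multiplicative_on_pos (rpow x).
Proof. by split=> [|m n _ _]; rewrite /rpow ?powR1 // natrM powRM. Qed.

Lemma rpowE x n : (0 < n)%N -> rpow x n = expR (- (x * ln n%:R)).
Proof. by move=> n0; rewrite /rpow /powR pnatr_eq0 eqn0Ngt n0 mulNr. Qed.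

Lemma rpowD x y n : (0 < n)%N -> rpow (x + y) n = rpow x n * rpow y n.
Proof. by move=> n0; rewrite !rpowE // mulrDl opprD expRD. Qed.

Lemma rpow_le1 x n : 0 <= x -> (0 < n)%N -> rpow x n <= 1.
Proof. by move=> x0 n0; rewrite rpowE // expR_le1 oppr_le0 mulr_ge0 // ln_ge0 // ler1n. Qed.

Lemma rpow1 n : (0 < n)%N -> rpow 1 n = n%:R^-1.
Proof. by move=> n0; rewrite rpowE // mul1r -lnV ?posrE ?ltr0n // lnK // posrE invr_gt0 ltr0n. Qed.

Lemma rpow_homo x y n : (0 < n)%N -> x <= y -> rpow y n <= rpow x n.
Proof.
by move=> n0 xy; rewrite !rpowE // ler_expR lerN2 ler_wpM2r // ln_ge0 // ler1n.
Qed.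

Lemma rpow_half x q : 1 <= x -> (1 < q)%N -> rpow x q <= 2^-1.
Proof.
move=> x1 q1; have q0 := ltnW q1; apply: (le_trans (rpow_homo q0 x1)).
by rewrite rpow1 // lef_pV2 ?posrE ?ltr0n // ler_nat.
Qed.

Lemma ln_step n : (0 < n)%N -> ln n.+1%:R - ln n%:R <= n%:R^-1 :> R.
Proof.
move=> n0; have np : (0 : R) < n%:R by rewrite ltr0n.
have : ln (1 + n%:R^-1) <= n%:R^-1 :> R.
  by apply: le_ln1Dx; rewrite (@lt_trans _ _ 0) ?invr_gt0 // ltrN10.
have -> : 1 + n%:R^-1 = n.+1%:R / n%:R :> R by rewrite -natr1; field; rewrite gt_eqF.
by rewrite ln_div ?posrE ?ltr0n.
Qed.

Lemma ln_step2 n : (0 < n)%N -> n.+1%:R^-1 <= ln n.+1%:R - ln n%:R :> R.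
Proof.
move=> n0; have np : (0 : R) < n.+1%:R by rewrite ltr0n.
have : ln (1 + - n.+1%:R^-1) <= - n.+1%:R^-1 :> R.
  by apply: le_ln1Dx; rewrite ltrN2 invf_lt1 // ltr1n ltnS.
have -> : 1 + - n.+1%:R^-1 = n%:R / n.+1%:R :> R.
  by rewrite -natr1; field; rewrite natr1 gt_eqF.
by rewrite ln_div ?posrE ?ltr0n // lerNr opprB.
Qed.

(** Comparison with the telescoping sum of the differences of [n ^ (- t) / t]. *)
Lemma zeta_le t N : 0 < t -> \sum_(1 <= n < N.+1) rpow (1 + t) n <= 1 + t^-1.
Proof.
move=> t0; case: N => [|N].
  by rewrite big_geq // addr_ge0 // invr_ge0 ltW.
suff : t * \sum_(1 <= n < N.+2) rpow (1 + t) n <= t + 1 - rpow t N.+1.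
  have := rpow_ge0 t N.+1 => h1 h2.
  rewrite -(ler_pM2l t0) mulrDr mulr1 divff ?gt_eqF //.
  by apply: (le_trans h2); rewrite gerBl.
elim: N => [|N ih].
  by rewrite big_nat1 (rpow_mul _).1 (rpow_mul _).1 mulr1 addrK.
rewrite big_nat_recr //= mulrDr; apply: (le_trans (lerD ih (lexx _))).
suff : t * rpow (1 + t) N.+2 <= rpow t N.+1 - rpow t N.+2 by lra.
have e : rpow t N.+1 = rpow t N.+2 * expR (t * (ln N.+2%:R - ln N.+1%:R)).
  by rewrite !rpowE // -expRD; congr expR; ring.
rewrite rpowD // rpow1 // e.
have h : 1 + t * N.+2%:R^-1 <= expR (t * (ln N.+2%:R - ln N.+1%:R)).
  apply: (le_trans (expR_ge1Dx _)); rewrite ler_expR ler_wpM2l ?(ltW t0) //.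
  exact: ln_step2.
have h2 := ler_wpM2l (rpow_ge0 t N.+2) h.
by rewrite lerBrDr; apply: le_trans h2; rewrite mulrDr mulr1 addrC lerD2l mulrA mulrC.
Qed.

Lemma zeta_ge t N : 0 < t -> 1 - rpow t N.+1 <= t * \sum_(1 <= n < N.+1) rpow (1 + t) n.
Proof.
move=> t0; elim: N => [|N ih].
  by rewrite big_geq // mulr0 (rpow_mul _).1 subrr.
rewrite big_nat_recr //= mulrDr; apply: le_trans (lerD ih (lexx _)).
suff : rpow t N.+1 - rpow t N.+2 <= t * rpow (1 + t) N.+1 by lra.
have e : rpow t N.+2 = rpow t N.+1 * expR (- (t * (ln N.+2%:R - ln N.+1%:R))).
  by rewrite !rpowE // -expRD; congr expR; ring.
rewrite rpowD // rpow1 // e.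
have h : 1 - t * N.+1%:R^-1 <= expR (- (t * (ln N.+2%:R - ln N.+1%:R))).
  apply: (le_trans (expR_ge1Dx _)); rewrite ler_expR lerN2 ler_wpM2l ?(ltW t0) //.
  exact: ln_step.
have h2 := ler_wpM2l (rpow_ge0 t N.+1) h.
rewrite mulrBr mulr1 in h2; rewrite lerBlDr -lerBlDl; apply: le_trans h2.
by rewrite le_eqVlt; apply/orP; left; apply/eqP; move: (_^-1) (rpow t _) => a b; ring.
Qed.

Lemma sum_sub_le (f : nat -> R) (s1 s2 : seq nat) : (forall n, 0 <= f n) ->
  uniq s1 -> uniq s2 -> {subset s1 <= s2} -> \sum_(n <- s1) f n <= \sum_(n <- s2) f n.
Proof.
move=> f0 u1 u2 s12.
have p : perm_eq s1 [seq x <- s2 | x \in s1].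
  apply: uniq_perm => //; first exact: filter_uniq.
  by move=> x; rewrite mem_filter andbC; case: (boolP (x \in s1)) => [/s12->|]; rewrite ?andbF.
rewrite (perm_big _ p) /= big_filter [leRHS](bigID (mem s1)) /= lerDl.
by apply: sumr_ge0.
Qed.

Lemma zeta_sum_le t (s : seq nat) : 0 < t -> uniq s -> all (leq 1) s ->
  \sum_(n <- s) rpow (1 + t) n <= 1 + t^-1.
Proof.
move=> t0 us s1; apply: (le_trans _ (zeta_le (\max_(n <- s) n) t0)).
apply: sum_sub_le => //; [by move=> n; exact: rpow_ge0|exact: iota_uniq|].
move=> n ns; rewrite mem_index_iota (allP s1 _ ns) /= ltnS.
by rewrite (leq_bigmax_seq (F := id)).
Qed.

Lemma prod_geom (f : nat -> R) qs K : (forall q, q \in qs -> f q < 1) ->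
  (\prod_(q <- qs) \sum_(k < K.+1) f q ^+ k) * \prod_(q <- qs) (1 - f q) =
  \prod_(q <- qs) (1 - f q ^+ K.+1).
Proof.
move=> h; rewrite -big_split /=; apply: eq_bigr => q _.
by rewrite mulrC -[1 - f q]opprB mulNr -subrX1 opprB.
Qed.

(** The finite Euler product is a sum over smooth numbers, hence at most the full
    zeta function at [1 + t], which is at most [1 + t^-1]. *)
Lemma euler_le t qs : 0 < t -> all prime qs -> uniq qs ->
  1 <= (1 + t^-1) * \prod_(q <- qs) (1 - rpow (1 + t) q).
Proof.
move=> t0 qsp u; set f := rpow (1 + t).
have f2 q : q \in qs -> f q <= 2^-1.
  by move=> /(allP qsp) /prime_gt1 q1; apply: rpow_half => //; rewrite lerDl ltW.
have f1 q : q \in qs -> f q < 1 by move=> /f2 h; lra.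
have P0 : 0 <= \prod_(q <- qs) (1 - f q).
  by rewrite big_seq; apply: prodr_ge0 => q /f1 h; rewrite subr_ge0 ltW.
apply/ler_addgt0Pr => e e0.
have [h0 h2] : 0 <= 2^-1 :> R /\ 2^-1 < 1 :> R by split; lra.
have [K HK] := geometric_small (size qs)%:R h0 h2 e0.
have h1 : 1 - e <= \prod_(q <- qs) (1 - f q ^+ K.+1).
  apply: (@le_trans _ _ (1 - (size qs)%:R * 2^-1 ^+ K.+1)).
    by rewrite lerD2l lerN2 HK // leqnSn.
  elim: (qs) f2 => [|q l ih] f2'; first by rewrite big_nil mul0r subr0.
  rewrite big_cons /= -natr1 mulrDl mul1r.
  have a1 : f q ^+ K.+1 <= 2^-1 ^+ K.+1.
    by rewrite lerXn2r ?nnegrE ?rpow_ge0 // f2' // inE eqxx.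
  have a2 := ih (fun q' h => f2' q' ltac:(by rewrite inE h orbT)).
  have a3 : \prod_(j <- l) (1 - f j ^+ K.+1) <= 1.
    rewrite big_seq; apply: prodr_ile1 => j jl; rewrite gerBl exprn_ge0 ?rpow_ge0 // andbT.
    rewrite subr_ge0 exprn_ile1 ?rpow_ge0 //; apply: (le_trans (f2' j _)).
      by rewrite inE jl orbT.
    by rewrite invf_le1 //; lra.
  have a4 : 0 <= f q ^+ K.+1 by rewrite exprn_ge0 // rpow_ge0.
  set A := \prod_(j <- l) _ in a2 a3 *; nra.
rewrite -lerBlDr; apply: (le_trans h1); rewrite -prod_geom // ler_wpM2r //.
rewrite -box_sum //; last exact: rpow_mul.
apply: zeta_sum_le => //; first exact: box_uniq.
by apply/allP => n /(box_pos qsp).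
Qed.

(** By unique factorization every [n <= N] occurs in the Euler product over the
    primes up to [N]. *)
Lemma euler_ge t N : 0 < t ->
  (\sum_(1 <= n < N.+1) rpow (1 + t) n) * \prod_(q <- plist N) (1 - rpow (1 + t) q) <= 1.
Proof.
move=> t0; set f := rpow (1 + t); have qsp := plist_prime N.
have f1 q : q \in plist N -> f q < 1.
  move=> /(allP qsp) /prime_gt1 q1; have := @rpow_half (1 + t) q; rewrite -/f lerDl => h.
  by have := h (ltW t0) q1; lra.
have P0 : 0 <= \prod_(q <- plist N) (1 - f q).
  by rewrite big_seq; apply: prodr_ge0 => q /f1 h; rewrite subr_ge0 ltW.
apply: (@le_trans _ _ ((\sum_(n <- box (plist N) N) f n) * \prod_(q <- plist N) (1 - f q))).
  apply: ler_wpM2r => //; apply: sum_sub_le.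
  - by move=> n; exact: rpow_ge0.
  - exact: iota_uniq.
  - apply: box_uniq => //; exact: plist_uniq.
  - move=> n; rewrite mem_index_iota ltnS => /andP[n0 nN]; exact: mem_box_plist.
rewrite box_sum //; last exact: rpow_mul.
rewrite prod_geom //; rewrite big_seq; apply: prodr_ile1 => q qp.
by rewrite gerBl exprn_ge0 ?rpow_ge0 // subr_ge0 exprn_ile1 ?rpow_ge0 // ltW // f1.
Qed.

(** Mertens-type lower bound: the logarithm of the Euler product, which is at least
    [- ln (2 * t)], differs from the prime sum by a convergent sum of squares. *)
Lemma prime_sum_ge t : 0 < t -> exists N,
  (2 * t)^-1 * expR (- 4) <= expR (\sum_(q <- plist N) rpow (1 + t) q).
Proof.
move=> t0.
have [N hN] : exists N : nat, rpow t N.+1 <= 2^-1.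
  exists (Num.truncn (expR (ln 2 / t))).
  have h : expR (ln 2 / t) <= (Num.truncn (expR (ln 2 / t))).+1%:R by rewrite ltW // truncnS_gt.
  rewrite rpowE // -[leRHS]lnK ?posrE ?invr_gt0 // ler_expR lnV ?posrE // lerN2.
  rewrite mulrC -ler_pdivrMr // -ler_expR lnK ?posrE ?ltr0n //.
exists N; set f := rpow (1 + t); have qsp := plist_prime N.
have f2 q : q \in plist N -> f q <= 2^-1.
  by move=> /(allP qsp) /prime_gt1 q1; apply: rpow_half => //; rewrite lerDl ltW.
have Z := zeta_ge N t0; have E := euler_ge N t0; rewrite -/f in Z E.
set S := \sum_(1 <= n < N.+1) f n in Z E; set P := \prod_(q <- _) _ in E.
have S1 : 2^-1 <= t * S by apply: le_trans Z; lra.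
have P0 : 0 < P.
  by rewrite /P big_seq; apply: prodr_gt0 => q /f2 h; rewrite subr_gt0; lra.
have PV : (2 * t)^-1 <= P^-1.
  rewrite lef_pV2 ?posrE ?mulr_gt0 // -(ler_pM2l (_ : 0 < 2^-1)) ?invr_gt0 // mulKf //.
  apply: (le_trans (ler_wpM2r (ltW P0) S1)); rewrite -mulrA.
  by rewrite -[leRHS]mulr1 ler_wpM2l // ltW.
apply: (le_trans (ler_wpM2r (expR_ge0 _) PV)).
rewrite -ler_pdivlMr ?expR_gt0 // -expRN opprK -expRD.
have -> : P^-1 = \prod_(q <- plist N) (1 - f q)^-1 by rewrite -prodfV.
apply: (@le_trans _ _ (\prod_(q <- plist N) expR (f q + 2 * f q ^+ 2))).
  rewrite big_seq [leRHS]big_seq; apply: ler_prod => q /f2 h.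
  rewrite invr_ge0 subr_ge0 expR_ge_inv1B ?rpow_ge0 // andbT; lra.
rewrite -expR_sum ler_expR big_split /= lerD2l -mulr_sumr.
have : \sum_(q <- plist N) f q ^+ 2 <= 1 + 1^-1.
  apply: le_trans (@zeta_sum_le 1 (plist N) ltr01 (plist_uniq N) _); last first.
    by apply/allP => q /(allP qsp) /prime_gt0.
  rewrite big_seq [leRHS]big_seq; apply: ler_sum => q /(allP qsp) /prime_gt0 q0.
  rewrite /f expr2 -rpowD //; apply: rpow_homo => //; lra.
rewrite invr1; lra.
Qed.

End Zeta.

(** * Dirichlet polynomials as lists of terms *)

Section DirichletPolynomials.
Variable R : realType.
Local Notation C := R[i].
Implicit Types (P Q : dirpoly R) (D E : dlist R) (s : C) (p : R).

Definition terms P : dlist R := [seq (dcoef P n, n) | n <- index_iota 1 (size P).+1].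

Lemma terms_pos P : dpos (terms P).
Proof. by apply/allP => x /mapP[n]; rewrite mem_index_iota => /andP[n1 _] ->. Qed.

Lemma terms_sum P (g : nat -> C) :
  \sum_(x <- terms P) x.1 * g x.2 = \sum_(1 <= n < (size P).+1) dcoef P n * g n.
Proof. by rewrite big_map. Qed.

Lemma devalE P s : deval P s = ev (terms P) (@npow R ^~ s).
Proof. exact: (esym (terms_sum P (@npow R ^~ s))). Qed.

Lemma npow_imag n (t : R) : npow n (0 +i* t) = nchar t n.
Proof.
by rewrite /npow /= mul0r oppr0 expR0 rmorph1 mul1r.
Qed.

Lemma deval_imag P (t : R) : deval P (0 +i* t) = ev (terms P) (nchar t).
Proof. by rewrite devalE; apply: eq_bigr => x _; rewrite npow_imag. Qed.

Lemma Hp_norm_pmean p (f : C -> C) D : (forall t : R, cmod (f (0 +i* t)) = cmod (ev D (nchar t))) ->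
  Hp_norm p f = pmean p D `^ p^-1.
Proof.
move=> h; rewrite /Hp_norm /pmean /avg.
by have -> : (fun t : R => cmod (f (0 +i* t)) `^ p) = (fun t => cmod (ev D (nchar t)) `^ p)
  by apply/funext => t; rewrite h.
Qed.

Lemma Hp_norm_terms p P : Hp_norm p (deval P) = pmean p (terms P) `^ p^-1.
Proof. by apply: Hp_norm_pmean => t; rewrite deval_imag. Qed.

Definition dscale (c : C) D : dlist R := [seq (c * x.1, x.2) | x <- D].

Lemma dscale_pos c D : dpos D -> dpos (dscale c D).
Proof. by move=> D0; apply/allP => x /mapP[y yD ->]; exact: (allP D0 _ yD). Qed.

Lemma ev_dscale c D chi : ev (dscale c D) chi = c * ev D chi.
Proof. by rewrite /ev big_map mulr_sumr; apply: eq_bigr => x _; rewrite mulrA. Qed.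

Definition dsub D E : dlist R := D ++ dscale (-1) E.

Lemma dsub_pos D E : dpos D -> dpos E -> dpos (dsub D E).
Proof. by move=> D0 E0; rewrite /dpos all_cat; apply/andP; split=> //; exact: dscale_pos. Qed.

Lemma ev_dsub D E chi : ev (dsub D E) chi = ev D chi - ev E chi.
Proof. by rewrite /dsub /ev big_cat /= -/(ev (dscale (-1) E) chi) ev_dscale mulN1r. Qed.

Lemma Hp_norm_sub p P Q :
  Hp_norm p (fun s => deval P s - deval Q s) = pmean p (dsub (terms P) (terms Q)) `^ p^-1.
Proof. by apply: Hp_norm_pmean => t; rewrite ev_dsub !deval_imag. Qed.

Definition collect D : dirpoly R :=
  mkseq (fun i => \sum_(x <- D | x.2 == i.+1) x.1) (\max_(x <- D) x.2).

Lemma collect_sum D (g : nat -> C) : dpos D ->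
  \sum_(1 <= n < (size (collect D)).+1) dcoef (collect D) n * g n = \sum_(x <- D) x.1 * g x.2.
Proof.
move=> D0; rewrite size_mkseq; set M := \max_(x <- D) x.2.
have -> : \sum_(1 <= n < M.+1) dcoef (collect D) n * g n =
    \sum_(1 <= n < M.+1) \sum_(x <- D) (if x.2 == n then x.1 * g x.2 else 0).
  apply: eq_big_nat => n /andP[n1 nM]; rewrite -big_mkcond /=.
  have n0 : n.-1.+1 = n by rewrite prednK.
  rewrite /dcoef nth_mkseq; last by rewrite -ltnS n0.
  by rewrite n0 mulr_suml; apply: eq_bigr => x /eqP->.
rewrite exchange_big /= big_seq [RHS]big_seq; apply: eq_bigr => x xD.
have x0 := allP D0 _ xD; have xM : (x.2 <= M)%N.
  by rewrite (leq_bigmax_seq (F := fun x : C * nat => x.2)).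
rewrite -big_mkcond /= (big_rem x.2) ?mem_index_iota ?x0 //= eqxx.
rewrite big_seq_cond big1 ?addr0 // => n /andP[+ /eqP e]; rewrite -e.
by rewrite rem_filter ?iota_uniq // mem_filter /= eqxx.
Qed.

Lemma ev_collect D chi : dpos D -> ev (terms (collect D)) chi = ev D chi.
Proof. by move=> D0; rewrite /ev (terms_sum _ chi) collect_sum. Qed.

Lemma dual_sum (g : nat -> C) P : g 1%N = 1 ->
  dcoef P 1 + \sum_(2 <= n < (size P).+1) dcoef P n * g n = \sum_(x <- terms P) x.1 * g x.2.
Proof.
move=> g1; rewrite (terms_sum P g); case: P => [|a P].
  by rewrite !big_geq // addr0.
by rewrite [RHS]big_ltn // g1 mulr1.
Qed.

Lemma npow_real n (x : R) : (0 < n)%N -> npow n x%:C = (rpow x n)%:C.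
Proof.
move=> n0; rewrite /npow /= mul0r cos0 sin0 oppr0 rpowE //.
by rewrite -[1 +i* 0]/(1%:C) rmorph1 mulr1.
Qed.

Lemma cmod_npow_sq n s : (0 < n)%N -> cmod (npow n s) ^+ 2 = rpow (2 * Re s) n.
Proof. by move=> n0; rewrite cmod_npow -expRM_natr rpowE //; congr expR; ring. Qed.

(** The functional has norm [zeta (2 * Re s) ^ (1 / p)]; the simple pole of the
    zeta function at [1] is where the exponent [1 / p] comes from. *)
Lemma point_eval_zeta P s p (t : R) : 0 < p -> 0 < t -> 2 * Re s = 1 + t ->
  cmod (ev (terms P) (@npow R ^~ s)) <= (1 + t^-1) `^ p^-1 * Hp_norm p (deval P).
Proof.
move=> p0 t0 st; have D0 := terms_pos P; have qsp := plist_prime (size P).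
have s0 : 0 < Re s by lra.
have := @point_eval R (plist (size P)) s (terms P) p qsp D0 p0 s0.
have cover (x : C * nat) r : x \in terms P -> prime r -> (r %| x.2)%N -> r \in plist (size P).
  move=> /mapP[n]; rewrite mem_index_iota => /andP[n1 nS] -> /= rp rn.
  by rewrite mem_plist rp (leq_trans (dvdn_leq n1 rn)).
move=> /(_ cover).
have -> : \prod_(q <- plist (size P)) (1 - cmod (npow q s) ^+ 2) =
    \prod_(q <- plist (size P)) (1 - rpow (1 + t) q).
  rewrite big_seq [RHS]big_seq; apply: eq_bigr => q /(allP qsp) /prime_gt0 q0.
  by rewrite cmod_npow_sq // st.
move=> h; have e := euler_le t0 qsp (plist_uniq (size P)).
set Z := \prod_(q <- _) _ in h e; set F := cmod _ in h *.
have k0 : 0 < 1 + t^-1 by rewrite addr_gt0 // invr_gt0.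
rewrite Hp_norm_terms -powRM ?(ltW k0) ?pmean_ge0 //.
have -> : F = (F `^ p) `^ p^-1 by rewrite -powRrM divff ?gt_eqF // powRr1 // cmod_ge0.
apply: ler_powR2; rewrite ?invr_ge0 ?(ltW p0) ?powR_ge0 //.
apply: (@le_trans _ _ (F `^ p * ((1 + t^-1) * Z))); first by rewrite ler_peMr ?powR_ge0.
by rewrite mulrCA ler_wpM2l ?(ltW k0).
Qed.

(** Point evaluation bounds the polynomial on the line [Re s = 3 / 2], and a single
    coefficient is at most the square root of the mean square there. *)
Lemma coef_bound P p n : 0 < p -> (0 < n <= size P)%N ->
  cmod (dcoef P n) * rpow (3 / 2) n <= (3 / 2) `^ p^-1 * Hp_norm p (deval P).
Proof.
move=> p0 /andP[n0 nS].
pose E : dlist R := [seq (dcoef P n * (rpow (3 / 2) n)%:C, n) | n <- index_iota 1 (size P).+1].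
have E0 : dpos E by apply/allP => x /mapP[k]; rewrite mem_index_iota => /andP[n1 _] ->.
set B := _ * Hp_norm _ _.
have B0 : 0 <= B by apply: mulr_ge0; rewrite ?Hp_norm_terms powR_ge0.
have evE t : cmod (ev E (nchar t)) <= B.
  have st : 2 * Re ((3 / 2) +i* t : C) = 1 + 2 by rewrite /=; lra.
  have := point_eval_zeta P p0 (ltr0Sn R 1) st.
  have -> : ev (terms P) (@npow R ^~ ((3 / 2) +i* t)) = ev E (nchar t).
    rewrite /ev (terms_sum P (@npow R ^~ _)) big_map; apply: eq_big_nat => k /andP[k0 _] /=.
    by rewrite -mulrA rpowE.
  by have -> : 1 + 2^-1 = 3 / 2 :> R by lra.
have m2 : pmean 2 E <= B ^+ 2.
  have := @pmean_le_sum R unit [::] (fun=> 0) (fun=> 1) (fun=> E) (B ^+ 2) 2 E E0 (ltr0Sn R 1).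
  rewrite big_nil addr0; apply => // t; rewrite big_nil addr0 powR_mulrn ?cmod_ge0 //.
  by rewrite lerXn2r ?nnegrE ?cmod_ge0.
have L0 : 0 <= cmod (dcoef P n) * rpow (3 / 2) n by rewrite mulr_ge0 ?cmod_ge0 ?rpow_ge0.
rewrite -(@ler_pXn2r _ 2) ?nnegrE //.
apply: le_trans m2; rewrite pmean2E // Re_sum big_map.
have nI : n \in index_iota 1 (size P).+1 by rewrite mem_index_iota n0.
have term k : Re (\sum_(y <- E | k == y.2) (dcoef P k * (rpow (3 / 2) k)%:C) * conjc y.1) =
    if k \in index_iota 1 (size P).+1 then (cmod (dcoef P k) * rpow (3 / 2) k) ^+ 2 else 0.
  rewrite big_map /=; case: ifP => kI.
    rewrite (big_rem k) //= eqxx big_seq_cond big1 ?addr0.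
      by rewrite mulJ cmodM cmod_real ger0_norm ?rpow_ge0.
    move=> j /andP[+ /eqP e]; rewrite -e rem_filter ?iota_uniq //.
    by rewrite mem_filter /= eqxx.
  by rewrite big_seq_cond big1 // => j /andP[+ /eqP e]; rewrite -e kI.
rewrite (eq_bigr (fun k => if k \in index_iota 1 (size P).+1 then
   (cmod (dcoef P k) * rpow (3 / 2) k) ^+ 2 else 0)) => [|k _]; last exact: term.
rewrite (big_rem n) //= nI lerDl; apply: sumr_ge0 => j _.
by case: ifP => _ //; exact: sqr_ge0.
Qed.

End DirichletPolynomials.

(** * The weights [(log n) ^ (- b)] as superpositions of powers [n ^ (- s)] *)

Section Superposition.
Variable R : realType.
Implicit Types (b g c d e x y : R).

(** A Riemann sum with step [e] for the integral of [s `^ (b - 1) * G s], divided by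
    the value at [b] of the Gamma function. The weights are those for which
    [G s = expR (- (s * x))] gives a partial sum of a binomial series, so that the
    value [x `^ (- b)] of the integral is approached without any Gamma function. *)
Definition superpos b e (K : nat) (G : R -> R) : R :=
  \sum_(k < K) e `^ b * binc b k.+1 * G (k.+1%:R * e).

Lemma expR_quotient x : 0 < x -> 1 <= x / (1 - expR (- x)) <= 1 + x.
Proof.
move=> x0; have e1 : 0 < 1 - expR (- x) by rewrite subr_gt0 expR_lt1 oppr_lt0.
rewrite ler_pdivlMr // mul1r ler_pdivrMr //; apply/andP; split.
  by have := expR_ge1Dx (- x); lra.
have := expR_ge1Dx x; have := expRxMexpNx_1 x; have := expR_gt0 (- x).
set u := expR (- x); set v := expR x; nra.
Qed.

Lemma superpos_limit1 b x d : 0 < b -> 0 < x -> 0 < d -> exists2 e0, 0 < e0 &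
  forall e, 0 < e -> e <= e0 -> `|(e / (1 - expR (- (e * x)))) `^ b - x `^ (- b)| <= d.
Proof.
move=> b0 x0 d0; have xb : 0 < x `^ (- b) by rewrite powR_gt0.
pose M := 2 * b * x * x `^ (- b) / d + 2 * b * x.
have M0 : 0 < M by rewrite addr_gt0 // ?divr_gt0 ?mulr_gt0.
exists M^-1; first by rewrite invr_gt0.
move=> e e0 eM; have ex : 0 < e * x by rewrite mulr_gt0.
have := expR_quotient ex; set q := _ / _ => /andP[q1 q2].
have -> : e / (1 - expR (- (e * x))) = x^-1 * q.
  by rewrite /q [e * x]mulrC; field; rewrite !gt_eqF // subr_gt0 expR_lt1 oppr_lt0 mulr_gt0.
have q0 : 0 <= q by lra.
rewrite powRM ?invr_ge0 ?(ltW x0) //.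
have -> : x^-1 `^ b = x `^ (- b) by rewrite -powR_inv1 ?ltW // -powRrM mulN1r.
rewrite -[X in _ - X]mulr1 -mulrBr normrM ger0_norm ?(ltW xb) //.
have eM1 : e * M <= 1 by rewrite -ler_pdivlMr // mul1r.
have eMe : e * M = e * (2 * b * x * x `^ (- b) / d) + 2 * b * (e * x) by rewrite /M; ring.
have p1 : 0 <= e * (2 * b * x * x `^ (- b) / d) by nneg.
have p2 : 0 <= 2 * b * (e * x) by nneg.
have u1 : b * (e * x) <= 2^-1 by lra.
have h1 : 1 <= q `^ b by rewrite -(powRr0 q); apply: ler_powR => //; exact: ltW.
have h2 : q `^ b <= 1 + 2 * (b * (e * x)).
  apply: (@le_trans _ _ ((1 + e * x) `^ b)); first by rewrite ler_powR2 // ltW.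
  apply: (@le_trans _ _ (expR (e * x) `^ b)).
    by rewrite ler_powR2 ?(ltW b0) ?expR_ge1Dx // addr_ge0 // ltW.
  rewrite -expRM [_ * b]mulrC; apply: (le_trans (expR_le_inv1B _)); first lra.
  have bp : 0 <= b * (e * x) by nneg.
  move: (b * (e * x)) u1 bp => u u1 bp; rewrite -div1r ler_pdivrMr; nra.
rewrite ger0_norm ?subr_ge0 //.
have h3 : q `^ b - 1 <= 2 * (b * (e * x)) by lra.
apply: (le_trans (ler_wpM2l (ltW xb) h3)).
have E : x `^ (- b) * (2 * (b * (e * x))) = d * (e * (2 * b * x * x `^ (- b) / d)).
  by field; rewrite gt_eqF.
rewrite E -[leRHS]mulr1 ler_wpM2l ?(ltW d0) //; lra.
Qed.

Lemma superpos_limit b (xs : seq R) d : 0 < b -> 0 < d -> all (fun x => 0 < x) xs ->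
  exists e K, [/\ 0 < e, e <= 1 & forall x, x \in xs ->
    `|superpos b e K (fun s => expR (- (s * x))) - x `^ (- b)| <= d].
Proof.
move=> b0 d0 xs0; have d3 : 0 < d / 3 by lra.
have [e1 e10 H1] : exists2 e1, 0 < e1 & forall e, 0 < e -> e <= e1 -> forall x, x \in xs ->
    `|(e / (1 - expR (- (e * x)))) `^ b - x `^ (- b)| <= d / 3.
  elim: xs xs0 => [|x xs ih] /=; first by move=> _; exists 1.
  move=> /andP[x0 /ih[e1 e10 H1]]; have [e2 e20 H2] := superpos_limit1 b0 x0 d3.
  exists (Num.min e1 e2); first by rewrite lt_min e10.
  move=> e e0; rewrite le_min => /andP[h1 h2] y; rewrite inE => /orP[/eqP->|yx].
    exact: H2.
  exact: H1.
pose e := Num.min e1 (Num.min 1 ((d / 3) `^ b^-1)).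
have e0 : 0 < e by rewrite !lt_min e10 ltr01 powR_gt0.
have ee1 : e <= e1 by rewrite ge_min lexx.
have ee2 : e <= 1 by rewrite !ge_min lexx orbT.
have ee3 : e `^ b <= d / 3.
  have : e <= (d / 3) `^ b^-1 by rewrite !ge_min lexx !orbT.
  move=> /(ler_powR2 (ltW b0) (ltW e0)).
  by rewrite -powRrM mulVf ?gt_eqF // powRr1 // ltW.
have eb0 : 0 < e `^ b by rewrite powR_gt0.
have [K HK] : exists N, forall n, (N <= n)%N -> forall x, x \in xs ->
    `|(binpoly b n).[expR (- (e * x))] - (1 - expR (- (e * x))) `^ (- b)| <= d / 3 / e `^ b.
  elim: xs xs0 {H1} => [|x xs ih] /=; first by move=> _; exists 0%N.
  move=> /andP[x0 /ih[N1 H1]].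
  have y1 : expR (- (e * x)) < 1 by rewrite expR_lt1 oppr_lt0 mulr_gt0.
  have [N2 H2] := binpoly_cvg b (expR_ge0 _) y1 (divr_gt0 d3 eb0).
  exists (maxn N1 N2) => n; rewrite geq_max => /andP[n1 n2] y.
  rewrite inE => /orP[/eqP->|yx]; last exact: H1.
  by apply: H2 => //; exact: expR_ge0.
exists e, K; split=> // x xx; have x0 := allP xs0 _ xx.
have y1 : expR (- (e * x)) < 1 by rewrite expR_lt1 oppr_lt0 mulr_gt0.
(* The sum omits the term of index [0] of the binomial series, at a cost [e `^ b]. *)
have -> : superpos b e K (fun s => expR (- (s * x))) =
    e `^ b * ((binpoly b K).[expR (- (e * x))] - 1).
  rewrite horner_binpoly big_ord_recl binc0 expr0 mulr1 [1 + _]addrC addrK mulr_sumr.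
  apply: eq_bigr => k _; rewrite -mulrA -expRM_natl.
  by congr (_ * (_ * expR _)); rewrite mulrN mulrA.
have -> : e `^ b * ((binpoly b K).[expR (- (e * x))] - 1) - x `^ (- b) =
  e `^ b * ((binpoly b K).[expR (- (e * x))] - (1 - expR (- (e * x))) `^ (- b)) +
  ((e / (1 - expR (- (e * x)))) `^ b - x `^ (- b)) - e `^ b.
  have -> : (e / (1 - expR (- (e * x)))) `^ b = e `^ b * (1 - expR (- (e * x))) `^ (- b).
    have u0 : 0 <= 1 - expR (- (e * x)) by rewrite subr_ge0 ltW.
    by rewrite powRM ?invr_ge0 ?(ltW e0) // -powR_inv1 // -powRrM mulN1r.
  by ring.
rewrite [leRHS](_ : d = d / 3 + d / 3 + d / 3); last by field.
apply: (le_trans (ler_normB _ _)); apply: lerD; last by rewrite ger0_norm ?(ltW eb0).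
apply: (le_trans (ler_normD _ _)); apply: lerD; last exact: H1.
rewrite normrM ger0_norm ?(ltW eb0) //.
apply: (le_trans (ler_wpM2l (ltW eb0) (HK K (leqnn K) _ xx))).
by rewrite mulrCA divff ?mulr1 // gt_eqF.
Qed.

(** The integral of [s `^ (b - 1 - g) * expR (- (c * s))] is finite because [g < b].
    For the Riemann sum, [binc_shift] absorbs the factor [s `^ (- g)] into the
    weights, turning them into those of the exponent [b - g]. *)
Lemma superpos_bound b g c : 0 < g -> g < b -> 0 < c -> exists2 S, 0 < S &
  forall e K, 0 < e -> e <= 1 ->
    superpos b e K (fun s => s `^ (- g) * expR (- (c * s))) <= S.
Proof.
move=> g0 gb c0; have d0 : 0 < b - g by lra.
have [A A0 HA] := binc_shift d0 (ltW g0).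
exists (A * ((1 + c) / c) `^ (b - g)).
  by rewrite mulr_gt0 // powR_gt0 // divr_gt0 // addr_gt0.
move=> e K e0 e1; have ce : 0 < c * e by rewrite mulr_gt0.
have y1 : expR (- (c * e)) < 1 by rewrite expR_lt1 oppr_lt0.
apply: (@le_trans _ _ (A * (e `^ (b - g) * (binpoly (b - g) K).[expR (- (c * e))]))).
  rewrite horner_binpoly big_ord_recl mulrDr mulrDr -[leLHS]add0r; apply: lerD.
    by rewrite binc0 expr0 !mulr1 mulr_ge0 ?powR_ge0 // ltW.
  rewrite !mulr_sumr; apply: ler_sum => k _.
  have kp : (0 : R) < k.+1%:R by rewrite ltr0n.
  have -> : expR (- (c * (k.+1%:R * e))) = expR (- (c * e)) ^+ k.+1.
    by rewrite -expRM_natl; congr expR; rewrite mulrN mulrCA.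
  have -> : (k.+1%:R * e) `^ (- g) = k.+1%:R `^ (- g) * e `^ (- g) by rewrite powRM // ltW.
  have -> : e `^ (b - g) = e `^ b * e `^ (- g) by rewrite powRD // (gt_eqF e0) implybT.
  have H := HA k; rewrite subrK in H.
  have H2 := ler_wpM2r (powR_ge0 k.+1%:R (- g)) H.
  have Hk : A * k.+1%:R `^ g * binc (b - g) k.+1 * k.+1%:R `^ (- g) = A * binc (b - g) k.+1.
    by rewrite powRN; field; rewrite gt_eqF // powR_gt0.
  rewrite Hk in H2.
  have Z : 0 <= e `^ b * e `^ (- g) * expR (- (c * e)) ^+ k.+1 by nneg.
  have h := ler_wpM2l Z H2; rewrite lift0; apply: (le_trans (le_trans _ h)).
    by rewrite le_eqVlt; apply/orP; left; apply/eqP; ring.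
  by rewrite le_eqVlt; apply/orP; left; apply/eqP; ring.
rewrite ler_wpM2l ?(ltW A0) //.
apply: (@le_trans _ _ (e `^ (b - g) * (1 - expR (- (c * e))) `^ (- (b - g)))).
  by rewrite ler_wpM2l ?powR_ge0 // binpoly_le // expR_ge0.
have u0 : 0 < 1 - expR (- (c * e)) by rewrite subr_gt0.
have -> : (1 - expR (- (c * e))) `^ (- (b - g)) = ((1 - expR (- (c * e)))^-1) `^ (b - g).
  by rewrite -[in RHS]powR_inv1 ?(ltW u0) // -powRrM mulN1r.
rewrite -powRM ?(ltW e0) ?invr_ge0 ?(ltW u0) //; apply: ler_powR2; first exact: ltW.
  by rewrite divr_ge0 // ltW.
have /andP[_ h] := expR_quotient ce.
rewrite ler_pdivlMr // mulrC mulrA; apply: (le_trans h).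
by rewrite lerD2l ler_piMr // ltW.
Qed.

(** The norms integrated below behave like [s `^ (- g)] for small [s] and decay
    exponentially for large [s]; both regimes are dominated by one weight to which
    [superpos_bound] applies. *)
Lemma decay_weight g : 0 < g -> exists2 S, 0 < S & forall s, 0 < s ->
  (s <= 3 -> s `^ (- g) <= S * (s `^ (- g) * expR (- (4^-1 * s)))) /\
  (expR (- (2^-1 * s)) <= S * (s `^ (- g) * expR (- (4^-1 * s)))).
Proof.
move=> g0; have c0 : 0 < 4^-1 :> R by lra.
have [K K0 HK] := powR_le_expR g0 c0.
exists (K + expR 1); first by rewrite addr_gt0 // expR_gt0.
move=> s s0; have sg := powR_gt0 (- g) s0; split.
  move=> s3; rewrite mulrCA -[leLHS]mulr1 ler_wpM2l ?(ltW sg) //.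
  apply: (@le_trans _ _ (expR 1 * expR (- (4^-1 * s)))).
    rewrite -expRD -[leLHS]expR0 ler_expR; lra.
  by rewrite ler_wpM2r ?expR_ge0 // lerDr ltW.
have -> : expR (- (2^-1 * s)) = expR (- (4^-1 * s)) * expR (- (4^-1 * s)).
  by rewrite -expRD; congr expR; lra.
rewrite mulrA ler_wpM2r ?expR_ge0 //.
apply: (@le_trans _ _ (K * s `^ (- g))); last first.
  by rewrite ler_wpM2r ?(ltW sg) // lerDl expR_ge0.
have h := HK _ (ltW s0); rewrite powRN ler_pdivlMr ?powR_gt0 // expRN mulrC.
by rewrite ler_pdivrMr ?expR_gt0.
Qed.

End Superposition.

(** * Boundedness of the functional for [beta > 1 / p] *)

Section DualPositive.
Variable R : realType.
Local Notation C := R[i].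
Implicit Types (P : dirpoly R) (p beta s : R).

Lemma phi_coef1 beta : phi_coef beta 1 = 1 :> R. Proof. by []. Qed.

Lemma phi_coefE beta n : (1 < n)%N ->
  phi_coef beta n = rpow (2^-1) n * ln n%:R `^ (- beta) :> R.
Proof.
move=> n1; have n0 := ltnW n1; rewrite /phi_coef gtn_eqF // invfM powRN /rpow powRN.
by rewrite powR12_sqrt.
Qed.

Lemma phi_coef_ge0 beta n : 0 <= phi_coef beta n :> R.
Proof. by rewrite /phi_coef; case: ifP => // _; rewrite invr_ge0 mulr_ge0 ?sqrtr_ge0 ?powR_ge0. Qed.

Lemma ln_nat_ge n : (1 < n)%N -> 2^-1 <= ln n%:R :> R.
Proof.
move=> n1; apply: (@le_trans _ _ (ln 2%:R)).
  by have := @ln_step2 R 1 (ltnSn 0); rewrite ln1 subr0.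
by rewrite ler_ln ?posrE ?ltr0n ?ler_nat // ltnW.
Qed.

(** All terms with [n >= 2] decay exponentially in [s]; the constant term does not,
    which is why it is split off throughout. *)
Lemma rpow_decay (t s : R) n : (1 < n)%N -> t <= s -> rpow (s - t) n <= expR (t / 2) * expR (- (2^-1 * s)).
Proof.
move=> n1 ts; rewrite rpowE ?(ltnW n1) // -expRD ler_expR.
have h : (s - t) * 2^-1 <= (s - t) * ln n%:R by rewrite ler_wpM2l ?subr_ge0 // ln_nat_ge.
lra.
Qed.

Lemma Hp_norm_ge0 P p : 0 <= Hp_norm p (deval P).
Proof. by rewrite Hp_norm_terms powR_ge0. Qed.

Lemma coef1_bound P p : 0 < p ->
  cmod (dcoef P 1) <= (3 / 2) `^ p^-1 * Hp_norm p (deval P).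
Proof.
move=> p0; case: (posnP (size P)) => [e|P1].
  rewrite /dcoef nth_default ?e // cmod0 mulr_ge0 ?powR_ge0 //; exact: Hp_norm_ge0.
by have := @coef_bound R P p 1 p0 P1; rewrite (rpow_mul _).1 mulr1.
Qed.

Lemma tailE P s : \sum_(2 <= n < (size P).+1) dcoef P n * (rpow (2^-1 + s) n)%:C =
  ev (terms P) (@npow R ^~ (2^-1 + s)%:C) - dcoef P 1.
Proof.
have g1 : (rpow (2^-1 + s) 1)%:C = 1 by rewrite (rpow_mul _).1.
have <- : dcoef P 1 + \sum_(2 <= n < (size P).+1) dcoef P n * (rpow (2^-1 + s) n)%:C = ev (terms P) (@npow R ^~ (2^-1 + s)%:C).
  apply: (etrans (@dual_sum R (fun n => (rpow (2^-1 + s) n)%:C) P g1)).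
  rewrite /ev big_seq [RHS]big_seq; apply: eq_bigr => x xP.
  by rewrite npow_real // (allP (terms_pos P) _ xP).
by rewrite [RHS]addrC addKr.
Qed.

(** For small [s] this is point evaluation at [1 / 2 + s]; for large [s] the bounds
    of the single coefficients are summed. *)
Lemma tail_bound p : 0 < p -> exists2 A : R, 0 < A & forall P s, 0 < s ->
  cmod (\sum_(2 <= n < (size P).+1) dcoef P n * (rpow (2^-1 + s) n)%:C) <=
  A * Hp_norm p (deval P) * (s `^ (- p^-1) * expR (- (4^-1 * s))).
Proof.
move=> p0; set g := p^-1; have g0 : 0 < g by rewrite invr_gt0.
have [S S0 HS] := decay_weight g0.
pose K0 : R := (3 / 2) `^ g; have K00 : 0 < K0 by rewrite powR_gt0 //; lra.
pose A1 : R := 4 `^ g + K0 * 3 `^ g; have A10 : 0 < A1.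
  by rewrite addr_gt0 ?mulr_gt0 ?powR_gt0.
pose A2 : R := 2 * K0 * expR (3 / 2); have A20 : 0 < A2 by rewrite !mulr_gt0 ?expR_gt0.
exists ((A1 + A2) * S); first by apply: mulr_gt0 => //; exact: addr_gt0.
move=> P s s0; set N := Hp_norm p (deval P); set W := s `^ (- g) * expR _.
have N0 : 0 <= N by exact: Hp_norm_ge0.
have W0 : 0 <= W by rewrite mulr_ge0 ?powR_ge0 ?expR_ge0.
have [H1 H2] := HS _ s0; rewrite -/W in H1 H2.
have c1 := coef1_bound P p0; rewrite -/K0 -/N in c1.
case: (leP s 3) => s3.
  apply: (@le_trans _ _ (A1 * N * (S * W))); last first.
    have -> : (A1 + A2) * S * N * W = A1 * N * (S * W) + A2 * N * (S * W) by ring.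
    by rewrite lerDl; nneg.
  apply: le_trans (ler_wpM2l _ (H1 s3)); last by nneg.
  rewrite tailE; apply: (le_trans (cmodB _ _)).
  have t0 : 0 < 2 * s by rewrite mulr_gt0.
  have st : 2 * complex.Re ((2^-1 + s)%:C : C) = 1 + 2 * s by rewrite /=; lra.
  have sg : 0 < s `^ (- g) by rewrite powR_gt0.
  have h1 : cmod (ev (terms P) (@npow R ^~ (2^-1 + s)%:C)) <= 4 `^ g * s `^ (- g) * N.
    apply: (le_trans (point_eval_zeta P p0 t0 st)); rewrite ler_wpM2r //.
    have -> : s `^ (- g) = s^-1 `^ g by rewrite -powR_inv1 ?ltW // -powRrM mulN1r.
    rewrite -powRM ?invr_ge0 ?(ltW s0) //; apply: ler_powR2; first exact: ltW.
      by rewrite addr_ge0 // invr_ge0 ltW.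
    have -> : 1 + (2 * s)^-1 = (2 * s + 1) / 2 / s by field; rewrite gt_eqF.
    rewrite ler_wpM2r ?invr_ge0 ?(ltW s0) //; lra.
  have h2 : 1 <= 3 `^ g * s `^ (- g).
    have -> : s `^ (- g) = s^-1 `^ g by rewrite -powR_inv1 ?ltW // -powRrM mulN1r.
    rewrite -powRM ?invr_ge0 ?(ltW s0) //.
    apply: (@le_trans _ _ ((3 * s^-1) `^ 0)); first by rewrite powRr0.
    by apply: ler_powR; rewrite ?(ltW g0) // ler_pdivlMr // mul1r.
  have h3 : K0 * N <= K0 * N * (3 `^ g * s `^ (- g)) by rewrite ler_peMr //; nneg.
  apply: (le_trans (lerD h1 (le_trans c1 h3))).
  by rewrite le_eqVlt; apply/orP; left; apply/eqP; rewrite /A1; ring.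
apply: (@le_trans _ _ (A2 * N * (S * W))); last first.
  have -> : (A1 + A2) * S * N * W = A1 * N * (S * W) + A2 * N * (S * W) by ring.
  by rewrite lerDr; nneg.
apply: le_trans (ler_wpM2l _ H2); last by nneg.
apply: (le_trans (cmod_sum _ _ _)).
apply: (@le_trans _ _ (\sum_(2 <= n < (size P).+1)
   (rpow (1 + 1) n * (K0 * N * (expR (3 / 2) * expR (- (2^-1 * s))))))).
  rewrite big_nat_cond [leRHS]big_nat_cond; apply: ler_sum => n /andP[/andP[n2 nS] _].
  have n0 : (0 < n)%N by exact: ltnW.
  rewrite cmodM cmod_real ger0_norm ?rpow_ge0 //.
  have -> : 2^-1 + s = 3 / 2 + ((1 + 1) + (s - 3)) by lra.
  rewrite rpowD // rpowD // mulrA.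
  have cb : cmod (dcoef P n) * rpow (3 / 2) n <= K0 * N.
    by apply: coef_bound => //; rewrite n0.
  have db := rpow_decay n2 (ltW s3).
  have r2 := rpow_ge0 (1 + 1 : R) n.
  rewrite [leRHS]mulrCA; apply: ler_pM => //; rewrite ?mulr_ge0 ?rpow_ge0 ?cmod_ge0 //.
  by rewrite ler_wpM2l.
rewrite -mulr_suml.
have z : \sum_(2 <= n < (size P).+1) rpow (1 + 1) n <= 2 :> R.
  have -> : 2 = 1 + 1^-1 :> R by rewrite invr1.
  apply: zeta_sum_le; [exact: ltr01|exact: iota_uniq|].
  by apply/allP => n; rewrite mem_index_iota => /andP[/ltnW].
apply: (le_trans (ler_wpM2r _ z)); first by nneg.
by rewrite le_eqVlt; apply/orP; left; apply/eqP; rewrite /A2; ring.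
Qed.

Lemma cmod_real_sum (n : nat) (mu : 'I_n -> R) (z : 'I_n -> C) : (forall k, 0 <= mu k) ->
  cmod (\sum_(k < n) (mu k)%:C * z k) <= \sum_(k < n) mu k * cmod (z k).
Proof.
move=> m0; apply: (le_trans (cmod_sum _ _ _)); apply: ler_sum => k _.
by rewrite cmodM cmod_real ger0_norm.
Qed.

Lemma superpos_term (beta e : R) K n : (0 < n)%N ->
  rpow (2^-1) n * superpos beta e K (fun s => expR (- (s * ln n%:R))) =
  \sum_(k < K) e `^ beta * binc beta k.+1 * rpow (2^-1 + k.+1%:R * e) n.
Proof.
move=> n0; rewrite /superpos mulr_sumr; apply: eq_bigr => k _.
by rewrite rpowD // [rpow (k.+1%:R * e) n]rpowE //; ring.
Qed.

(** [(ln n) ^ (- beta)] is a superposition of the [n ^ (- s)], hence the functional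
    is one of the point evaluations at [1 / 2 + s], of norm [s ^ (- 1 / p)]; the
    superposition of these norms is finite for [beta > 1 / p]. *)
Lemma phi_dual_bounded p beta : 0 < p -> p^-1 < beta -> phi_in_Hp_dual p beta.
Proof.
move=> p0 pb; have g0 : 0 < p^-1 by rewrite invr_gt0.
have b0 : 0 < beta by exact: lt_trans pb.
have [A A0 HA] := tail_bound p0.
have c0 : 0 < 4^-1 :> R by lra.
have [S S0 HS] := superpos_bound g0 pb c0.
pose K0 : R := (3 / 2) `^ p^-1; have K00 : 0 < K0 by rewrite powR_gt0 //; lra.
exists (K0 + A * S); split; first by rewrite addr_gt0 ?mulr_gt0.
move=> P; set N := Hp_norm p (deval P).
have N0 : 0 <= N by exact: Hp_norm_ge0.
apply/ler_addgt0Pr => d d0.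
pose M : R := \sum_(2 <= n < (size P).+1) cmod (dcoef P n) + 1.
have M0 : 0 < M by rewrite ltr_wpDl // sumr_ge0 // => n _; exact: cmod_ge0.
have lnp : all (fun x : R => 0 < x) [seq ln n%:R | n <- index_iota 2 (size P).+1].
  apply/allP => x /mapP[n]; rewrite mem_index_iota => /andP[n2 _] ->.
  by apply: lt_le_trans (ln_nat_ge n2); rewrite invr_gt0.
have [e [K [e0 e1 He]]] := superpos_limit b0 (divr_gt0 d0 M0) lnp.
set Sum := \sum_(2 <= n < _) _.
pose T : C := \sum_(k < K) (e `^ beta * binc beta k.+1)%:C *
  \sum_(2 <= n < (size P).+1) dcoef P n * (rpow (2^-1 + k.+1%:R * e) n)%:C.
have mu0 (k : 'I_K) : 0 <= e `^ beta * binc beta k.+1.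
  by rewrite mulr_ge0 ?powR_ge0 ?binc_ge0 // ltW.
have hT : cmod T <= A * S * N.
  apply: (le_trans (cmod_real_sum _ mu0)).
  apply: (@le_trans _ _ (A * N * superpos beta e K
     (fun s => s `^ (- p^-1) * expR (- (4^-1 * s))))); last first.
    have -> : A * S * N = A * N * S by ring.
    by rewrite ler_wpM2l ?HS //; nneg.
  rewrite /superpos mulr_sumr; apply: ler_sum => k _.
  rewrite [leRHS]mulrCA ler_wpM2l //; apply: HA.
  by rewrite mulr_gt0 // ltr0n.
have TE : T = \sum_(2 <= n < (size P).+1) dcoef P n *
    (rpow (2^-1) n * superpos beta e K (fun s => expR (- (s * ln n%:R))))%:C.
  rewrite /T (eq_bigr (fun k : 'I_K => \sum_(2 <= n < (size P).+1) dcoef P n *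
    (e `^ beta * binc beta k.+1 * rpow (2^-1 + k.+1%:R * e) n)%:C)); last first.
    by move=> k _; rewrite mulr_sumr; apply: eq_bigr => n _; rewrite [in RHS]rmorphM /= mulrCA.
  rewrite exchange_big /=; apply: eq_big_nat => n /andP[n2 _].
  by rewrite -mulr_sumr superpos_term ?(ltnW n2) // real_complex_sum.
have hd : cmod (Sum - T) <= d.
  rewrite TE /Sum -sumrB; apply: (le_trans (cmod_sum _ _ _)).
  apply: (@le_trans _ _ (\sum_(2 <= n < (size P).+1) cmod (dcoef P n) * (d / M))).
    rewrite big_nat_cond [leRHS]big_nat_cond; apply: ler_sum => n /andP[/andP[n2 nS] _].
    rewrite -mulrBr cmodM ler_wpM2l ?cmod_ge0 // -rmorphB cmod_real phi_coefE //.
    rewrite -mulrBr normrM ger0_norm ?rpow_ge0 // distrC.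
    have nl : (ln n%:R : R) \in [seq ln n%:R | n <- index_iota 2 (size P).+1].
      by apply/mapP; exists n => //; rewrite mem_index_iota n2.
    apply: (le_trans _ (He _ nl)); rewrite ler_piMl // rpow_le1 ?(ltnW n2) //.
  rewrite -mulr_suml mulrA ler_pdivrMr // mulrC ler_wpM2l ?(ltW d0) //.
  by rewrite /M lerDl.
have -> : dcoef P 1 + Sum = dcoef P 1 + T + (Sum - T) by ring.
apply: (le_trans (cmodD _ _)); apply: lerD => //.
apply: (le_trans (cmodD _ _)); rewrite mulrDl; apply: lerD => //.
exact: coef1_bound.
Qed.

End DualPositive.

(** * Products of one-variable polynomials over primes *)

Section EulerProducts.
Variable R : realType.
Local Notation C := R[i].
Implicit Types (c d : nat -> nat -> R) (K : nat) (qs : seq nat) (L M : seq (R * nat)).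

Definition lmul L M : seq (R * nat) :=
  [seq (x.1 * y.1, (x.2 * y.2)%N) | x <- L, y <- M].

Definition lpowers (f : nat -> R) K q : seq (R * nat) :=
  [seq (f k, (q ^ k)%N) | k <- index_iota 0 K.+1].

(** Dirichlet polynomials with real coefficients that factor over the primes; means
    and correlations of these factor as well. *)
Definition eprod c K qs : seq (R * nat) :=
  foldr (fun q L => lmul (lpowers (c q) K q) L) [:: (1, 1%N)] qs.

Definition lpos L := all (fun x => 0 < x.2)%N L.

Definition rterms L : dlist R := [seq (x.1%:C, x.2) | x <- L].

Lemma eprod_cons c K q qs : eprod c K (q :: qs) = lmul (lpowers (c q) K q) (eprod c K qs).
Proof. by []. Qed.

Lemma eprod_nil c K : eprod c K [::] = [:: (1, 1%N)].
Proof. by []. Qed.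

Lemma lmul_sum (A : nmodType) L M (F : R * nat -> A) :
  \sum_(z <- lmul L M) F z = \sum_(x <- L) \sum_(y <- M) F (x.1 * y.1, (x.2 * y.2)%N).
Proof. by rewrite big_allpairs_dep. Qed.

Lemma lpowers_sum (A : nmodType) f K q (F : R * nat -> A) :
  \sum_(z <- lpowers f K q) F z = \sum_(k < K.+1) F (f k, (q ^ k)%N).
Proof. by rewrite big_map big_mkord. Qed.

Lemma eprod_pos c K qs : all prime qs -> lpos (eprod c K qs).
Proof.
elim: qs => [|q qs ih] //; rewrite eprod_cons => /andP[qp /ih h].
apply/allP => z /allpairsP[[x y] /= [xL yL ->]] /=; rewrite muln_gt0.
rewrite (allP h _ yL) andbT; move: xL => /mapP[k _ ->] /=.
by rewrite expn_gt0 prime_gt0.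
Qed.

Lemma rterms_pos L : lpos L -> dpos (rterms L).
Proof. by move=> h; apply/allP => x /mapP[y yL ->]; exact: (allP h _ yL). Qed.

Lemma eprod_ge0 c K qs : (forall q k, 0 <= c q k) -> all (fun x => 0 <= x.1) (eprod c K qs).
Proof.
move=> c0; elim: qs => [|q qs ih] /=; first by rewrite ler01.
apply/allP => z /allpairsP[[x y] /= [xL yL ->]] /=; rewrite mulr_ge0 ?(allP ih _ yL) //.
by move: xL => /mapP[k _ ->] /=; rewrite c0.
Qed.

Lemma eprod_coprime c K qs q x : all prime qs -> prime q -> q \notin qs ->
  x \in eprod c K qs -> coprime q x.2.
Proof.
move=> + qp; elim: qs x => [|r qs ih] x.
  by move=> _ _; rewrite eprod_nil inE => /eqP->; rewrite coprimen1.
rewrite eprod_cons => /andP[rp qsp]; rewrite inE negb_or => /andP[qr qn].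
move=> /allpairsP[[y z] /= [yL zL ->]] /=; rewrite coprimeMr (ih _ qsp qn zL) andbT.
move: yL => /mapP[k _ ->] /=; apply: coprimeXr.
by rewrite prime_coprime // dvdn_prime2.
Qed.

Lemma eprod_sum c K qs (g : nat -> R) : multiplicative_on_pos g -> all prime qs ->
  \sum_(x <- eprod c K qs) x.1 * g x.2 = \prod_(q <- qs) \sum_(k < K.+1) c q k * g q ^+ k.
Proof.
move=> mg; have [g1 gM] := mg; elim: qs => [|q qs ih].
  by rewrite eprod_nil big_seq1 big_nil g1 mulr1.
rewrite eprod_cons => /andP[qp qsp]; have q0 := prime_gt0 qp.
rewrite big_cons -(ih qsp) lmul_sum lpowers_sum mulr_suml; apply: eq_bigr => k _ /=.
rewrite mulr_sumr big_seq [RHS]big_seq; apply: eq_bigr => y yL.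
have qk : (0 < q ^ k)%N by rewrite expn_gt0 q0.
rewrite (gM _ _ qk (allP (eprod_pos c K qsp) _ yL)) (mulposX k mg q0); ring.
Qed.

Lemma ev_eprod c K qs t : all prime qs ->
  ev (rterms (eprod c K qs)) (nchar t) =
  \prod_(q <- qs) \sum_(k < K.+1) (c q k)%:C * nchar t q ^+ k.
Proof.
elim: qs => [|q qs ih].
  by rewrite /ev big_map eprod_nil big_seq1 big_nil mul1r -[1%N]/(2 ^ 0)%N ncharX.
rewrite eprod_cons => /andP[qp qsp]; have q0 := prime_gt0 qp.
rewrite big_cons -(ih qsp) /ev !big_map lmul_sum lpowers_sum mulr_suml; apply: eq_bigr => k _ /=.
rewrite mulr_sumr big_seq [RHS]big_seq; apply: eq_bigr => y yL.
rewrite ncharM ?expn_gt0 ?q0 ?(allP (eprod_pos c K qsp) _ yL) // ncharX // rmorphM /=; ring.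
Qed.

(** The mean of [F * M * conj L], for [F] with coefficients [kap]: only the terms
    with [n * y = x] survive. When [kap] is the indicator of [1], this is the mean
    of [M * conj L]. *)
Definition lcorr (kap : nat -> R) L M : R :=
  \sum_(x <- L) \sum_(y <- M) if (y.2 %| x.2)%N then x.1 * y.1 * kap (x.2 %/ y.2)%N else 0.

(** A product of powers of distinct primes divides another one if and only if it
    does so at each prime. *)
Lemma lcorr_eprod kap c d K qs : multiplicative_on_pos kap -> all prime qs -> uniq qs ->
  lcorr kap (eprod c K qs) (eprod d K qs) =
  \prod_(q <- qs) \sum_(k < K.+1) \sum_(j < K.+1)
     if (j <= k)%N then c q k * d q j * kap q ^+ (k - j) else 0.
Proof.
move=> mk; have [k1 kM] := mk; elim: qs => [|q qs ih].
  by move=> _ _; rewrite big_nil /lcorr !eprod_nil !big_seq1 dvdnn divnn k1 !mulr1.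
rewrite !eprod_cons => /andP[qp qsp] /= /andP[qn u]; have q0 := prime_gt0 qp.
rewrite big_cons -(ih qsp u) /lcorr lmul_sum lpowers_sum mulr_suml; apply: eq_bigr => k _ /=.
transitivity (\sum_(x <- eprod c K qs) \sum_(j < K.+1) \sum_(y <- eprod d K qs)
   (if (j <= k)%N then c q k * d q j * kap q ^+ (k - j) else 0) *
   (if (y.2 %| x.2)%N then x.1 * y.1 * kap (x.2 %/ y.2)%N else 0)); last first.
  rewrite mulr_sumr; apply: eq_bigr => x _; rewrite mulr_suml; apply: eq_bigr => j _.
  by rewrite mulr_sumr.
rewrite big_seq [RHS]big_seq; apply: eq_bigr => x xL.
rewrite lmul_sum lpowers_sum; apply: eq_bigr => j _ /=.
rewrite big_seq [RHS]big_seq; apply: eq_bigr => y yL.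
have x0 := allP (eprod_pos c K qsp) _ xL; have y0 := allP (eprod_pos d K qsp) _ yL.
have cx := eprod_coprime qsp qp qn xL; have cy := eprod_coprime qsp qp qn yL.
have qk : (0 < q ^ k)%N by rewrite expn_gt0 q0.
have qj : (0 < q ^ j)%N by rewrite expn_gt0 q0.
have E : (q ^ j * y.2 %| q ^ k * x.2)%N = (j <= k)%N && (y.2 %| x.2)%N.
  rewrite Gauss_dvd; last by apply: coprimeXl.
  rewrite mulnC Gauss_dvdr; last by apply: coprimeXl.
  rewrite Gauss_dvdl; last by rewrite coprime_sym; apply: coprimeXl.
  by rewrite dvdn_Pexp2l // prime_gt1.
rewrite E; case: (leqP j k) => jk /=; last by rewrite mul0r.
case: (boolP (y.2 %| x.2)%N) => [yx|_]; last by rewrite mulr0.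
have -> : (q ^ k * x.2 %/ (q ^ j * y.2) = q ^ (k - j) * (x.2 %/ y.2))%N.
  have e1 : (q ^ k * x.2 = (q ^ (k - j) * (x.2 %/ y.2)) * (q ^ j * y.2))%N.
    by rewrite mulnACA -expnD subnK // divnK.
  by rewrite e1 mulnK // muln_gt0 qj.
have xy : (0 < x.2 %/ y.2)%N by rewrite divn_gt0 // dvdn_leq.
have qkj : (0 < q ^ (k - j))%N by rewrite expn_gt0 q0.
rewrite (kM _ _ qkj xy) (mulposX (k - j) mk q0); ring.
Qed.

Lemma Re_conj_real (a b : R) : Re (a%:C * conjc b%:C) = a * b.
Proof. by rewrite conjc_real Re_realM. Qed.

Lemma indic1_mul : multiplicative_on_pos (fun n => (n == 1%N)%:R : R).
Proof. by split=> // m n _ _; rewrite muln_eq1 -natrM mulnb. Qed.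

Lemma pmean2_eprod c K qs : all prime qs -> uniq qs ->
  pmean 2 (rterms (eprod c K qs)) = \prod_(q <- qs) \sum_(k < K.+1) c q k ^+ 2.
Proof.
move=> qsp u; have L0 := eprod_pos c K qsp.
rewrite pmean2E ?rterms_pos //.
transitivity (lcorr (fun n => (n == 1%N)%:R) (eprod c K qs) (eprod c K qs)).
  rewrite Re_sum big_map /lcorr big_seq [RHS]big_seq; apply: eq_bigr => x xL /=.
  rewrite Re_sum big_mkcond big_map big_seq [RHS]big_seq; apply: eq_bigr => y yL.
  have x0 := allP L0 _ xL; have y0 := allP L0 _ yL.
  rewrite -[Re _]/(Re (x.1%:C * conjc y.1%:C)) Re_conj_real.
  rewrite -[_ == _]/(x.2 == y.2); case: (eqVneq x.2 y.2) => [->|xy].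
    by rewrite dvdnn divnn y0 eqxx mulr1.
  case: ifP => // yx; rewrite (_ : (_ == 1%N) = false) ?mulr0 //.
  by apply/eqP => e; move/eqP: xy; apply; rewrite -(divnK yx) e mul1n.
rewrite (lcorr_eprod _ _ _ indic1_mul qsp u) big_seq [RHS]big_seq; apply: eq_bigr => q qq.
have -> : (q == 1%N) = false.
  by apply/negbTE; rewrite neq_ltn (prime_gt1 (allP qsp _ qq)) orbT.
apply: eq_bigr => k _; rewrite (bigD1 k) //= leqnn subnn expr0 mulr1 big1 ?addr0 // => j jk.
case: ifP => // jk2; rewrite expr0n subn_eq0; case: leqP => kj; rewrite ?mulr0 //.
by move: jk; rewrite -val_eqE /= eqn_leq jk2 kj.
Qed.

Lemma lcorr_le kap1 kap2 L M : lpos L -> lpos M ->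
  all (fun x => 0 <= x.1) L -> all (fun x => 0 <= x.1) M ->
  (forall n, (0 < n)%N -> kap1 n <= kap2 n) -> lcorr kap1 L M <= lcorr kap2 L M.
Proof.
move=> L0 M0 Lp Mp h; rewrite /lcorr big_seq [leRHS]big_seq; apply: ler_sum => x xL.
rewrite big_seq [leRHS]big_seq; apply: ler_sum => y yM; case: ifP => // yx.
rewrite ler_wpM2l ?mulr_ge0 ?(allP Lp _ xL) ?(allP Mp _ yM) //; apply: h.
by rewrite divn_gt0 ?(allP M0 _ yM) // dvdn_leq // (allP L0 _ xL).
Qed.

Lemma prod_expR_bounds (T : Type) (r : seq T) (f : T -> R) (x : T -> R) e :
  (forall i, expR (x i - e) <= f i <= expR (x i + e)) ->
  expR (\sum_(i <- r) x i - (size r)%:R * e) <= \prod_(i <- r) f i <=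
  expR (\sum_(i <- r) x i + (size r)%:R * e).
Proof.
move=> h; elim: r => [|i r /andP[ih1 ih2]].
  by rewrite !big_nil /= !mul0r subr0 addr0 expR0 lexx.
have /andP[h1 h2] := h i; rewrite !big_cons /= -natr1 mulrDl mul1r.
apply/andP; split.
  have -> : x i + \sum_(j <- r) x j - ((size r)%:R * e + e) =
    (x i - e) + (\sum_(j <- r) x j - (size r)%:R * e) by ring.
  by rewrite expRD; apply: ler_pM; rewrite ?expR_ge0.
have -> : x i + \sum_(j <- r) x j + ((size r)%:R * e + e) =
  (x i + e) + (\sum_(j <- r) x j + (size r)%:R * e) by ring.
rewrite expRD; apply: ler_pM => //; first exact: le_trans (expR_ge0 _) h1.
exact: le_trans (expR_ge0 _) ih1.
Qed.

End EulerProducts.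

(** * Test functions: approximate exponentials of the prime zeta function *)

Section TestFunctions.
Variable R : realType.
Local Notation C := R[i].
Implicit Types (a s t : R) (m q : nat) (qs : seq nat).

(** [testf a s m qs] is the product over [q] of [(1 + a * r * z / m) ^+ m], where
    [r = q ^ (- 1 / 2 - s)] and [z] is the variable of [q]: it approximates the
    exponential of [a] times the sum of the [r * z]. *)
Definition tcoef a s m q k : R := 'C(m, k)%:R * (a * rpow (2^-1 + s) q / m%:R) ^+ k.

Definition testf a s m qs := eprod (tcoef a s m) m qs.

Definition prime_zeta s qs t : R := \sum_(q <- qs) rpow (2^-1 + s) q * complex.Re (nchar t q).

Lemma tcoef_ge0 a s m q k : 0 <= a -> 0 <= tcoef a s m q k.
Proof.
move=> a0; rewrite mulr_ge0 // exprn_ge0 // divr_ge0 // mulr_ge0 //; exact: rpow_ge0.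
Qed.

Lemma binomial_sum (A : comNzRingType) (x : A) m :
  \sum_(k < m.+1) 'C(m, k)%:R * x ^+ k = (1 + x) ^+ m.
Proof. by rewrite exprDn; apply: eq_bigr => k _; rewrite expr1n mul1r mulr_natl. Qed.

Lemma bin_le_exp m k : ('C(m, k) <= m ^ k)%N.
Proof.
elim: k => [|k ih]; first by rewrite bin0 expn0.
apply: (@leq_trans (k.+1 * 'C(m, k.+1))); first by rewrite leq_pmull.
by rewrite mul_bin_left expnS leq_mul // leq_subr.
Qed.

Lemma tcoef_sum_sq a s m q : (0 < m)%N -> (0 < q)%N ->
  \sum_(k < m.+1) tcoef a s m q k ^+ 2 <= expR (a ^+ 2 * rpow (1 + 2 * s) q).
Proof.
move=> m0 q0; have mp : (0 : R) < m%:R by rewrite ltr0n.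
set x := a * rpow (2^-1 + s) q.
have <- : x ^+ 2 = a ^+ 2 * rpow (1 + 2 * s) q.
  rewrite /x exprMn [rpow _ _ ^+ 2]expr2 -rpowD //; congr (_ * rpow _ _); lra.
apply: (@le_trans _ _ ((1 + x ^+ 2 / m%:R) ^+ m)); last first.
  apply: (@le_trans _ _ (expR (x ^+ 2 / m%:R) ^+ m)).
    rewrite lerXn2r ?nnegrE ?expR_ge0 ?expR_ge1Dx //.
    by rewrite addr_ge0 // divr_ge0 ?sqr_ge0 // ltW.
  by rewrite -expRM_natr divfK // gt_eqF.
rewrite -binomial_sum; apply: ler_sum => k _; rewrite /tcoef -/x.
have -> : ('C(m, k)%:R * (x / m%:R) ^+ k) ^+ 2 =
   'C(m, k)%:R * (x ^+ 2 / m%:R) ^+ k * ('C(m, k)%:R / m%:R ^+ k) :> R.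
  have mk : m%:R ^+ k != 0 :> R by rewrite expf_neq0 // gt_eqF.
  rewrite [(x / m%:R) ^+ k]exprMn [(x ^+ 2 / m%:R) ^+ k]exprMn !exprVn [(x ^+ 2) ^+ k]exprAC.
  by move: (m%:R ^+ k) (x ^+ k) ('C(m, k)%:R) mk => u v w u0; field.
rewrite ler_piMr //; first by rewrite mulr_ge0 // exprn_ge0 // divr_ge0 ?sqr_ge0 // ltW.
by rewrite ler_pdivrMr ?exprn_gt0 // mul1r -natrX ler_nat bin_le_exp.
Qed.

Lemma testf_pos a s m qs : all prime qs -> dpos (rterms (testf a s m qs)).
Proof. by move=> qsp; apply: rterms_pos; exact: eprod_pos. Qed.

Lemma pmean2_testf a s m qs : (0 < m)%N -> all prime qs -> uniq qs ->
  pmean 2 (rterms (testf a s m qs)) <= expR (a ^+ 2 * \sum_(q <- qs) rpow (1 + 2 * s) q).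
Proof.
move=> m0 qsp u; rewrite pmean2_eprod // mulr_sumr expR_sum.
rewrite big_seq [leRHS]big_seq; apply: ler_prod => q qq.
rewrite tcoef_sum_sq ?(prime_gt0 (allP qsp _ qq)) // andbT.
by apply: sumr_ge0 => k _; exact: sqr_ge0.
Qed.

Lemma testf_modulus a s qs : 0 <= s -> all prime qs -> exists N, forall m, (N < m)%N ->
  forall t, expR (a * prime_zeta s qs t - 1) <= cmod (ev (rterms (testf a s m qs)) (nchar t))
     <= expR (a * prime_zeta s qs t + 1).
Proof.
move=> s0 qsp.
pose e : R := ((size qs)%:R + 1)^-1; have k0 : (0 : R) < (size qs)%:R + 1 by rewrite ltr_wpDl.
have e0 : 0 < e by rewrite invr_gt0.
have e1 : (size qs)%:R * e <= 1 by rewrite /e ler_pdivrMr // mul1r lerDl.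
have [N HN] := euler_exp (normr_ge0 a) e0.
exists N => m mN t; rewrite ev_eprod // cmod_prod.
have F q : prime q -> expR (a * (rpow (2^-1 + s) q * complex.Re (nchar t q)) - e) <=
    cmod (\sum_(k < m.+1) (tcoef a s m q k)%:C * nchar t q ^+ k) <=
    expR (a * (rpow (2^-1 + s) q * complex.Re (nchar t q)) + e).
  move=> qp; have q0 := prime_gt0 qp.
  have -> : \sum_(k < m.+1) (tcoef a s m q k)%:C * nchar t q ^+ k =
      (1 + (a * rpow (2^-1 + s) q)%:C * nchar t q * (m%:R^-1)%:C) ^+ m.
    have -> : (a * rpow (2^-1 + s) q)%:C * nchar t q * (m%:R^-1)%:C =
        (a * rpow (2^-1 + s) q / m%:R)%:C * nchar t q by rewrite mulrAC -rmorphM.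
    rewrite -binomial_sum; apply: eq_bigr => k _.
    by rewrite /tcoef rmorphM rmorphXn /= rmorph_nat [in RHS]exprMn [RHS]mulrA.
  have := HN m mN ((a * rpow (2^-1 + s) q)%:C * nchar t q).
  rewrite Re_realM cmodX cmodM cmod_real cmod_nchar mulr1 normrM -mulrA; apply.
  rewrite ler_piMr // ger0_norm ?rpow_ge0 // rpow_le1 //; lra.
pose x q := a * (rpow (2^-1 + s) q * complex.Re (nchar t q)).
pose f q := if prime q then cmod (\sum_(k < m.+1) (tcoef a s m q k)%:C * nchar t q ^+ k)
   else expR (x q).
have Ff q : expR (x q - e) <= f q <= expR (x q + e).
  rewrite /f; case: ifP => [/F //|_]; rewrite !ler_expR; apply/andP; split; lra.
have := prod_expR_bounds qs Ff.
have -> : \prod_(i <- qs) f i =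
    \prod_(i <- qs) cmod (\sum_(k < m.+1) (tcoef a s m i k)%:C * nchar t i ^+ k).
  by rewrite big_seq [RHS]big_seq; apply: eq_bigr => q /(allP qsp) qp; rewrite /f qp.
have -> : \sum_(i <- qs) x i = a * prime_zeta s qs t by rewrite /prime_zeta mulr_sumr.
move=> /andP[h1 h2]; apply/andP; split.
  by apply: le_trans h1; rewrite ler_expR lerD2l lerN2.
by apply: (le_trans h2); rewrite ler_expR lerD2l.
Qed.

(** [(ln n) ^ beta] is at most a constant times [s ^ (- beta) * n ^ s]: the
    coefficients of [phi] dominate those of a shifted zeta function, which are
    multiplicative. *)
Lemma phi_coef_ge beta : 0 < beta -> exists2 c, 0 < c &
  forall s n, 0 < s -> s <= 1 -> (0 < n)%N ->
    c * s `^ beta * rpow (2^-1 + s) n <= phi_coef beta n.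
Proof.
move=> b0; have [K K0 HK] := powR_le_expR b0 (ltr01 : (0 : R) < 1).
exists (K + 1)^-1; first by rewrite invr_gt0 addr_gt0.
move=> s n s0 s1; case: n => [//|[_|n _]].
  rewrite (rpow_mul _).1 mulr1 phi_coef1 mulrC ler_pdivrMr ?addr_gt0 // mul1r.
  apply: (@le_trans _ _ 1); last by rewrite lerDr ltW.
  apply: (@le_trans _ _ (1 `^ beta)); first by rewrite ler_powR2 // ltW.
  by rewrite powR1.
rewrite phi_coefE // rpowD // mulrCA ler_wpM2l ?rpow_ge0 //.
set l := ln n.+2%:R; have l0 : 0 < l by apply: lt_le_trans (@ln_nat_ge R n.+2 _); rewrite ?invr_gt0.
have := HK (s * l) (mulr_ge0 (ltW s0) (ltW l0)); rewrite mul1r powRM ?(ltW s0) ?(ltW l0) // => h.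
have lb : 0 < l `^ beta by rewrite powR_gt0.
have E0 : 0 < expR (s * l) by exact: expR_gt0.
have K1 : 0 < K + 1 by rewrite addr_gt0.
rewrite powRN -(ler_pM2r lb) mulVf ?gt_eqF // rpowE // -/l expRN.
have -> : (K + 1)^-1 * s `^ beta * (expR (s * l))^-1 * l `^ beta =
   (s `^ beta * l `^ beta) / (expR (s * l) * (K + 1)).
  by field; rewrite !gt_eqF.
rewrite ler_pdivrMr ?mulr_gt0 // mul1r; apply: (le_trans h).
by rewrite mulrC ler_wpM2l ?(ltW E0) // lerDl.
Qed.

Lemma prod1D_ge (a s : R) qs : 0 <= a -> 0 <= s -> all prime qs -> uniq qs ->
  expR (a * \sum_(q <- qs) rpow (1 + 2 * s) q - 4 * a ^+ 2) <=
  \prod_(q <- qs) (1 + a * rpow (1 + 2 * s) q).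
Proof.
move=> a0 s0 qsp u.
apply: (@le_trans _ _ (\prod_(q <- qs) expR (a * rpow (1 + 2 * s) q - 2 * (a * rpow (1 + 2 * s) q) ^+ 2))).
  rewrite -expR_sum ler_expR sumrB -mulr_sumr lerD2l lerN2.
  rewrite (eq_bigr (fun q => 2 * a ^+ 2 * rpow (1 + 2 * s) q ^+ 2)); last by move=> q _; ring.
  rewrite -mulr_sumr.
  have : \sum_(q <- qs) rpow (1 + 2 * s) q ^+ 2 <= 1 + 1^-1 :> R.
    apply: le_trans (@zeta_sum_le R 1 qs ltr01 u _); last first.
      by apply/allP => q /(allP qsp) /prime_gt0.
    rewrite big_seq [leRHS]big_seq; apply: ler_sum => q /(allP qsp) /prime_gt0 q0.
    rewrite expr2 -rpowD //; apply: rpow_homo => //; lra.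
  rewrite invr1 => h; have a2 : 0 <= 2 * a ^+ 2 by nneg.
  have := ler_wpM2l a2 h; lra.
apply: ler_prod => q _; rewrite expR_ge0 /= expR_le_1D //.
have : 0 <= a * rpow (1 + 2 * s) q by rewrite mulr_ge0 // rpow_ge0.
lra.
Qed.

(** The right side is a product over the primes; of each factor keep only the terms
    [k = 0] and [k = 1]. *)
Lemma testf_phi_ge a s m qs : (0 < m)%N -> 0 <= a -> all prime qs ->
  \prod_(q <- qs) (1 + a * rpow (1 + 2 * s) q) <=
  \sum_(x <- testf a s m qs) x.1 * rpow (2^-1 + s) x.2.
Proof.
move=> m0 a0 qsp; rewrite (eprod_sum _ _ (rpow_mul _) qsp).
rewrite big_seq [leRHS]big_seq; apply: ler_prod => q qq.
have q0 := prime_gt0 (allP qsp _ qq).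
have ar : 0 <= a * rpow (1 + 2 * s) q by rewrite mulr_ge0 // rpow_ge0.
rewrite addr_ge0 //=.
have r2 : rpow (1 + 2 * s) q = rpow (2^-1 + s) q * rpow (2^-1 + s) q.
  by rewrite -rpowD //; congr rpow; lra.
case: m m0 => // m _; rewrite big_ord_recl big_ord_recl addrA.
have t0 : tcoef a s m.+1 q 0 = 1 by rewrite /tcoef bin0 expr0 mulr1.
have t1 : tcoef a s m.+1 q 1 = a * rpow (2^-1 + s) q.
  by rewrite /tcoef bin1 expr1 mulrC divfK // pnatr_eq0.
rewrite t0 t1 !expr0 expr1 mulr1 r2 mulrA lerDl; apply: sumr_ge0 => i _.
by rewrite mulr_ge0 ?tcoef_ge0 // exprn_ge0 // rpow_ge0.
Qed.

End TestFunctions.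

(** * Unboundedness of the functional for [beta < 1 / p] *)

Section NotDual.
Variable R : realType.
Local Notation C := R[i].

Lemma real_terms_sum (L : seq (R * nat)) (g : nat -> R) :
  \sum_(x <- rterms L) x.1 * (g x.2)%:C = (\sum_(x <- L) x.1 * g x.2)%:C.
Proof. by rewrite big_map real_complex_sum; apply: eq_bigr => x _; rewrite /= rmorphM. Qed.

(** Test with [exp (2 / p * w)], [w] the prime zeta function at [1 / 2 + s]. The
    [p]-th power of its modulus is that of [exp w] squared, whose mean is of order
    [s ^ (- 1)], so its norm is of order [s ^ (- 1 / p)]; the pairing with [phi] is
    at least of order [s ^ (beta - 2 / p)]. *)
Lemma phi_dual_unbounded (p beta : R) : 0 < beta -> 0 < p -> beta < p^-1 ->
  ~ phi_in_Hp_dual p beta.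
Proof.
move=> b0 p0 bp [C0 [C0p H]].
have [c c0 Hc] := phi_coef_ge b0.
pose a : R := 2 / p; have a0 : 0 <= a by rewrite divr_ge0 // ltW.
pose d := p^-1 - beta; have d0 : 0 < d by rewrite subr_gt0.
pose K4 : R := (4^-1 * expR (- 4)) `^ p^-1.
have K40 : 0 < K4 by rewrite powR_gt0 // mulr_gt0 ?expR_gt0 // invr_gt0.
pose K : R := C0 * expR ((p + 2) / p + 4 * a ^+ 2) / (c * K4).
have K0 : 0 < K by rewrite divr_gt0 // ?mulr_gt0 ?expR_gt0.
have main s : 0 < s -> s <= 1 -> s `^ (- d) <= K.
  move=> s0 s1; have t0 : 0 < 2 * s by rewrite mulr_gt0.
  have [N HN] := prime_sum_ge t0.
  set qs := plist N in HN; have qsp : all prime qs by exact: plist_prime.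
  have u : uniq qs by exact: plist_uniq.
  set L := \sum_(q <- qs) _ in HN.
  have [N1 H1] := testf_modulus a (ltW s0) qsp.
  have [N2 H2] := testf_modulus 1 (ltW s0) qsp.
  pose m := (maxn N1 N2).+1; have m0 : (0 < m)%N by [].
  have {}H1 := H1 m (leq_maxl N1 N2 : (N1 < m)%N).
  have {}H2 := H2 m (leq_maxr N1 N2 : (N2 < m)%N).
  pose E := testf a s m qs; have E0 : dpos (rterms E) := testf_pos a s m qsp.
  have low : c * s `^ beta * expR (a * L - 4 * a ^+ 2) <= C0 * Hp_norm p (deval (collect (rterms E))).
    apply: le_trans (H (collect (rterms E))).
    have g1 : (phi_coef beta 1)%:C = 1 :> C by rewrite phi_coef1.
    rewrite (@dual_sum R (fun n => (phi_coef beta n)%:C) _ g1).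
    rewrite (terms_sum _ (fun n => (phi_coef beta n)%:C)).
    rewrite (collect_sum (fun n => (phi_coef beta n)%:C) E0) real_terms_sum cmod_real.
    apply: le_trans (ler_norm _).
    have cs : 0 <= c * s `^ beta by rewrite mulr_ge0 ?powR_ge0 // ltW.
    apply: (@le_trans _ _ (c * s `^ beta * \sum_(x <- E) x.1 * rpow (2^-1 + s) x.2)).
      rewrite ler_wpM2l //; apply: (le_trans (prod1D_ge a0 (ltW s0) qsp u)).
      exact: testf_phi_ge.
    rewrite mulr_sumr big_seq [leRHS]big_seq; apply: ler_sum => x xE.
    rewrite mulrCA ler_wpM2l //.
      by apply: (allP (eprod_ge0 _ _ _) _ xE) => q k; exact: tcoef_ge0.
    by apply: Hc => //; exact: (allP (eprod_pos _ _ qsp) _ xE).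
  have up : Hp_norm p (deval (collect (rterms E))) <= expR ((p + 2) / p) * expR L `^ p^-1.
    rewrite Hp_norm_terms.
    have -> : expR ((p + 2) / p) = expR (p + 2) `^ p^-1 by rewrite expRM.
    rewrite -(powRM _ (expR_ge0 _) (expR_ge0 _)); apply: ler_powR2.
    - by rewrite invr_ge0 ltW.
    - by apply: pmean_ge0 => //; exact: terms_pos.
    have -> : pmean p (terms (collect (rterms E))) = pmean p (rterms E).
      by apply: pmean_ext => //; [exact: terms_pos|move=> t; rewrite ev_collect].
    apply: (@le_trans _ _ (expR (p + 2) * pmean 2 (rterms (testf 1 s m qs)))).
      apply: pmean_le => //; first exact: testf_pos.
      move=> t; rewrite powR_mulrn ?cmod_ge0 //.
      have /andP[_ h1] := H1 t; have /andP[h2 _] := H2 t.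
      apply: (@le_trans _ _ (expR (a * prime_zeta s qs t + 1) `^ p)).
        by rewrite ler_powR2 ?cmod_ge0 // ltW.
      apply: (@le_trans _ _ (expR (p + 2) * expR (1 * prime_zeta s qs t - 1) ^+ 2)); last first.
        by rewrite ler_wpM2l ?expR_ge0 // lerXn2r ?nnegrE ?expR_ge0 // cmod_ge0.
      rewrite -expRM -expRM_natr -expRD ler_expR le_eqVlt; apply/orP; left; apply/eqP.
      by rewrite /a; field; rewrite gt_eqF.
    rewrite ler_wpM2l ?expR_ge0 //; apply: (le_trans (pmean2_testf 1 s m0 qsp u)).
    by rewrite expr1n mul1r.
  have both := le_trans low (ler_wpM2l (ltW C0p) up).
  have EL : expR (a * L - 4 * a ^+ 2) =
      expR L `^ p^-1 * expR L `^ p^-1 * expR (- (4 * a ^+ 2)).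
    by rewrite -!expRM -!expRD; congr expR; rewrite /a; field; rewrite gt_eqF.
  have X0 : 0 < expR L `^ p^-1 by rewrite powR_gt0 // expR_gt0.
  have both2 : c * s `^ beta * expR L `^ p^-1 <= C0 * expR ((p + 2) / p + 4 * a ^+ 2).
    rewrite -(ler_pM2r X0) -(ler_pM2r (expR_gt0 (- (4 * a ^+ 2)))).
    have -> : C0 * expR ((p + 2) / p + 4 * a ^+ 2) * expR L `^ p^-1 * expR (- (4 * a ^+ 2)) =
       C0 * (expR ((p + 2) / p) * expR L `^ p^-1).
      by rewrite expRD expRN; field; rewrite gt_eqF // expR_gt0.
    by apply: le_trans both; rewrite EL !mulrA.
  rewrite /K ler_pdivlMr ?mulr_gt0 //; apply: le_trans both2.
  have -> : s `^ (- d) = s `^ beta * s `^ (- p^-1).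
    by rewrite -powRD ?(gt_eqF s0) ?implybT //; congr (_ `^ _); rewrite /d; ring.
  have h : s `^ (- p^-1) * K4 <= expR L `^ p^-1.
    have -> : s `^ (- p^-1) = s^-1 `^ p^-1 by rewrite -[s^-1]powR_inv1 ?(ltW s0) // -powRrM mulN1r.
    rewrite /K4 -powRM ?invr_ge0 ?(ltW s0) ?mulr_ge0 ?expR_ge0 ?invr_ge0 //.
    apply: ler_powR2; first by rewrite invr_ge0 ltW.
      by rewrite !mulr_ge0 ?invr_ge0 ?expR_ge0 // ltW.
    apply: le_trans HN; rewrite mulrA ler_wpM2r ?expR_ge0 //.
    by rewrite le_eqVlt; apply/orP; left; apply/eqP; field; rewrite gt_eqF.
  have := ler_wpM2l (mulr_ge0 (ltW c0) (powR_ge0 s beta)) h; apply: le_trans.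
  by rewrite le_eqVlt; apply/orP; left; apply/eqP; ring.
(* For this [s] the power [s `^ (- d)] equals [K + 1]. *)
pose s := (K + 1) `^ (- d^-1).
have K1 : 0 < K + 1 by rewrite addr_gt0.
have s0 : 0 < s by rewrite powR_gt0.
have s1 : s <= 1.
  rewrite /s powRN invf_le1 ?powR_gt0 //.
  apply: (@le_trans _ _ ((K + 1) `^ 0)); first by rewrite powRr0.
  by apply: ler_powR; rewrite ?lerDr ?invr_ge0 ltW.
have := main s s0 s1; rewrite /s -powRrM mulrNN mulVf ?gt_eqF // powRr1 ?(ltW K1) //.
by rewrite gerDl ler10.
Qed.

End NotDual.

(** * Necessity of [beta > p / 4] *)

Section Necessity.
Variable R : realType.
Local Notation C := R[i].
Implicit Types (P : dirpoly R) (L M : seq (R * nat)).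

Lemma Re_triple (z : C) (a b : R) :
  complex.Re (z * a%:C * conjc b%:C) = b * a * complex.Re z.
Proof. by rewrite conjc_real mulrC mulrA mulrAC -rmorphM Re_realM. Qed.

(** This turns the pairing of a Dirichlet polynomial with the product of a test
    function and a conjugate one into a statement on coefficients. *)
Lemma lcorr_mean P L M : lpos L -> lpos M ->
  is_mean (fun t => complex.Re (ev (terms P) (nchar t) * ev (rterms M) (nchar t) *
     conjc (ev (rterms L) (nchar t))))
   (lcorr (fun n => complex.Re (dcoef P n)) L M).
Proof.
move=> L0 M0; have P0 := terms_pos P.
pose D : dlist R := [seq (x.1 * y.1, (x.2 * y.2)%N) | x <- terms P, y <- rterms M].
pose T : tform R := [seq (x.1 * conjc y.1, (x.2, y.2)) | x <- D, y <- rterms L].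
have D0 : dpos D.
  apply/allP => z /allpairsP[[x y] [xP yM ->]].
  by rewrite /= muln_gt0 (allP P0 _ xP) (allP (rterms_pos M0) _ yM).
have T0 : tpos T.
  apply/allP => z /allpairsP[[x y] [xD yL ->]].
  by rewrite /= (allP D0 _ xD) (allP (rterms_pos L0) _ yL).
have DE t : ev D (nchar t) = ev (terms P) (nchar t) * ev (rterms M) (nchar t).
  rewrite /ev big_allpairs_dep mulr_suml big_seq [RHS]big_seq; apply: eq_bigr => x xP.
  rewrite mulr_sumr big_seq [RHS]big_seq; apply: eq_bigr => y yM.
  rewrite -[LHS]/(x.1 * y.1 * nchar t (x.2 * y.2)) ncharM; first by rewrite mulrACA.
    exact: (allP P0 _ xP).
  exact: (allP (rterms_pos M0) _ yM).
have TE t : tev T (nchar t) = ev D (nchar t) * conjc (ev (rterms L) (nchar t)).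
  rewrite /tev big_allpairs_dep /ev conj_sum mulr_suml; apply: eq_bigr => x _.
  rewrite mulr_sumr; apply: eq_bigr => y _; rewrite conjM mulrACA //.
have -> : lcorr (fun n => complex.Re (dcoef P n)) L M = complex.Re (tmean T).
  have -> : tmean T = \sum_(x <- L) \sum_(y <- M) \sum_(n <- index_iota 1 (size P).+1)
      if (n * y.2 == x.2)%N then dcoef P n * y.1%:C * conjc x.1%:C else 0.
    rewrite /tmean big_mkcond big_allpairs_dep exchange_big big_map; apply: eq_bigr => x _.
    rewrite big_allpairs_dep exchange_big big_map; apply: eq_bigr => y _.
    by rewrite big_map.
  rewrite Re_sum /lcorr big_seq [RHS]big_seq; apply: eq_bigr => x xL.
  rewrite Re_sum big_seq [RHS]big_seq; apply: eq_bigr => y yM.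
  have x0 := allP L0 _ xL; have y0 := allP M0 _ yM; rewrite -big_mkcond.
  case: ifP => [yx|yx]; last first.
    rewrite big1 // => n /eqP e; move: yx; by rewrite -e dvdn_mull.
  have E n : (n * y.2 == x.2)%N = (n == x.2 %/ y.2)%N.
    by apply/eqP/eqP => [<-|->]; [rewrite mulnK|rewrite divnK].
  rewrite (eq_bigl _ _ E).
  have xy0 : (0 < x.2 %/ y.2)%N by rewrite divn_gt0 // dvdn_leq.
  have [le|lt] := leqP (x.2 %/ y.2) (size P).
    rewrite (big_rem (x.2 %/ y.2)%N) /=; last by rewrite mem_index_iota xy0 ltnS.
    rewrite eqxx big_seq_cond big1 ?addr0.
      exact: (esym (Re_triple _ _ _)).
    move=> n /andP[+ /eqP e]; rewrite e rem_filter ?iota_uniq //.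
    by rewrite mem_filter /= eqxx.
  rewrite {1}/dcoef nth_default; last by rewrite -ltnS prednK.
  rewrite mulr0 big_seq_cond big1 // => n /andP[+ /eqP e].
  by rewrite e mem_index_iota ltnS [(_ <= size P)%N]leqNgt lt andbF.
by apply: mean_ext (mean_tev T0) => t; rewrite TE DE.
Qed.

Lemma cvg_sum_seq (I : eqType) (r : seq I) (f : nat -> I -> R) (g : I -> R) :
  (forall i, i \in r -> f j i @[j --> \oo] --> g i) ->
  (\sum_(i <- r) f j i) @[j --> \oo] --> \sum_(i <- r) g i.
Proof.
elim: r => [|i r ih] h.
  rewrite big_nil (_ : (fun j => _) = fun=> 0); first exact: cvg_cst.
  by apply/funext => j; rewrite big_nil.
rewrite big_cons (_ : (fun j => _) = fun j => f j i + \sum_(i <- r) f j i).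
  apply: cvgD; first by apply: h; rewrite inE eqxx.
  by apply: ih => l lr; apply: h; rewrite inE lr orbT.
by apply/funext => j; rewrite big_cons.
Qed.

Lemma lcorr_cvg (k_ : nat -> nat -> R) (k : nat -> R) L M : lpos L -> lpos M ->
  (forall n, (0 < n)%N -> k_ j n @[j --> \oo] --> k n) ->
  lcorr (k_ j) L M @[j --> \oo] --> lcorr k L M.
Proof.
move=> L0 M0 H; rewrite /lcorr.
apply: cvg_sum_seq => x xL; apply: cvg_sum_seq => y yM; case: ifP => yx; last exact: cvg_cst.
apply: cvgM; first exact: cvg_cst.
by apply: H; rewrite divn_gt0 ?(allP M0 _ yM) // dvdn_leq // (allP L0 _ xL).
Qed.

Lemma corner_sum_le m (T : nat -> nat -> R) : (forall k j, 0 <= T k j) ->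
  T 0%N 0%N + (T 1%N 0%N + T 1%N 1%N) <= \sum_(k < m.+2) \sum_(j < m.+2) T k j.
Proof.
move=> pos; rewrite big_ord_recl; apply: lerD.
  by rewrite big_ord_recl lerDl; apply: sumr_ge0 => j _; exact: pos.
rewrite big_ord_recl -[leLHS]addr0; apply: lerD; last first.
  by apply: sumr_ge0 => i _; apply: sumr_ge0 => j _; exact: pos.
rewrite big_ord_recl lerD2l big_ord_recl lerDl.
by apply: sumr_ge0 => j _; exact: pos.
Qed.

Lemma testf_corr_ge (s b : R) m qs : (0 < m)%N -> 0 <= b -> all prime qs -> uniq qs ->
  \prod_(q <- qs) (1 + (1 + b) * (1 + b) * rpow (1 + 2 * s) q) <=
  lcorr (rpow (2^-1 + s)) (testf (1 + b) s m qs) (testf b s m qs).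
Proof.
move=> m0 b0 qsp u; have a0 : 0 <= 1 + b by rewrite addr_ge0.
rewrite (lcorr_eprod _ _ _ (rpow_mul _) qsp u).
rewrite big_seq [leRHS]big_seq; apply: ler_prod => q qq.
have q0 := prime_gt0 (allP qsp _ qq).
have ar : 0 <= (1 + b) * (1 + b) * rpow (1 + 2 * s) q by rewrite !mulr_ge0 // rpow_ge0.
rewrite addr_ge0 //=.
have r2 : rpow (1 + 2 * s) q = rpow (2^-1 + s) q * rpow (2^-1 + s) q.
  by rewrite -rpowD //; congr rpow; lra.
have t0 a : tcoef a s m q 0 = 1 by rewrite /tcoef bin0 expr0 mulr1.
have t1 a : tcoef a s m q 1 = a * rpow (2^-1 + s) q.
  by rewrite /tcoef bin1 expr1 mulrC divfK // pnatr_eq0 -lt0n.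
pose T k j : R := if (j <= k)%N then tcoef (1 + b) s m q k * tcoef b s m q j *
    rpow (2^-1 + s) q ^+ (k - j) else 0.
have pos k j : 0 <= T k j.
  rewrite /T; case: ifP => _ //; apply: mulr_ge0; last by apply: exprn_ge0; exact: rpow_ge0.
  by apply: mulr_ge0; exact: tcoef_ge0.
have T00 : T 0%N 0%N = 1 by rewrite /T /= !t0 subnn expr0 !mulr1.
have T10 : T 1%N 0%N = (1 + b) * rpow (2^-1 + s) q * rpow (2^-1 + s) q.
  by rewrite /T /= t0 t1 subn0 expr1 mulr1.
have T11 : T 1%N 1%N = (1 + b) * rpow (2^-1 + s) q * (b * rpow (2^-1 + s) q).
  by rewrite /T /= !t1 subnn expr0 mulr1.
(* All terms are nonnegative, and three of them suffice. *)
rewrite -[leRHS]/(\sum_(k < m.+1) \sum_(j < m.+1) T k j).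
have -> : 1 + (1 + b) * (1 + b) * rpow (1 + 2 * s) q = T 0%N 0%N + (T 1%N 0%N + T 1%N 1%N).
  by rewrite T00 T10 T11 r2; ring.
by case: m m0 T pos {T00 T10 T11 t0 t1} => // m _ T pos; exact: corner_sum_le.
Qed.

Lemma young_terms_le (x2 x4 l a l2 b S e y Z : R) : 0 <= x2 -> x2 <= x4 -> 0 <= y -> 0 <= S ->
  l * a <= y -> l2 * b <= y -> e <= Z ->
  x4 * l * a + (x2 * l2 * b + x4 * S * e) <= x4 * (2 * y + S * Z).
Proof.
move=> h2 h24 y0 S0 la lb eZ; have h4 := le_trans h2 h24.
have i1 := ler_wpM2l h4 la; have i2 := le_trans (ler_wpM2l h2 lb) (ler_wpM2r y0 h24).
have i3 := ler_wpM2l h4 (ler_wpM2l S0 eZ); lra.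
Qed.

(** The function [exp ((p / 2 - 1) * w) * conj (exp (p / 2 * w))], [w] the prime
    zeta function, has as modulus the [(p - 1)]-st power of [|exp w|], so it is the
    extremal function dual to [exp w]. Paired with it, [P - Q] gives at most its
    norm times the dual norm, of order [expR (p * (p - 1) / 4 * L)], and [Q], which
    is bounded, only contributes the mean of the modulus, of the smaller order
    [expR ((p - 1) ^+ 2 / 4 * L)]. *)
Lemma dual_test (P Q : dirpoly R) (p s eta : R) m qs :
  2 <= p -> 0 < s -> 0 < eta -> (0 < m)%N -> all prime qs -> uniq qs ->
  pmean p (dsub (terms P) (terms Q)) <= eta `^ p ->
  (forall t, expR (p / 2 * prime_zeta s qs t - 1) <=
     cmod (ev (rterms (testf (p / 2) s m qs)) (nchar t)) <=
     expR (p / 2 * prime_zeta s qs t + 1)) ->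
  (forall t, expR ((p / 2 - 1) * prime_zeta s qs t - 1) <=
     cmod (ev (rterms (testf (p / 2 - 1) s m qs)) (nchar t)) <=
     expR ((p / 2 - 1) * prime_zeta s qs t + 1)) ->
  (forall t, expR ((p - 1) / 2 * prime_zeta s qs t - 1) <=
     cmod (ev (rterms (testf ((p - 1) / 2) s m qs)) (nchar t))) ->
  lcorr (fun n => complex.Re (dcoef P n)) (testf (p / 2) s m qs) (testf (p / 2 - 1) s m qs) <=
  expR 4 * (2 * eta * expR (p * (p - 1) / 4 * \sum_(q <- qs) rpow (1 + 2 * s) q)
    + dsize (terms Q) * expR ((p - 1) ^+ 2 / 4 * \sum_(q <- qs) rpow (1 + 2 * s) q)).
Proof.
move=> p2 s0 e0 m0 qsp u hPQ HA HB HE.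
have p0 : 0 < p by lra.
have p1 : 1 < p by lra.
have e22 : expR 4 = expR 2 * expR 2 :> R by rewrite -expRD; congr expR; lra.
set L := \sum_(q <- qs) _; set A := testf (p / 2) s m qs; set B := testf _ s m qs.
set E := testf ((p - 1) / 2) s m qs in HE; set G := prime_zeta s qs in HA HB HE.
have A0 : dpos (rterms A) := testf_pos _ s m qsp.
have B0 : dpos (rterms B) := testf_pos _ s m qsp.
have E0 : dpos (rterms E) := testf_pos _ s m qsp.
have PQ0 := dsub_pos (terms_pos P) (terms_pos Q).
(* With this weight the two terms of Young's inequality have equal means. *)
pose lam := eta * expR (- (p / 4 * L)).
have l0 : 0 < lam by rewrite mulr_gt0 ?expR_gt0.
set S := dsize (terms Q); have S0 : 0 <= S by exact: dsize_ge0.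
have pw t : complex.Re (ev (terms P) (nchar t) * ev (rterms B) (nchar t) *
     conjc (ev (rterms A) (nchar t))) <=
   0 + ((expR 4 * lam) * cmod (ev (rterms A) (nchar t)) `^ 2 +
   ((expR 2 * lam `^ (1 - p)) * cmod (ev (dsub (terms P) (terms Q)) (nchar t)) `^ p +
    (expR 4 * S) * cmod (ev (rterms E) (nchar t)) `^ 2)).
  apply: (le_trans (ler_norm _)); apply: (le_trans (Re_le_cmod _)).
  rewrite !cmodM cmodJ add0r.
  set x := cmod (ev (dsub _ _) _).
  have fx : cmod (ev (terms P) (nchar t)) <= x + S.
    have -> : ev (terms P) (nchar t) = ev (dsub (terms P) (terms Q)) (nchar t) +
       ev (terms Q) (nchar t) by rewrite ev_dsub subrK.
    apply: (le_trans (cmodD _ _)); rewrite lerD2l; apply: ev_le; last exact: terms_pos.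
    exact: nchar_unichar.
  have /andP[a1 a2] := HA t; have /andP[b1 b2] := HB t; have h1 := HE t.
  set y := expR (G t); have y0 : 0 <= y by exact: expR_ge0.
  have BA : cmod (ev (rterms B) (nchar t)) * cmod (ev (rterms A) (nchar t)) <=
      expR 2 * y `^ (p - 1).
    apply: (le_trans (ler_pM (cmod_ge0 _) (cmod_ge0 _) b2 a2)).
    rewrite -expRM -!expRD ler_expR le_eqVlt; apply/orP; left; apply/eqP; field => //.
  have yp : y `^ p <= expR 2 * cmod (ev (rterms A) (nchar t)) `^ 2.
    rewrite powR_mulrn ?cmod_ge0 //.
    apply: (@le_trans _ _ (expR 2 * expR (p / 2 * G t - 1) ^+ 2)).
      rewrite -expRM -expRM_natr -expRD ler_expR le_eqVlt; apply/orP; left; apply/eqP; field => //.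
    by rewrite ler_wpM2l ?expR_ge0 // lerXn2r ?nnegrE ?expR_ge0 // cmod_ge0.
  have yq : y `^ (p - 1) <= expR 2 * cmod (ev (rterms E) (nchar t)) `^ 2.
    rewrite powR_mulrn ?cmod_ge0 //.
    apply: (@le_trans _ _ (expR 2 * expR ((p - 1) / 2 * G t - 1) ^+ 2)).
      rewrite -expRM -expRM_natr -expRD ler_expR le_eqVlt; apply/orP; left; apply/eqP; field => //.
    by rewrite ler_wpM2l ?expR_ge0 // lerXn2r ?nnegrE ?expR_ge0 // cmod_ge0.
  have x0 : 0 <= x by exact: cmod_ge0.
  have Y := powR_young p1 l0 x0 y0.
  rewrite -mulrA; apply: (le_trans (ler_pM (cmod_ge0 _) _ fx BA)).
    by rewrite mulr_ge0 ?cmod_ge0.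
  rewrite e22.
  have k1 := ler_wpM2l (ltW l0) yp; have k2 := ler_wpM2l S0 yq.
  have k3 := lerD (le_trans Y (lerD k1 (lexx _))) k2.
  have k4 := ler_wpM2l (expR_ge0 2 : 0 <= expR 2 :> R) k3.
  have -> : (x + S) * (expR 2 * y `^ (p - 1)) = expR 2 * (x * y `^ (p - 1) + S * y `^ (p - 1)) by ring.
  apply: (le_trans k4); rewrite le_eqVlt; apply/orP; left; apply/eqP.
  move: (cmod _ `^ 2) (cmod _ `^ 2) (lam `^ _) (x `^ _) (expR 2) => c1 c2 c3 c4 c5; clear; ring.
have LM := @lcorr_mean P _ _ (eprod_pos (tcoef (p / 2) s m) m qsp) (eprod_pos (tcoef (p / 2 - 1) s m) m qsp).
rewrite -/(testf _ s m qs) -/(testf _ s m qs) -/A -/B in LM.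
have c2 (D : dlist R) (q c : R) : dpos D -> 0 < q ->
    continuous (fun t => c * cmod (ev D (nchar t)) `^ q).
  by move=> D0 q0 x; apply: cvgM; [exact: cvg_cst|exact: cont_cmod_ev].
have m2 (D : dlist R) (q c : R) : dpos D -> 0 < q ->
    is_mean (fun t => c * cmod (ev D (nchar t)) `^ q) (c * pmean q D).
  by move=> D0 q0; apply: meanZ; [exact: cont_cmod_ev|exact: pmeanP].
have cD (f g : R -> R) : continuous f -> continuous g -> continuous (fun t => f t + g t).
  by move=> cf cg x; apply: cvgD; [exact: cf|exact: cg].
have two : (0 : R) < 2 by [].
have cL : continuous (fun t => complex.Re (ev (terms P) (nchar t) * ev (rterms B) (nchar t) *
     conjc (ev (rterms A) (nchar t)))).
  have [T [T0 HT]] := formM (formM (form_ev (terms_pos P)) (form_ev B0)) (formJ (form_ev A0)).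
  rewrite (_ : (fun t => _) = fun t => complex.Re (tev T (nchar t))); first exact: cont_tev.
  by apply/funext => t; rewrite -HT //; exact: nchar_unichar.
have MR := meanD (@cont_cst R 0) (cD _ _ (c2 _ 2 (expR 4 * lam) A0 two)
  (cD _ _ (c2 _ p (expR 2 * lam `^ (1 - p)) PQ0 p0) (c2 _ 2 (expR 4 * S) E0 two)))
  (@mean_cst R 0) (meanD (c2 _ 2 (expR 4 * lam) A0 two)
  (cD _ _ (c2 _ p (expR 2 * lam `^ (1 - p)) PQ0 p0) (c2 _ 2 (expR 4 * S) E0 two))
  (m2 _ 2 (expR 4 * lam) A0 two) (meanD (c2 _ p (expR 2 * lam `^ (1 - p)) PQ0 p0)
  (c2 _ 2 (expR 4 * S) E0 two) (m2 _ p (expR 2 * lam `^ (1 - p)) PQ0 p0) (m2 _ 2 (expR 4 * S) E0 two))).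
have CR := cD _ _ (@cont_cst R 0) (cD _ _ (c2 _ 2 (expR 4 * lam) A0 two)
  (cD _ _ (c2 _ p (expR 2 * lam `^ (1 - p)) PQ0 p0) (c2 _ 2 (expR 4 * S) E0 two))).
apply: (le_trans (mean_le cL CR LM MR pw)); rewrite add0r.
have mA := pmean2_testf (p / 2) s m0 qsp u; rewrite -/A -/L in mA.
have mE := pmean2_testf ((p - 1) / 2) s m0 qsp u; rewrite -/E -/L in mE.
set X := expR (p * (p - 1) / 4 * L); set Z := expR ((p - 1) ^+ 2 / 4 * L).
have i1 : lam * pmean 2 (rterms A) <= eta * X.
  apply: (le_trans (ler_wpM2l (ltW l0) mA)); rewrite /lam /X -[leLHS]mulrA -expRD.
  by rewrite ler_wpM2l ?(ltW e0) // ler_expR le_eqVlt; apply/orP; left; apply/eqP; field.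
have i2 : lam `^ (1 - p) * pmean p (dsub (terms P) (terms Q)) <= eta * X.
  apply: (le_trans (ler_wpM2l (powR_ge0 _ _) hPQ)).
  rewrite /lam powRM ?(ltW e0) ?expR_ge0 // mulrAC -powRD; last by rewrite (gt_eqF e0) implybT.
  have -> : 1 - p + p = 1 by ring.
  rewrite powRr1 ?(ltW e0) // ler_wpM2l ?(ltW e0) // -expRM ler_expR.
  by rewrite le_eqVlt; apply/orP; left; apply/eqP; field.
have i3 : pmean 2 (rterms E) <= Z.
  apply: (le_trans mE); rewrite /Z ler_expR le_eqVlt; apply/orP; left; apply/eqP; field => //.
have e24 : expR 2 <= expR 4 :> R by rewrite ler_expR ler_nat.
rewrite -[2 * eta * X]mulrA; apply: (young_terms_le (expR_ge0 2) e24 _ S0 i1 i2 i3).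
by apply: mulr_ge0; [exact: ltW|exact: expR_ge0].
Qed.

Lemma Re_cvg (z_ : nat -> C) (z : C) :
  cmod (z_ k - z) @[k --> \oo] --> (0 : R) -> complex.Re (z_ k) @[k --> \oo] --> complex.Re z.
Proof.
move=> h; apply/cvgrPdist_le => e e0.
have /cvgrPdist_le/(_ e e0) := h; apply: filterS => k.
rewrite sub0r normrN ger0_norm ?cmod_ge0 //; apply: le_trans.
by rewrite distrC -ReN -ReD; exact: Re_le_cmod.
Qed.

Lemma pmean_of_Hp_norm (p : R) (P Q : dirpoly R) e : 0 < p ->
  Hp_norm p (fun s => deval P s - deval Q s) < e ->
  pmean p (dsub (terms P) (terms Q)) <= e `^ p.
Proof.
move=> p0 /ltW; rewrite Hp_norm_sub // => h.
have m0 : 0 <= pmean p (dsub (terms P) (terms Q)) by apply: pmean_ge0 => //; exact: dsub_pos (terms_pos P) (terms_pos Q).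
have := ler_powR2 (ltW p0) (powR_ge0 _ _) h.
by rewrite -powRrM mulVf ?gt_eqF // powRr1.
Qed.

(** Fixes the scale [s] at which the contribution of the bounded function [Q] in
    [dual_test] is negligible. *)
Lemma small_scale (S k p : R) : 0 < k -> 0 <= S -> 2 <= p -> exists s : R, [/\ 0 < s, s <= 1 &
  forall L : R, 0 <= L -> (2 * (2 * s))^-1 * expR (- 4) <= expR L ->
    expR 4 * (S * expR (- ((p - 1) / 4 * L))) <= k].
Proof.
move=> k0 S0 p2; have S1 : 0 < S + 1 by rewrite ltr_wpDl.
pose w := k / (expR 4 * (S + 1)).
have w0 : 0 < w by rewrite divr_gt0 // mulr_gt0 ?expR_gt0.
exists (Num.min 1 (w ^+ 4 / (4 * expR 4))); split.
- by rewrite lt_min ltr01 divr_gt0 ?exprn_gt0 // mulr_gt0 ?expR_gt0.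
- by rewrite ge_min lexx.
set s := Num.min _ _ => l L0 HL.
have s0 : 0 < s by rewrite /s lt_min ltr01 divr_gt0 ?exprn_gt0 // mulr_gt0 ?expR_gt0.
have sw : 4 * s * expR 4 <= w ^+ 4.
  have : s <= w ^+ 4 / (4 * expR 4) by rewrite /s ge_min lexx orbT.
  rewrite ler_pdivlMr ?mulr_gt0 ?expR_gt0 //; apply: le_trans.
  by rewrite le_eqVlt; apply/orP; left; apply/eqP; ring.
have h1 : expR (- (4^-1 * l)) <= w.
  rewrite -(@ler_pXn2r _ 4) ?nnegrE ?expR_ge0 // ?(ltW w0) //.
  apply: le_trans sw; rewrite -expRM_natr.
  have -> : - (4^-1 * l) * 4 = - l by field.
  rewrite expRN -[leRHS]invrK lef_pV2 ?posrE ?invr_gt0 ?expR_gt0 ?mulr_gt0 ?expR_gt0 //.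
  apply: le_trans HL; rewrite expRN le_eqVlt; apply/orP; left; apply/eqP.
  by field; rewrite !gt_eqF // ?expR_gt0.
have h2 : expR (- ((p - 1) / 4 * l)) <= w.
  by apply: le_trans h1; rewrite ler_expR lerN2 ler_wpM2r //; lra.
have h3 : S * expR (- ((p - 1) / 4 * l)) <= (S + 1) * w.
  by apply: ler_pM => //; rewrite ?expR_ge0 // lerDl.
apply: (le_trans (ler_wpM2l (expR_ge0 4) h3)).
by rewrite /w le_eqVlt; apply/orP; left; apply/eqP; field; rewrite !gt_eqF // expR_gt0.
Qed.

(** Let [F K] be close to [F j] for all large [j] and apply [dual_test]. As [j] grows
    the pairing becomes that of [phi], which is at least of order
    [s ^ beta * expR (p ^+ 2 / 4 * L)], while the norm of [F j - F K] only allows a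
    small multiple of [expR (p * (p - 1) / 4 * L)]. Since [expR L] is of order
    [s ^ (- 1)], this rules out [beta <= p / 4], the endpoint included. *)
Lemma phi_Hp_necessary (p beta : R) : 2 <= p -> 0 < beta -> phi_in_Hp p beta -> p / 4 < beta.
Proof.
move=> p2 b0 [F [Fc Fl]]; rewrite ltNge; apply/negP => bp.
have p0 : 0 < p by lra.
have [c c0 Hc] := phi_coef_ge b0.
(* [A = p * (p - 1) / 4 + p / 4]; the constant [k3] is a lower bound for
   [s `^ (p / 4) * expR (p / 4 * L)]. *)
pose A := p / 2 * (p / 2); pose k3 := (4^-1 * expR (- 4) : R) `^ (p / 4).
pose k : R := c * expR (- (4 * A ^+ 2)) * k3.
have k0 : 0 < k by rewrite !mulr_gt0 ?expR_gt0 // powR_gt0 // mulr_gt0 ?expR_gt0.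
pose eta : R := k / (8 * expR 4).
have e0 : 0 < eta by rewrite divr_gt0 // mulr_gt0 ?expR_gt0.
have [K HK] := Fc eta e0.
have k40 : 0 < k / 4 by rewrite divr_gt0.
have [s [s0 s1 Hs]] := small_scale k40 (dsize_ge0 (terms (F K))) p2.
have t0 : 0 < 2 * s by rewrite mulr_gt0.
have [N HN] := prime_sum_ge t0.
set qs := plist N in HN; set L := \sum_(q <- qs) _ in HN.
have qsp : all prime qs by exact: plist_prime.
have u : uniq qs by exact: plist_uniq.
have L0 : 0 <= L by apply: sumr_ge0 => q _; exact: rpow_ge0.
have [N1 H1] := testf_modulus (p / 2) (ltW s0) qsp.
have [N2 H2] := testf_modulus (p / 2 - 1) (ltW s0) qsp.
have [N3 H3] := testf_modulus ((p - 1) / 2) (ltW s0) qsp.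
pose m := (N1 + N2 + N3).+1.
have m0 : (0 < m)%N by [].
set TA := testf (p / 2) s m qs; set TB := testf (p / 2 - 1) s m qs.
pose X := expR (p * (p - 1) / 4 * L).
pose Z := expR ((p - 1) ^+ 2 / 4 * L).
pose S := dsize (terms (F K)).
have up j : (K <= j)%N -> lcorr (fun n => complex.Re (dcoef (F j) n)) TA TB <=
   expR 4 * (2 * eta * X + S * Z).
  move=> Kj; apply: dual_test => //.
  - by apply: pmean_of_Hp_norm => //; exact: HK.
  - by apply: H1; rewrite ltnS -addnA leq_addr.
  - by apply: H2; rewrite ltnS addnAC leq_addl.
  - have m3 : (N3 < m)%N by rewrite ltnS leq_addl.
    by move=> t; have /andP[] := H3 m m3 t.
have LA : lpos TA by exact: eprod_pos.
have LB : lpos TB by exact: eprod_pos.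
have lim : lcorr (phi_coef beta) TA TB <= expR 4 * (2 * eta * X + S * Z).
  have cv := @lcorr_cvg (fun j n => complex.Re (dcoef (F j) n)) (phi_coef beta) TA TB LA LB
    (fun n n0 => Re_cvg (Fl n n0)).
  rewrite -(cvg_lim _ cv) //; apply: limr_le; first by apply/cvg_ex; eexists; exact: cv.
  by exists K => // j /= Kj; exact: up.
have b20 : 0 <= p / 2 - 1 by lra.
have b1 : 1 + (p / 2 - 1) = p / 2 by ring.
have low : c * s `^ beta * expR (A * L - 4 * A ^+ 2) <= lcorr (phi_coef beta) TA TB.
  apply: (@le_trans _ _ (lcorr (fun n => c * s `^ beta * rpow (2^-1 + s) n) TA TB)); last first.
    apply: lcorr_le => //; try by apply: eprod_ge0 => q l; apply: tcoef_ge0; lra.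
    by move=> n; exact: Hc.
  have -> : lcorr (fun n => c * s `^ beta * rpow (2^-1 + s) n) TA TB =
      c * s `^ beta * lcorr (rpow (2^-1 + s)) TA TB.
    rewrite /lcorr mulr_sumr; apply: eq_bigr => x _; rewrite mulr_sumr; apply: eq_bigr => y _.
    by case: ifP => _; rewrite ?mulr0 // mulrCA.
  rewrite ler_wpM2l ?mulr_ge0 ?powR_ge0 // ?(ltW c0) //.
  have := testf_corr_ge s m0 b20 qsp u; rewrite b1 => /(le_trans _); apply.
  by apply: prod1D_ge => //; rewrite ?mulr_ge0 ?ltW // divr_ge0 // ltW.
have EA : expR (A * L - 4 * A ^+ 2) = X * expR L `^ (p / 4) * expR (- (4 * A ^+ 2)).
  by rewrite /X -expRM -!expRD; congr expR; rewrite /A; field.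
have h3 : k3 <= s `^ beta * expR L `^ (p / 4).
  apply: (@le_trans _ _ (s `^ (p / 4) * expR L `^ (p / 4))); last first.
    by rewrite ler_wpM2r ?powR_ge0 //; apply: ger_powR => //; rewrite s0 s1.
  rewrite -(powRM _ (ltW s0) (expR_ge0 L)); apply: ler_powR2; first by rewrite divr_ge0 // ltW.
  - by rewrite mulr_ge0 ?expR_ge0.
  have := ler_wpM2l (ltW s0) HN; apply: le_trans.
  by rewrite le_eqVlt; apply/orP; left; apply/eqP; field; rewrite gt_eqF.
have X0 : 0 < X by exact: expR_gt0.
have h4 : k * X <= c * s `^ beta * expR (A * L - 4 * A ^+ 2).
  rewrite EA /k.
  have := ler_wpM2l (mulr_ge0 (mulr_ge0 (ltW c0) (expR_ge0 (- (4 * A ^+ 2)))) (ltW X0)) h3.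
  rewrite (_ : _ * _ * _ * k3 = c * expR (- (4 * A ^+ 2)) * k3 * X); last by rewrite mulrAC.
  move/le_trans; apply; rewrite le_eqVlt; apply/orP; left; apply/eqP.
  clear; ring.
have h5 : expR 4 * (S * Z) <= k / 4 * X.
  have := ler_wpM2r (ltW X0) (Hs L L0 HN); apply: le_trans.
  rewrite -!mulrA -expRD le_eqVlt; apply/orP; left; apply/eqP.
  by congr (_ * (_ * expR _)); field => //.
have h6 : expR 4 * (2 * eta * X) = k / 4 * X.
  have := expR_gt0 (4 : R); rewrite /eta; move: (expR 4) => v v0.
  have v1 : v != 0 by rewrite gt_eqF.
  by clear -v1; field.
have := le_trans h4 (le_trans low lim); rewrite mulrDr h6 => h7.
have h8 : k * X <= k / 4 * X + k / 4 * X by apply: (le_trans h7); rewrite lerD2l; exact: h5.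
have kX : 0 < k * X by rewrite mulr_gt0.
move: h8; rewrite [k / 4 * X]mulrAC; move: kX; move: (k * X) => y kX h8; clear -kX h8; lra.
Qed.

End Necessity.

(** * Norms of the smoothed zeta products *)

Section QuadraticPowers.
Variable R : realType.
Implicit Types (c a rho : R) (m k : nat).

(** For [c = a / m] an approximation of [exp (a * ('X + 'X ^+ 2 / 2))], that is of
    [(1 - 'X) ^ (- a)] up to the third order. *)
Definition qpoly c m : {poly R} := (1 + c *: 'X + (c / 2) *: 'X^2) ^+ m.

Lemma qpoly_ge0 c m k : 0 <= c -> 0 <= (qpoly c m)`_k.
Proof.
move=> c0; elim: m k => [|m ih] k; first by rewrite /qpoly expr0 coef1 ler0n.
rewrite /qpoly exprS coefM; apply: sumr_ge0 => j _; apply: mulr_ge0; last exact: ih.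
by rewrite !coefD !coefZ coef1 coefX coefXn !addr_ge0 // mulr_ge0 // divr_ge0.
Qed.

Lemma qpoly_coef0 c m : (qpoly c m)`_0 = 1.
Proof.
rewrite -horner_coef0 /qpoly horner_exp !hornerE.
by rewrite -[RHS](expr1n _ m); congr (_ ^+ m); rewrite /=; ring.
Qed.

Lemma qpoly_coef1 c m : (qpoly c m)`_1 = m%:R * c.
Proof.
elim: m => [|m ih]; first by rewrite /qpoly expr0 coef1 mul0r.
rewrite /qpoly exprS coefM !big_ord_recl big_ord0 /= -/(qpoly c m) ih qpoly_coef0.
by rewrite !coefD !coefZ !coef1 !coefX !coefXn /= -natr1; ring.
Qed.

Lemma qpoly_size c m : (size (qpoly c m) <= (2 * m).+1)%N.
Proof.
apply: (leq_trans (size_poly_exp_leq _ _)); rewrite ltnS leq_mul2r; apply/orP; right.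
suff : (size ((1 + c *: 'X + (c / 2) *: 'X^2)%R : {poly R}) <= 3)%N by case: (size _).
apply: (leq_trans (size_polyD _ _)); rewrite geq_max; apply/andP; split.
  apply: (leq_trans (size_polyD _ _)); rewrite geq_max size_poly1 /=.
  by apply: (leq_trans (size_scale_leq _ _)); rewrite size_polyX.
by apply: (leq_trans (size_scale_leq _ _)); rewrite size_polyXn.
Qed.

Lemma sum_sq_le n (x : 'I_n -> R) : (forall i, 0 <= x i) ->
  \sum_(i < n) x i ^+ 2 <= (\sum_(i < n) x i) ^+ 2.
Proof.
move=> x0; rewrite [leRHS]expr2 mulr_suml; apply: ler_sum => i _.
rewrite expr2 ler_wpM2l // (bigD1 i) //= lerDl.
exact: sumr_ge0.
Qed.

Lemma sum_recl2 n (f : nat -> R) :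
  \sum_(i < n.+2) f i = f 0%N + (f 1%N + \sum_(i < n) f i.+2).
Proof. by rewrite 2!big_ord_recl. Qed.

(** The coefficients of indices [0] and [1] give [1 + a ^+ 2 * rho ^+ 2]; the others
    carry at least [rho ^+ 4], and their total is at most the value at [1]. *)
Lemma qpoly_sum_sq a m rho : 0 <= a -> (0 < m)%N -> 0 <= rho -> rho <= 1 ->
  \sum_(k < (2 * m).+1) ((qpoly (a / m%:R) m)`_k * rho ^+ k) ^+ 2 <=
  expR (a ^+ 2 * rho ^+ 2) * expR (expR (3 * a) * rho ^+ 4).
Proof.
move=> a0; case: m => // m _ r0 r1; set n := m.+1.
have n0 : (n%:R : R) != 0 by rewrite pnatr_eq0.
pose c := a / n%:R; have c0 : 0 <= c by rewrite divr_ge0.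
rewrite -/c.
have [x xE] : exists x : nat -> R, forall k, (qpoly c n)`_k = x k by exists (fun k => (qpoly c n)`_k).
have x0 k : 0 <= x k by rewrite -xE qpoly_ge0.
rewrite (eq_bigr (fun k : 'I_ _ => (x k * rho ^+ k) ^+ 2)); last by move=> k _; rewrite xE.
have -> : (2 * n).+1 = (2 * m).+3 by rewrite /n mulnS.
rewrite (@sum_recl2 _ (fun k => (x k * rho ^+ k) ^+ 2)).
have -> : x 0%N = 1 by rewrite -xE qpoly_coef0.
have -> : x 1%N = a by rewrite -xE qpoly_coef1 /c mulrC divfK.
have tot : \sum_(i < (2 * m).+3) x i <= expR (3 / 2 * a).
  have -> : \sum_(i < (2 * m).+3) x i = (qpoly c n).[1].
    rewrite (@horner_coef_wide _ (2 * m).+3); last by have := qpoly_size c n; rewrite /n mulnS.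
    by apply: eq_bigr => i _; rewrite expr1n mulr1 xE.
  rewrite /qpoly horner_exp !hornerE /=.
  have -> : 3 / 2 * a = (c + c / 2) * n%:R by rewrite /c; field.
  rewrite expRM_natr lerXn2r ?nnegrE ?expR_ge0 //.
    by rewrite !mulr1 -addrA !addr_ge0 // divr_ge0.
  by rewrite !mulr1 -addrA expR_ge1Dx.
have tl : \sum_(i < (2 * m).+1) (x i.+2 * rho ^+ i.+2) ^+ 2 <= expR (3 * a) * rho ^+ 4.
  apply: (@le_trans _ _ (\sum_(i < (2 * m).+1) x i.+2 ^+ 2 * rho ^+ 4)).
    apply: ler_sum => i _; rewrite exprMn ler_wpM2l ?sqr_ge0 //.
    by rewrite -exprM ler_wiXn2l //; lia.
  rewrite -mulr_suml ler_wpM2r ?exprn_ge0 //.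
  apply: (le_trans (sum_sq_le (fun i => x0 _))).
  have -> : expR (3 * a) = expR (3 / 2 * a) ^+ 2.
    by rewrite -expRM_natr; congr expR; field => //.
  rewrite lerXn2r ?nnegrE ?expR_ge0 ?sumr_ge0 //.
  by apply: le_trans tot; rewrite sum_recl2 addrA lerDr addr_ge0.
set T := \sum_(i < _) _ in tl *.
apply: (@le_trans _ _ ((1 + a ^+ 2 * rho ^+ 2) * (1 + expR (3 * a) * rho ^+ 4))).
  have h1 : 0 <= a ^+ 2 * rho ^+ 2 by rewrite mulr_ge0 ?sqr_ge0.
  have h2 : 0 <= expR (3 * a) * rho ^+ 4 by rewrite mulr_ge0 ?expR_ge0 ?exprn_ge0.
  have h3 := mulr_ge0 h1 h2.
  rewrite expr0 !mulr1 expr1n expr1 exprMn.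
  by move: tl h1 h2 h3; move: (a ^+ 2 * rho ^+ 2) (expR _ * _) T => v1 v2 v3; clear; lra.
by apply: ler_pM; rewrite ?addr_ge0 ?mulr_ge0 ?sqr_ge0 ?exprn_ge0 ?expR_ge0 ?expR_ge1Dx.
Qed.

End QuadraticPowers.

Section ZetaProducts.
Variable R : realType.
Local Notation C := R[i].
Implicit Types (a s t : R) (m q K : nat) (qs : seq nat).

Definition hcoef a s m q k : R := (qpoly (a / m%:R) m)`_k * rpow (2^-1 + s) q ^+ k.

Lemma hcoef_eval a s m q t : (0 < m)%N ->
  \sum_(k < (2 * m).+1) (hcoef a s m q k)%:C * nchar t q ^+ k =
  (1 + a%:C * nlog1B 2 ((rpow (2^-1 + s) q)%:C * nchar t q) * (m%:R^-1)%:C) ^+ m.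
Proof.
move=> m0; set r := rpow _ _; set z := nchar t q.
have n0 : (m%:R : R) != 0 by rewrite pnatr_eq0 -lt0n.
pose P := map_poly (real_complex R) (qpoly (a / m%:R) m).
transitivity P.[r%:C * z].
  rewrite (@horner_coef_wide _ (2 * m).+1); last by rewrite size_map_poly qpoly_size.
  by apply: eq_bigr => k _; rewrite coef_map exprMn mulrA /hcoef -/r rmorphM rmorphXn.
rewrite /P rmorphXn /= horner_exp; congr (_ ^+ _).
rewrite !rmorphD /= rmorph1 !map_polyZ map_polyX map_polyXn !hornerE.
rewrite /nlog1B 2!big_ord_recl big_ord0 /= expr1 addr0 invr1 mulr1 -addrA; congr (1 + _).
have -> : (a / m%:R / 2)%:C = a%:C * (m%:R^-1)%:C * (2^-1)%:C by rewrite -!rmorphM.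
have -> : (a / m%:R)%:C = a%:C * (m%:R^-1)%:C by rewrite -!rmorphM.
rewrite -[bump 0 0]/1%N expr2; move: (a%:C) ((m%:R^-1)%:C) ((2^-1)%:C) (r%:C) => v1 v2 v3 v4; ring.
Qed.


Lemma expR_prime_sum_le s qs : 0 < s -> all prime qs -> uniq qs ->
  expR (\sum_(q <- qs) rpow (1 + 2 * s) q) <= 1 + (2 * s)^-1.
Proof.
move=> s0 qsp u; have t0 : 0 < 2 * s by rewrite mulr_gt0.
have h := euler_le t0 qsp u.
have h2 : \prod_(q <- qs) (1 - rpow (1 + 2 * s) q) <= expR (- \sum_(q <- qs) rpow (1 + 2 * s) q).
  rewrite -sumrN expR_sum big_seq [leRHS]big_seq; apply: ler_prod => q qq.
  have q1 := prime_gt1 (allP qsp _ qq).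
  rewrite subr_ge0 rpow_le1 ?(ltnW q1) ?expR_ge1Dx //; lra.
have t1 : 0 <= 1 + (2 * s)^-1 by rewrite addr_ge0 // invr_ge0 ltW.
have := le_trans h (ler_wpM2l t1 h2).
by rewrite expRN ler_pdivlMr ?expR_gt0 // mul1r.
Qed.

Lemma sqr_rpow_half s q : (0 < q)%N -> rpow (2^-1 + s) q ^+ 2 = rpow (1 + 2 * s) q :> R.
Proof. by move=> q0; rewrite expr2 -rpowD //; congr (rpow _ _); lra. Qed.

Lemma pmean2_hcoef a s m qs : 0 <= a -> (0 < m)%N -> 0 < s -> all prime qs -> uniq qs ->
  pmean 2 (rterms (eprod (hcoef a s m) (2 * m) qs)) <=
  expR (2 * expR (3 * a)) * (1 + (2 * s)^-1) `^ (a ^+ 2).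
Proof.
move=> a0 m0 s0 qsp u; rewrite pmean2_eprod //.
have s2 : 0 <= 2^-1 + s by rewrite addr_ge0 // ltW.
apply: (@le_trans _ _ (\prod_(q <- qs) expR (a ^+ 2 * rpow (1 + 2 * s) q + expR (3 * a) * rpow (1 + 1) q))).
  rewrite big_seq [leRHS]big_seq; apply: ler_prod => q qq.
  have q1 := prime_gt1 (allP qsp _ qq); have q0 := ltnW q1.
  rewrite sumr_ge0 /=; last by move=> k _; exact: sqr_ge0.
  apply: (le_trans (qpoly_sum_sq a0 m0 (rpow_ge0 _ _) (rpow_le1 s2 q0))).
  rewrite -expRD ler_expR (sqr_rpow_half _ q0) lerD2l ler_wpM2l ?expR_ge0 //.
  rewrite (exprM _ 2 2) (sqr_rpow_half _ q0) expr2 -rpowD //.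
  by apply: rpow_homo => //; lra.
rewrite -expR_sum big_split /= -!mulr_sumr expRD mulrC; apply: ler_pM; rewrite ?expR_ge0 //.
  rewrite ler_expR mulrC ler_wpM2r ?expR_ge0 //.
  have := @zeta_sum_le R 1 qs ltr01 u; rewrite invr1; apply.
  by apply/allP => q /(allP qsp) /prime_gt0.
rewrite mulrC expRM; apply: ler_powR2; rewrite ?sqr_ge0 ?expR_ge0 //.
exact: expR_prime_sum_le.
Qed.

(** The logarithm of the Euler product has to be expanded to the second order: the
    squares [q ^ (- 1)] of the terms at [s = 0] have a divergent sum, the third powers
    [q ^ (- 3 / 2)] a convergent one. *)
Definition log_zeta s qs t : R :=
  \sum_(q <- qs) complex.Re (nlog1B 2 ((rpow (2^-1 + s) q)%:C * nchar t q)).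

Lemma hcoef_modulus a s qs : 0 <= a -> 0 <= s -> all prime qs -> exists2 m, (0 < m)%N &
  forall t, expR (a * log_zeta s qs t - 1) <=
    cmod (ev (rterms (eprod (hcoef a s m) (2 * m) qs)) (nchar t)).
Proof.
move=> a0 s0 qsp.
pose e : R := ((size qs)%:R + 1)^-1; have k0 : (0 : R) < (size qs)%:R + 1 by rewrite ltr_wpDl.
have e0 : 0 < e by rewrite invr_gt0.
have e1 : (size qs)%:R * e <= 1 by rewrite /e ler_pdivrMr // mul1r lerDl.
have a2 : 0 <= a * 2 by rewrite mulr_ge0.
have [N HN] := euler_exp a2 e0.
exists N.+1 => // t; rewrite ev_eprod // cmod_prod; set m := N.+1.
pose w q : C := (rpow (2^-1 + s) q)%:C * nchar t q.
pose x q := a * complex.Re (nlog1B 2 (w q)).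
have F q : prime q -> expR (x q - e) <=
    cmod (\sum_(k < (2 * m).+1) (hcoef a s m q k)%:C * nchar t q ^+ k) <= expR (x q + e).
  move=> qp; have q0 := prime_gt0 qp; rewrite hcoef_eval // cmodX.
  have := HN m (ltnSn N) (a%:C * nlog1B 2 (w q)); rewrite Re_realM; apply.
  rewrite cmodM cmod_real ger0_norm // ler_wpM2l //.
  have w1 : cmod (w q) <= 1.
    by rewrite /w cmodM cmod_real cmod_nchar mulr1 ger0_norm ?rpow_ge0 // rpow_le1 // addr_ge0.
  rewrite /nlog1B; apply: (le_trans (cmod_sum _ _ _)).
  rewrite (_ : 2 = \sum_(k < 2) (1 : R)); last by rewrite sumr_const card_ord.
  apply: ler_sum => k _; rewrite cmodM cmodX cmod_real ger0_norm ?invr_ge0 //.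
  apply: mulr_ile1.
  - by rewrite exprn_ge0 // cmod_ge0.
  - by rewrite invr_ge0.
  - by rewrite exprn_ile1 // cmod_ge0.
  - by rewrite invf_le1 ?ltr0n // ler1n.
pose f q := if prime q then cmod (\sum_(k < (2 * m).+1) (hcoef a s m q k)%:C * nchar t q ^+ k)
   else expR (x q).
have Ff q : expR (x q - e) <= f q <= expR (x q + e).
  rewrite /f; case: ifP => [/F //|_]; rewrite !ler_expR; apply/andP; split; lra.
have /andP[h1 _] := prod_expR_bounds qs Ff.
have fE : \prod_(i <- qs) f i =
    \prod_(i <- qs) cmod (\sum_(k < (2 * m).+1) (hcoef a s m i k)%:C * nchar t i ^+ k).
  by rewrite big_seq [RHS]big_seq; apply: eq_bigr => q /(allP qsp) qp; rewrite /f qp.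
rewrite -fE; apply: le_trans h1; rewrite ler_expR /log_zeta mulr_sumr.
by rewrite lerD2l lerN2.
Qed.

(** The factor at one prime of the truncated Euler product: the truncation costs a
    factor close to [1], the expansion of the logarithm an error of third order. *)
Lemma geom_sum_le (w : C) K : cmod w <= 3 / 4 ->
  cmod (\sum_(k < K.+1) w ^+ k) <=
  (1 + (3 / 4) ^+ K.+1) * expR (complex.Re (nlog1B 2 w) + 4 * cmod w ^+ 3).
Proof.
move=> w34; have w1 : cmod w < 1 by lra.
have w0 := cmod_ge0 w.
have d0 : 0 < cmod (1 - w).
  have := cmodD (1 - w) w; rewrite subrK cmod1; lra.
have tele : cmod (\sum_(k < K.+1) w ^+ k) * cmod (1 - w) <= 1 + (3 / 4) ^+ K.+1.
  have -> : cmod (\sum_(k < K.+1) w ^+ k) * cmod (1 - w) = cmod (1 - w ^+ K.+1).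
    by rewrite -cmodM mulrC -[1 - w ^+ _]opprB subrX1 -mulNr opprB.
  apply: (le_trans (cmodB _ _)); rewrite cmod1 lerD2l cmodX lerXn2r ?nnegrE //; lra.
rewrite -ler_pdivlMr // in tele; apply: (le_trans tele).
apply: ler_wpM2l; first by rewrite addr_ge0 // exprn_ge0.
have /ler_normlP[h _] := nlog1B_approx 2 w1.
have -> : (cmod (1 - w))^-1 = expR (- ln (cmod (1 - w))) by rewrite expRN lnK.
rewrite ler_expR.
have : cmod w ^+ 3 / (1 - cmod w) <= 4 * cmod w ^+ 3.
  rewrite ler_pdivrMr; last lra.
  have w3 : 0 <= cmod w ^+ 3 by rewrite exprn_ge0.
  move: (cmod w ^+ 3) w3 => v v0; nra.
move: h; rewrite opprD; lra.
Qed.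

End ZetaProducts.

(** * Mean bounds for box polynomials *)

Section BoxPolynomials.
Variable R : realType.
Local Notation C := R[i].
Implicit Types (a s t p : R) (f : nat -> R) (m q K n : nat) (qs : seq nat).

Definition boxd f qs K : dlist R := [seq ((f n)%:C, n) | n <- box qs K].

Lemma boxd_pos f qs K : all prime qs -> dpos (boxd f qs K).
Proof. by move=> qsp; apply/allP => x /mapP[n nb ->] /=; exact: box_pos nb. Qed.

Lemma ev_boxd f qs K chi : ev (boxd f qs K) chi = \sum_(n <- box qs K) (f n)%:C * chi n.
Proof. by rewrite /ev big_map. Qed.

Lemma nchar1 t : nchar t 1 = 1.
Proof. by rewrite -[1%N]/(2 ^ 0)%N ncharX. Qed.

Lemma ev_boxd_rpow s qs K t : all prime qs ->
  ev (boxd (rpow (2^-1 + s)) qs K) (nchar t) =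
  \prod_(q <- qs) \sum_(k < K.+1) ((rpow (2^-1 + s) q)%:C * nchar t q) ^+ k.
Proof.
move=> qsp; rewrite ev_boxd; apply: (@box_sum _ (fun n => (rpow (2^-1 + s) n)%:C * nchar t n)) => //.
have [r1 rM] := rpow_mul (2^-1 + s).
split; first by rewrite r1 nchar1 mulr1.
by move=> n k n0 k0; rewrite rM // ncharM // rmorphM /= mulrACA.
Qed.

Lemma rpow_le34 s q : 0 <= s -> (1 < q)%N -> rpow (2^-1 + s) q <= 3 / 4.
Proof.
move=> s0 q1; have q0 := ltnW q1.
have : rpow (2^-1 + s) q ^+ 2 <= 2^-1.
  by rewrite (sqr_rpow_half _ q0) rpow_half //; lra.
have := rpow_ge0 (2^-1 + s) q; move: (rpow _ _) => r r0 h.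
rewrite leNgt; apply/negP => h1; move: h; nra.
Qed.

(** [13 = 1 + 4 * 3]: the truncation of the exponents costs at most a factor [e] once
    [K] is large, and the sum of the third powers is at most that of the
    [q ^ (- 3 / 2)], hence at most [3]. *)
Lemma zbox_modulus qs : all prime qs -> uniq qs -> exists K0, forall K s t, (K0 <= K)%N -> 0 <= s ->
  cmod (ev (boxd (rpow (2^-1 + s)) qs K) (nchar t)) <= expR (13 + log_zeta s qs t).
Proof.
move=> qsp u.
have [K0 HK] := @geometric_small R (size qs)%:R (3 / 4) ltac:(lra) ltac:(lra) 1 ltr01.
exists K0 => K s t KK s0; rewrite ev_boxd_rpow // cmod_prod.
set g : R := (3 / 4) ^+ K.+1; have g0 : 0 <= g by rewrite exprn_ge0.
pose w q : C := (rpow (2^-1 + s) q)%:C * nchar t q.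
apply: (@le_trans _ _ (\prod_(q <- qs)
    expR (g + (complex.Re (nlog1B 2 (w q)) + 4 * rpow (1 + 2^-1) q)))).
  rewrite big_seq [leRHS]big_seq; apply: ler_prod => q qq; rewrite cmod_ge0 /=.
  have q1 := prime_gt1 (allP qsp _ qq); have q0 := ltnW q1.
  have wr : cmod (w q) = rpow (2^-1 + s) q.
    by rewrite /w cmodM cmod_real cmod_nchar mulr1 ger0_norm ?rpow_ge0.
  have w34 : cmod (w q) <= 3 / 4 by rewrite wr rpow_le34.
  apply: (le_trans (geom_sum_le K w34)); rewrite [leRHS]expRD; apply: ler_pM; rewrite ?expR_ge0 ?expR_ge1Dx //.
  rewrite ler_expR lerD2l ler_wpM2l // wr exprSr (sqr_rpow_half _ q0) -rpowD //.
  by apply: rpow_homo => //; lra.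
rewrite -expR_sum ler_expR big_split big_split /= -/(log_zeta s qs t).
have h1 : \sum_(q <- qs) g <= 1.
  rewrite big_const_seq count_predT iter_addr_0 -mulr_natl; apply: HK; exact: leqW.
have h2 : \sum_(q <- qs) rpow (1 + 2^-1) q <= 1 + 2^-1^-1 :> R.
  apply: zeta_sum_le => //.
  by apply/allP => q /(allP qsp) /prime_gt0.
rewrite -mulr_sumr; rewrite invrK in h2.
move: h1 h2; move: (\sum_(q <- qs) g) (\sum_(q <- qs) rpow (1 + 2^-1) q) (log_zeta _ _ _) => x y z.
clear; lra.
Qed.

(** [|exp (log_zeta)| ^ p] is comparable to the square of the modulus of the product
    of [qpoly]s with [a = p / 2], whose mean is a product of sums of squares. *)
Lemma zbox_bound p : 0 < p -> exists2 C0, 0 < C0 &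
  forall qs, all prime qs -> uniq qs -> exists K0, forall K s, (K0 <= K)%N -> 0 < s ->
  pmean p (boxd (rpow (2^-1 + s)) qs K) <= C0 * (1 + (2 * s)^-1) `^ ((p / 2) ^+ 2).
Proof.
move=> p0; exists (expR (13 * p + 2) * expR (2 * expR (3 * (p / 2)))).
  by rewrite mulr_gt0 ?expR_gt0.
move=> qs qsp u; have [K0 HK] := zbox_modulus qsp u; exists K0 => K s KK s0.
have a0 : 0 <= p / 2 by rewrite divr_ge0 // ltW.
have [m m0 Hm] := hcoef_modulus a0 (ltW s0) qsp.
rewrite -mulrA; apply: le_trans (ler_wpM2l (expR_ge0 _) (pmean2_hcoef a0 m0 s0 qsp u)).
apply: pmean_le => //; first exact: boxd_pos.
  by apply: rterms_pos; exact: eprod_pos.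
move=> t; rewrite [_ `^ 2]powR_mulrn ?cmod_ge0 //.
apply: (@le_trans _ _ (expR (13 + log_zeta s qs t) `^ p)).
  by apply: ler_powR2; rewrite ?cmod_ge0 ?(ltW p0) // HK // ltW.
apply: (@le_trans _ _ (expR (13 * p + 2) * expR (p / 2 * log_zeta s qs t - 1) ^+ 2)).
  rewrite -expRM -expRM_natr -expRD ler_expR le_eqVlt; apply/orP; left; apply/eqP.
  by field => //.
by rewrite ler_wpM2l ?expR_ge0 // lerXn2r ?nnegrE ?expR_ge0 ?cmod_ge0.
Qed.

Definition ztail s n : R := if n == 1%N then 0 else rpow (2^-1 + s) n.

Lemma box1 qs K : all prime qs -> uniq qs -> (1 \in box qs K)%N.
Proof.
move=> qsp u; apply: mem_box => //; last by move=> r; rewrite logn1.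
by move=> r rp; rewrite dvdn1 => /eqP r1; move: rp; rewrite r1.
Qed.

Lemma ev_boxd_not1 f qs K chi : all prime qs -> uniq qs ->
  ev (boxd f qs K) chi =
  (f 1%N)%:C * chi 1%N + \sum_(n <- box qs K | n != 1%N) (f n)%:C * chi n.
Proof. by move=> qsp u; rewrite ev_boxd (bigD1_seq 1%N) ?box1 ?box_uniq. Qed.

Lemma ev_ztail s qs K t : all prime qs -> uniq qs ->
  ev (boxd (ztail s) qs K) (nchar t) = ev (boxd (rpow (2^-1 + s)) qs K) (nchar t) - 1.
Proof.
move=> qsp u; rewrite !ev_boxd_not1 // nchar1 (rpow_mul _).1 {1}/ztail eqxx.
rewrite mul0r add0r mulr1 [RHS]addrAC subrr add0r.
by apply: eq_bigr => n n1; rewrite /ztail (negPf n1).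
Qed.

Lemma ztail_decay s qs K t : 3 <= s -> all prime qs -> uniq qs ->
  cmod (ev (boxd (ztail s) qs K) (nchar t)) <= 2 * expR (3 / 2 / 2) * expR (- (2^-1 * s)).
Proof.
move=> s3 qsp u; rewrite ev_boxd; apply: (le_trans (cmod_sum _ _ _)).
apply: (@le_trans _ _ (\sum_(n <- box qs K) rpow (1 + 1) n * (expR (3 / 2 / 2) * expR (- (2^-1 * s))))).
  rewrite big_seq [leRHS]big_seq; apply: ler_sum => n nb.
  have n0 := box_pos qsp nb.
  rewrite cmodM cmod_nchar mulr1 cmod_real /ztail; case: eqP => [_|/eqP n1].
    by rewrite normr0 !mulr_ge0 ?expR_ge0 // rpow_ge0.
  rewrite ger0_norm ?rpow_ge0 //.
  have -> : 2^-1 + s = (1 + 1) + (s - 3 / 2) by lra.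
  rewrite rpowD // ler_wpM2l ?rpow_ge0 //; apply: rpow_decay; last lra.
  by rewrite ltn_neqAle eq_sym n1.
rewrite -mulr_suml -[leRHS]mulrA ler_wpM2r ?mulr_ge0 ?expR_ge0 //.
have := @zeta_sum_le R 1 (box qs K) ltr01 (box_uniq K qsp u); rewrite invr1; apply.
by apply/allP => n; exact: box_pos.
Qed.

Lemma pmean_le_cst p D c : 0 < p -> dpos D -> (forall t, cmod (ev D (nchar t)) <= c) ->
  pmean p D <= c `^ p.
Proof.
move=> p0 D0 h; have := @pmean_le_sum R nat [::] (fun=> 0) (fun=> 1) (fun=> D) (c `^ p) p D D0 p0.
rewrite !big_nil !addr0; apply=> // t; rewrite big_nil addr0.
by apply: ler_powR2; rewrite ?cmod_ge0 // ltW.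
Qed.

(** For small [s] this is [zbox_bound], the constant term being harmless; for large
    [s] the terms with [n >= 2] are summed. *)
Lemma ztail_bound p : 0 < p -> exists2 B, 0 < B &
  forall qs, all prime qs -> uniq qs -> exists K0, forall K s, (K0 <= K)%N -> 0 < s ->
  pmean p (boxd (ztail s) qs K) <= (B * (s `^ (- (p / 4)) * expR (- (4^-1 * s)))) `^ p.
Proof.
move=> p0; have [C0 C00 HC] := zbox_bound p0.
have g0 : 0 < p / 4 by rewrite divr_gt0.
have [S S0 HS] := decay_weight g0.
pose C1 : R := 2 `^ p * (1 + C0) * 4 `^ ((p / 2) ^+ 2).
have C10 : 0 < C1 by rewrite !mulr_gt0 ?powR_gt0 // addr_gt0.
pose D1 : R := 2 * expR (3 / 2 / 2).
have D10 : 0 < D1 by rewrite mulr_gt0 // expR_gt0.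
exists ((C1 `^ p^-1 + D1) * S).
  by apply: mulr_gt0 => //; apply: addr_gt0 => //; rewrite powR_gt0.
move=> qs qsp u; have [K0 HK] := HC qs qsp u; exists K0 => K s KK s0.
have [W1 W2] := HS s s0; set W := s `^ _ * _ in W1 W2 *.
have W0 : 0 <= W by rewrite mulr_ge0 ?powR_ge0 ?expR_ge0.
have SW0 : 0 <= S * W by rewrite mulr_ge0 // ltW.
have [s3|s3] := leP s 3; last first.
  apply: (@le_trans _ _ ((D1 * expR (- (2^-1 * s))) `^ p)).
    apply: pmean_le_cst => //; first exact: boxd_pos.
    by move=> t; apply: ztail_decay => //; exact: ltW.
  apply: ler_powR2; rewrite ?(ltW p0) ?mulr_ge0 ?expR_ge0 ?(ltW D10) //.
  apply: (le_trans (ler_wpM2l (ltW D10) W2)).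
  by rewrite -[leRHS]mulrA ler_wpM2r // lerDr powR_ge0.
apply: (@le_trans _ _ (C1 * s `^ (- ((p / 2) ^+ 2)))).
  have z0 := boxd_pos (rpow (2^-1 + s)) K qsp.
  have h : pmean p (boxd (ztail s) qs K) <= 2 `^ p + 2 `^ p * pmean p (boxd (rpow (2^-1 + s)) qs K).
    have := @pmean_le_sum R nat [:: 0%N] (fun=> 2 `^ p) (fun=> p) (fun=> boxd (rpow (2^-1 + s)) qs K)
      (2 `^ p) p (boxd (ztail s) qs K) (boxd_pos _ K qsp) p0.
    rewrite big_seq1; apply=> // t; rewrite big_seq1 ev_ztail //.
    set z := ev _ _.
    apply: (@le_trans _ _ ((cmod z + 1) `^ p)).
      apply: ler_powR2; rewrite ?cmod_ge0 ?(ltW p0) //.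
      by apply: (le_trans (cmodB _ _)); rewrite cmod1.
    apply: (le_trans (powRD_le (ltW p0) (cmod_ge0 z) ler01)).
    by rewrite powR1 mulrDr mulr1 addrC.
  apply: (le_trans h).
  have hC := HK K s KK s0.
  set a2 := (p / 2) ^+ 2 in hC *; have a20 : 0 <= a2 by exact: sqr_ge0.
  have k1 : (1 + (2 * s)^-1) `^ a2 <= 4 `^ a2 * s `^ (- a2).
    have -> : s `^ (- a2) = s^-1 `^ a2 by rewrite -[s^-1]powR_inv1 ?(ltW s0) // -powRrM mulN1r.
    rewrite -powRM ?invr_ge0 ?(ltW s0) //; apply: ler_powR2 => //.
      by rewrite addr_ge0 // invr_ge0 mulr_ge0 // ltW.
    rewrite -(ler_pM2r s0) -mulrA mulVf ?gt_eqF // mulrDl mul1r mulr1.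
    have -> : (2 * s)^-1 * s = 2^-1 by field; rewrite gt_eqF.
    by move: s3; clear; lra.
  have k2 : 1 <= 4 `^ a2 * s `^ (- a2).
    apply: (le_trans _ k1); rewrite -[leLHS](powRr0 (1 + (2 * s)^-1)); apply: ler_powR => //.
    by rewrite lerDl invr_ge0 mulr_ge0 // ltW.
  have k3 := le_trans hC (ler_wpM2l (ltW C00) k1).
  have k4 : 1 + pmean p (boxd (rpow (2^-1 + s)) qs K) <= (1 + C0) * (4 `^ a2 * s `^ (- a2)).
    by rewrite mulrDl mul1r lerD.
  have k5 := ler_wpM2l (powR_ge0 2 p : 0 <= 2 `^ p :> R) k4.
  move: k5; rewrite mulrDr mulr1 => k5; apply: (le_trans k5).
  by rewrite /C1 !mulrA.
have -> : C1 * s `^ (- ((p / 2) ^+ 2)) = (C1 `^ p^-1 * s `^ (- (p / 4))) `^ p.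
  rewrite powRM ?powR_ge0 // -!powRrM mulVf ?gt_eqF // powRr1 ?(ltW C10) //.
  by congr (_ * _ `^ _); field => //.
apply: ler_powR2; rewrite ?(ltW p0) ?mulr_ge0 ?powR_ge0 //.
apply: (le_trans (ler_wpM2l (powR_ge0 _ _) (W1 s3))).
by rewrite -[leRHS]mulrA ler_wpM2r // lerDl ltW.
Qed.

End BoxPolynomials.

Section PhiBox.
Variable R : realType.
Local Notation C := R[i].
Implicit Types (s t p : R) (f : nat -> R) (q K n : nat) (qs : seq nat).

(** [phi] is a superposition of shifted zeta functions, whose norms [ztail_bound]
    gives. Jensen's inequality stands in for the triangle inequality; the weights
    are multiplied by the bounds [W k] of the norms, which makes their sum bounded, and the
    functions are divided by them. *)
Lemma phi_box_bound p beta : 2 <= p -> p / 4 < beta -> exists2 Y, 0 < Y &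
  forall qs, all prime qs -> uniq qs -> exists K0, forall K, (K0 <= K)%N ->
  pmean p (boxd (phi_coef beta) qs K) <= Y.
Proof.
move=> p2 pb; have p0 : 0 < p by lra.
have p1 : 1 <= p by lra.
have g0 : 0 < p / 4 by rewrite divr_gt0.
have b0 : 0 < beta by exact: lt_trans pb.
have c0 : 0 < 4^-1 :> R by rewrite invr_gt0.
have [S S0 HS] := superpos_bound g0 pb c0.
have [B B0 HB] := ztail_bound p0.
exists (2 `^ p * 2 `^ p + 2 `^ p * S `^ (p - 1) * B `^ p * S).
  by rewrite addr_gt0 ?mulr_gt0 ?powR_gt0.
move=> qs qsp u; have [K0 HK] := HB qs qsp u; exists K0 => K KK.
pose bx := [seq n <- box qs K | n != 1%N].
have bxP n : n \in bx -> (1 < n)%N.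
  rewrite mem_filter => /andP[n1 nb]; rewrite ltn_neqAle eq_sym n1 /=; exact: box_pos nb.
(* The accuracy [M^-1] makes the total error of the approximation at most [1]. *)
pose M : R := \sum_(n <- bx) rpow 2^-1 n + 1.
have M0 : 0 < M by rewrite ltr_wpDl // sumr_ge0 // => n _; exact: rpow_ge0.
have lnp : all (fun x : R => 0 < x) [seq ln n%:R | n <- bx].
  apply/allP => x /mapP[n /bxP n2 ->].
  by apply: lt_le_trans (ln_nat_ge R n2); rewrite invr_gt0.
have iM : 0 < M^-1 by rewrite invr_gt0.
have [e [k0 [e0 e1 He]]] := superpos_limit b0 iM lnp.
pose w (k : 'I_k0) : R := e `^ beta * binc beta k.+1.
have w0 k : 0 <= w k by rewrite mulr_ge0 ?powR_ge0 ?binc_ge0 // ltW.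
pose sk (k : 'I_k0) : R := k.+1%:R * e.
have sk0 k : 0 < sk k by rewrite mulr_gt0 // ltr0n.
pose W (k : 'I_k0) : R := sk k `^ (- (p / 4)) * expR (- (4^-1 * sk k)).
have W0 k : 0 < W k by rewrite mulr_gt0 ?powR_gt0 ?expR_gt0.
have wW : \sum_k w k * W k <= S by exact: HS.
have approx t : cmod (ev (boxd (phi_coef beta) qs K) (nchar t)) <=
    2 + \sum_k w k * cmod (ev (boxd (ztail (sk k)) qs K) (nchar t)).
  rewrite ev_boxd_not1 // nchar1 phi_coef1 mulr1.
  set P := \sum_(n <- _ | _) _.
  pose T : C := \sum_k (w k)%:C * ev (boxd (ztail (sk k)) qs K) (nchar t).
  have TE : T = \sum_(n <- bx) (rpow 2^-1 n *
      superpos beta e k0 (fun s => expR (- (s * ln n%:R))))%:C * nchar t n.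
    rewrite /T (eq_bigr (fun k => \sum_(n <- bx) (w k * rpow (2^-1 + sk k) n)%:C * nchar t n)).
      rewrite exchange_big /= big_seq [RHS]big_seq; apply: eq_bigr => n /bxP n1.
      by rewrite superpos_term ?(ltnW n1) // -mulr_suml real_complex_sum.
    move=> k _; rewrite ev_boxd_not1 // {1}/ztail eqxx mul0r add0r big_filter mulr_sumr.
    apply: eq_bigr => n n1; rewrite /ztail (negPf n1).
    have -> : (w k * rpow (2^-1 + sk k) n)%:C = (w k)%:C * (rpow (2^-1 + sk k) n)%:C by exact: rmorphM.
    by rewrite mulrA.
  have PT : cmod (P - T) <= 1.
    rewrite TE /P -big_filter -/bx -sumrB; apply: (le_trans (cmod_sum _ _ _)).
    apply: (@le_trans _ _ (\sum_(n <- bx) rpow 2^-1 n * M^-1)).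
      rewrite big_seq [leRHS]big_seq; apply: ler_sum => n nb; have n1 := bxP _ nb.
      rewrite -mulrBl cmodM cmod_nchar mulr1 -rmorphB cmod_real phi_coefE // -mulrBr normrM.
      rewrite ger0_norm ?rpow_ge0 // ler_wpM2l ?rpow_ge0 // distrC; apply: He.
      by apply/mapP; exists n.
    by rewrite -mulr_suml ler_pdivrMr // mul1r lerDl.
  have Tb : cmod T <= \sum_k w k * cmod (ev (boxd (ztail (sk k)) qs K) (nchar t)).
    exact: cmod_real_sum.
  have -> : 1%:C + P = 1%:C + T + (P - T) by ring.
  apply: (le_trans (cmodD _ _)); have := cmodD 1%:C T; rewrite cmod1.
  move: PT Tb; move: (cmod _) (cmod _) (cmod _) (\sum_k _) => x1 x2 x3 x4; clear; lra.
have V0 : 0 <= \sum_k w k * W k by apply: sumr_ge0 => k _; rewrite mulr_ge0 // ltW.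
have pw t : cmod (ev (boxd (phi_coef beta) qs K) (nchar t)) `^ p <=
    2 `^ p * 2 `^ p + \sum_k (2 `^ p * S `^ (p - 1) * (w k * W k * W k `^ (- p))) *
      cmod (ev (boxd (ztail (sk k)) qs K) (nchar t)) `^ p.
  pose x k := cmod (ev (boxd (ztail (sk k)) qs K) (nchar t)).
  have x0 k : 0 <= x k by exact: cmod_ge0.
  have s0 : 0 <= \sum_k w k * x k by apply: sumr_ge0 => k _; rewrite mulr_ge0.
  apply: (@le_trans _ _ ((2 + \sum_k w k * x k) `^ p)).
    by apply: ler_powR2; rewrite ?cmod_ge0 ?(ltW p0) //; exact: approx.
  have two : (0 : R) <= 2 by [].
  apply: (le_trans (powRD_le (ltW p0) two s0)).
  rewrite mulrDr lerD2l -[leRHS]/(\sum_k _ * x k `^ p).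
  rewrite [leRHS](eq_bigr (fun k => 2 `^ p * S `^ (p - 1) * (w k * W k * (x k / W k) `^ p))); last first.
    move=> k _; rewrite powRM ?invr_ge0 ?(ltW (W0 k)) //.
    have -> : (W k)^-1 `^ p = W k `^ (- p).
      by rewrite -[(W k)^-1]powR_inv1 ?(ltW (W0 k)) // -powRrM mulN1r.
    ring.
  rewrite -mulr_sumr -mulrA ler_wpM2l ?powR_ge0 //.
  have -> : \sum_k w k * x k = \sum_k (w k * W k) * (x k / W k).
    by apply: eq_bigr => k _; field; rewrite gt_eqF.
  have := @jensen_powR R _ (index_enum 'I_k0) (fun k => w k * W k) (fun k => x k / W k) p p1.
  move=> /(_ _ _)/le_trans; apply.
  - by move=> k; rewrite mulr_ge0 // ltW.
  - by move=> k; rewrite divr_ge0 // ltW.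
  rewrite ler_wpM2r //; last by apply: ler_powR2 => //; rewrite subr_ge0.
  by apply: sumr_ge0 => k _; rewrite mulr_ge0 ?powR_ge0 // mulr_ge0 // ltW.
apply: (le_trans (pmean_le_sum (boxd_pos _ K qsp) p0 (fun k => boxd_pos _ K qsp) (fun=> p0) pw)).
rewrite lerD2l.
apply: (@le_trans _ _ (\sum_k 2 `^ p * S `^ (p - 1) * B `^ p * (w k * W k))).
  apply: ler_sum => k _.
  have -> : 2 `^ p * S `^ (p - 1) * B `^ p * (w k * W k) =
     2 `^ p * S `^ (p - 1) * (w k * W k * W k `^ (- p)) * (B * W k) `^ p.
    rewrite (powRM p (ltW B0) (ltW (W0 k))) [W k `^ (- p)]powRN.
    have := powR_gt0 p (W0 k); move: (W k `^ p) => v v0.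
    by field; rewrite gt_eqF.
  apply: ler_wpM2l; last exact: HK.
  apply: mulr_ge0; first by apply: mulr_ge0; exact: powR_ge0.
  by apply: mulr_ge0; [apply: mulr_ge0 => //; exact: ltW|exact: powR_ge0].
by rewrite -mulr_sumr ler_wpM2l ?mulr_ge0 ?powR_ge0.
Qed.

End PhiBox.

(** * Sieving, uniform convexity and the Cauchy property *)

Section Sieve.
Variable R : realType.
Local Notation C := R[i].
Implicit Types (s t p : R) (f : nat -> R) (q K L M N n : nat) (ks qs : seq nat) (D E : dlist R).

(** Deleting the terms divisible by one of the primes [ks] is the conditional
    expectation that averages out their variables. *)
Definition sieve ks D : dlist R := [seq x <- D | ~~ has (fun q => (q %| x.2)%N) ks].

Lemma sieve_pos ks D : dpos D -> dpos (sieve ks D).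
Proof. by move=> /allP D0; apply/allP => x; rewrite mem_filter => /andP[_ /D0]. Qed.

Lemma pmean_sieve p ks D : 0 < p -> all prime ks -> dpos D -> pmean p (sieve ks D) <= pmean p D.
Proof.
move=> p0; elim: ks => [|q ks ih] /=.
  by move=> _ _; rewrite /sieve /= filter_predT.
move=> /andP[qp ksp] D0; have S0 := sieve_pos ks D0.
apply: le_trans (ih ksp D0); apply: le_trans (pmean_kill qp S0 p0).
rewrite le_eqVlt; apply/orP; left; apply/eqP; apply: pmean_ext => //.
- exact: sieve_pos.
- exact: psubst_pos.
move=> t; congr cmod; rewrite /ev big_map.
have -> : sieve (q :: ks) D = [seq x <- sieve ks D | ~~ (q %| x.2)%N].
  by rewrite /sieve -filter_predI; apply: eq_filter => x; rewrite /= negb_or.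
rewrite big_filter big_mkcond big_seq [RHS]big_seq; apply: eq_bigr => x xD.
have x0 := allP S0 _ xD.
case: ifP => /= qx.
  rewrite logn_coprime ?prime_coprime // expr0 mulr1 part_pnat_id //.
  by rewrite p'natE.
have l0 : (0 < logn q x.2)%N by rewrite logn_gt0 mem_primes qp x0; move: qx => /negbT; rewrite negbK.
by rewrite expr0n gtn_eqF // mulr0 mul0r.
Qed.

Lemma box_logn qs K n r : all prime qs -> uniq qs -> n \in box qs K -> prime r ->
  (logn r n <= K)%N.
Proof.
move=> + + + rp; elim: qs n => [|q qs ih] n; rewrite ?box_nil ?box_cons.
  by rewrite inE => _ _ /eqP->; rewrite logn1.
move=> /andP[qp qsp] /andP[qn u] /allpairsP[[k m] /= [kK mb ->]].
have m0 := box_pos qsp mb.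
have qk : (0 < q ^ k)%N by rewrite expn_gt0 prime_gt0.
rewrite lognM //  lognX logn_prime //.
case: eqP => [->|_]; last by rewrite muln0 add0n; exact: ih.
by rewrite (box_logn0 qsp qp qn mb) muln1 addn0; move: kK; rewrite mem_index_iota ltnS.
Qed.

Lemma mem_boxE qs K n : all prime qs -> uniq qs -> reflect
  [/\ (0 < n)%N, forall r, prime r -> (r %| n)%N -> r \in qs & forall r, prime r -> (logn r n <= K)%N]
  (n \in box qs K).
Proof.
move=> qsp u; apply: (iffP idP) => [nb|[n0 h1 h2]].
  split; [exact: box_pos nb|by move=> r; exact: box_primes nb|by move=> r rp; exact: box_logn nb rp].
apply: mem_box => // r; have [rp|rp] := boolP (prime r); first exact: h2.
by rewrite lognE (negPf rp).
Qed.

Definition new_primes M N : seq nat := [seq q <- plist N | (M < q)%N].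

Lemma sieve_box L M N K : (M <= L)%N -> (L <= N)%N ->
  perm_eq [seq n <- box (plist L) K | ~~ has (fun q => (q %| n)%N) (new_primes M N)]
    (box (plist M) K).
Proof.
move=> ML LN.
have MP n := mem_boxE K n (plist_prime M) (plist_uniq M).
have LP n := mem_boxE K n (plist_prime L) (plist_uniq L).
apply: uniq_perm; rewrite ?filter_uniq ?box_uniq ?plist_prime ?plist_uniq // => n.
rewrite mem_filter; apply/andP/idP => [[/hasPn h /LP[n0 h1 h2]]|/MP[n0 h1 h2]].
  apply/MP; split=> // r rp rn.
  have := h1 r rp rn; rewrite !mem_plist rp /= => rL; rewrite leqNgt; apply/negP => Mr.
  have := h r; rewrite mem_filter Mr mem_plist rp (leq_trans rL LN) rn => /(_ isT).
  by [].
split.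
  apply/hasPn => q; rewrite mem_filter mem_plist => /and3P[Mq qp _]; apply/negP => qn.
  by have := h1 q qp qn; rewrite mem_plist qp leqNgt Mq.
apply/LP; split=> // r rp rn.
by have := h1 r rp rn; rewrite !mem_plist rp => rM; exact: leq_trans ML.
Qed.

Lemma ev_sieve_boxd f L M N K chi : (M <= L)%N -> (L <= N)%N ->
  ev (sieve (new_primes M N) (boxd f (plist L) K)) chi = ev (boxd f (plist M) K) chi.
Proof.
move=> ML LN; rewrite /ev /sieve filter_map !big_map.
exact/perm_big/sieve_box.
Qed.

End Sieve.

Section Cauchy.
Variable R : realType.
Local Notation C := R[i].
Implicit Types (s t p : R) (f : nat -> R) (q K L M N n : nat) (ks qs : seq nat) (D E : dlist R).

Local Notation boxp f N K := (boxd f (plist N) K).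

Lemma ev_cat D E chi : ev (D ++ E) chi = ev D chi + ev E chi.
Proof. by rewrite /ev big_cat. Qed.

Lemma cmod_clarkson p (x y : C) : 2 <= p ->
  cmod (2^-1%:C * (x - y)) `^ p + cmod (2^-1%:C * (x + y)) `^ p <= (cmod x `^ p + cmod y `^ p) / 2.
Proof.
move=> p2.
have sq (z : C) : cmod z `^ p = (cmod z ^+ 2) `^ (p / 2).
  by rewrite -powR_mulrn ?cmod_ge0 // -powRrM mulrC divfK.
rewrite !sq; apply: clarkson_powR; rewrite ?sqr_ge0 //; first lra.
rewrite !cmodM !cmod_real !exprMn -mulrDr !cmodD_sq cmodN mulrN ReN.
rewrite ger0_norm ?invr_ge0 //; move: (cmod x ^+ 2) (cmod y ^+ 2) (complex.Re _) => u v w.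
by field => //.
Qed.

Lemma pmean_box_le f p M N K : 0 < p -> (M <= N)%N ->
  pmean p (boxp f M K) <= pmean p (boxp f N K).
Proof.
move=> p0 MN; have P n := boxd_pos f K (plist_prime n).
have np : all prime (new_primes M N).
  by apply/allP => q; rewrite mem_filter => /andP[_ /(allP (plist_prime N))].
apply: le_trans (pmean_sieve p0 np (P N)); rewrite le_eqVlt; apply/orP; left; apply/eqP.
apply: pmean_ext => //; first exact: sieve_pos.
by move=> t; rewrite ev_sieve_boxd.
Qed.

Lemma half_gap_le (a b c d : R) : b <= c -> d + c <= 2^-1 * (a + b) -> d <= (a - b) / 2.
Proof. lra. Qed.

(** [B] is a conditional expectation of [A], and also of the half sum of [A] and
    [B], whose norm is therefore at least that of [B]. Clarkson's inequality then
    turns the near equality of the norms of [A] and [B] into a bound for the norm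
    of their difference. *)
Lemma box_increment f p M N K : 2 <= p -> (M <= N)%N ->
  pmean p (dsub (boxp f N K) (boxp f M K)) <=
  2 `^ p * ((pmean p (boxp f N K) - pmean p (boxp f M K)) / 2).
Proof.
move=> p2 MN; have p0 : 0 < p by lra.
have P n : dpos (boxp f n K) := boxd_pos f K (plist_prime n).
have np : all prime (new_primes M N).
  by apply/allP => q; rewrite mem_filter => /andP[_ /(allP (plist_prime N))].
set A := boxp f N K; set B := boxp f M K.
have A0 : dpos A := P N; have B0 : dpos B := P M.
pose S := dscale 2^-1%:C (A ++ B); pose D := dscale 2^-1%:C (dsub A B).
have S0 : dpos S by apply: dscale_pos; rewrite /dpos all_cat; apply/andP.
have D0 : dpos D by apply: dscale_pos; exact: dsub_pos.
have AB0 : dpos (dsub A B) by exact: dsub_pos.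
have h1 : pmean p B <= pmean p S.
  apply: le_trans (pmean_sieve p0 np S0); rewrite le_eqVlt; apply/orP; left; apply/eqP.
  apply: pmean_ext => //; first exact: sieve_pos.
  move=> t; congr cmod.
  have -> : sieve (new_primes M N) S =
     dscale 2^-1%:C (sieve (new_primes M N) A ++ sieve (new_primes M N) B).
    by rewrite /sieve /S /dscale filter_map -filter_cat.
  rewrite ev_dscale ev_cat !ev_sieve_boxd // -/B.
  have e : 2^-1%:C + 2^-1%:C = 1 :> C.
    by rewrite -rmorphD (_ : 2^-1 + 2^-1 = 1 :> R) //; lra.
  by rewrite mulrDr -mulrDl e mul1r.
have cc (E : dlist R) : dpos E -> continuous (fun t => cmod (ev E (nchar t)) `^ p).
  by move=> E0; exact: cont_cmod_ev.
have cD (u v : R -> R) : continuous u -> continuous v -> continuous (fun t => u t + v t).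
  by move=> cu cv x; apply: cvgD; [exact: cu|exact: cv].
have cZ (c : R) (u : R -> R) : continuous u -> continuous (fun t => c * u t).
  by move=> cu x; apply: cvgM; [exact: cvg_cst|exact: cu].
have mDS := meanD (cc D D0) (cc S S0) (pmeanP D0 p0) (pmeanP S0 p0).
have mAB := meanZ (c := 2^-1) (cD _ _ (cc A A0) (cc B B0))
  (meanD (cc A A0) (cc B B0) (pmeanP A0 p0) (pmeanP B0 p0)).
have h2 : pmean p D + pmean p S <= 2^-1 * (pmean p A + pmean p B).
  apply: mean_le mDS mAB _.
  - exact: cD (cc D D0) (cc S S0).
  - exact: cZ (cD _ _ (cc A A0) (cc B B0)).
  - move=> t; rewrite !ev_dscale ev_dsub ev_cat [leRHS]mulrC; exact: cmod_clarkson.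
have h3 : pmean p (dsub A B) <= 2 `^ p * pmean p D.
  apply: pmean_le => // t; rewrite ev_dscale cmodM cmod_real ger0_norm ?invr_ge0 //.
  rewrite powRM ?invr_ge0 ?cmod_ge0 // mulrA -powRM ?invr_ge0 // mulfV ?pnatr_eq0 //.
  by rewrite powR1 mul1r.
apply: (le_trans h3); rewrite ler_wpM2l ?powR_ge0 //.
exact: half_gap_le h1 h2.
Qed.

(** Bounded monotone sequences converge, with room for errors [e] that tend to
    zero. *)
Lemma almost_nondecreasing_cauchy (Y e : nat -> R) (B : R) :
  (forall M N, (M <= N)%N -> Y M - e M <= Y N) -> (forall N, Y N <= B) -> (forall N, 0 <= e N) ->
  (forall d, 0 < d -> exists M0, forall M, (M0 <= M)%N -> e M <= d) ->
  forall d, 0 < d -> exists M0, forall M N, (M0 <= M)%N -> (M <= N)%N -> Y N - Y M <= d.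
Proof.
move=> mono YB e0 es d d0; pose A : set R := range (fun M => Y M - e M).
have supA : has_sup A.
  split; first by exists (Y 0%N - e 0%N), 0%N.
  by exists B => _ [M _ <-]; rewrite lerBlDr ler_wpDr.
have d20 : 0 < d / 2 by rewrite divr_gt0.
have [_ [M1 _ <-] h1] := sup_adherent d20 supA.
have [M2 h2] := es _ d20; exists (maxn M1 M2) => M N; rewrite geq_max => /andP[M1M M2M] MN.
have := mono _ _ M1M; have := h2 N (leq_trans M2M MN).
have : Y N - e N <= sup A by apply: sup_upper_bound => //; exists N.
lra.
Qed.

End Cauchy.

Section Sufficiency.
Variable R : realType.
Local Notation C := R[i].
Implicit Types (s t p beta : R) (f : nat -> R) (q K L M N n : nat) (ks qs : seq nat) (D E : dlist R).

Local Notation boxp f N K := (boxd f (plist N) K).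

Lemma phi_coef_le beta n : 0 < beta -> (0 < n)%N -> phi_coef beta n <= 2 `^ beta * rpow 2^-1 n.
Proof.
move=> b0; case: n => [//|[_|n _]].
  rewrite (rpow_mul _).1 mulr1 phi_coef1; apply: (@le_trans _ _ (1 `^ beta)); first by rewrite powR1.
  by apply: ler_powR2; rewrite ?(ltW b0) // ler1n.
have l2 := ln_nat_ge R (isT : 1 < n.+2)%N.
have l0 : 0 < ln n.+2%:R :> R by apply: lt_le_trans l2; rewrite invr_gt0.
rewrite phi_coefE // mulrC ler_wpM2r ?rpow_ge0 //.
have -> : ln n.+2%:R `^ (- beta) = (ln n.+2%:R)^-1 `^ beta.
  by rewrite -[(ln _)^-1]powR_inv1 ?(ltW l0) // -powRrM mulN1r.
apply: ler_powR2; rewrite ?(ltW b0) ?invr_ge0 ?(ltW l0) //.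
by rewrite -[leRHS]invrK lef_pV2 ?posrE ?invr_gt0.
Qed.

Lemma box_rpow_sum_le qs K : all prime qs -> \sum_(n <- box qs K) rpow 2^-1 n <= 4 ^+ size qs :> R.
Proof.
move=> qsp; rewrite (box_sum _ (rpow_mul _) qsp).
rewrite (_ : 4 ^+ size qs = \prod_(q <- qs) (4 : R)); last first.
  by rewrite big_const_seq count_predT; elim: (size qs) => //= k <-; rewrite exprS.
rewrite big_seq [leRHS]big_seq; apply: ler_prod => q qq.
have q1 := prime_gt1 (allP qsp _ qq).
have := @rpow_le34 R 0 q (lexx 0) q1; rewrite addr0; have := rpow_ge0 (2^-1 : R) q.
move: (rpow _ _) => r r0 r1; rewrite sumr_ge0 /=; last by move=> k _; rewrite exprn_ge0.
have h : (\sum_(k < K.+1) r ^+ k) * (1 - r) = 1 - r ^+ K.+1.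
  by rewrite mulrC -[1 - r ^+ _]opprB subrX1 -mulNr opprB.
have h2 : 0 <= r ^+ K.+1 by rewrite exprn_ge0.
move: h h2; move: (\sum_(k < _) _) (r ^+ _) => x y h y0.
rewrite leNgt; apply/negP => h3; nra.
Qed.

Lemma box_split qs K L : all prime qs -> uniq qs -> (K <= L)%N ->
  perm_eq (box qs L) (box qs K ++ [seq n <- box qs L | n \notin box qs K]).
Proof.
move=> qsp u KL; apply: uniq_perm; rewrite ?box_uniq // ?cat_uniq ?box_uniq ?filter_uniq ?box_uniq //=.
  by rewrite andbT; apply/hasPn => n; rewrite mem_filter => /andP[].
move=> n; rewrite mem_cat mem_filter; have [nK|nK] //= := boolP (n \in box qs K).
have /(mem_boxE K n qsp u)[n0 h1 h2] := nK.
by apply/(mem_boxE L n qsp u); split=> // r rp; apply: leq_trans KL; exact: h2.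
Qed.

(** For a fixed finite set of primes the sum over all exponents converges absolutely,
    so the truncation of the exponents is uniformly negligible. *)
Lemma box_trunc f qs (B : R) : all prime qs -> uniq qs -> (forall n, (0 < n)%N -> 0 <= f n) ->
  (forall K, \sum_(n <- box qs K) f n <= B) -> forall d, 0 < d -> exists K0, forall K L,
  (K0 <= K)%N -> (K0 <= L)%N -> forall t,
  cmod (ev (boxd f qs K) (nchar t) - ev (boxd f qs L) (nchar t)) <= d.
Proof.
move=> qsp u f0 fB d d0.
have mono K L : (K <= L)%N -> \sum_(n <- box qs L) f n =
    \sum_(n <- box qs K) f n + \sum_(n <- [seq n <- box qs L | n \notin box qs K]) f n.
  by move=> KL; rewrite -big_cat; exact/perm_big/box_split.
have pos K L : 0 <= \sum_(n <- [seq n <- box qs L | n \notin box qs K]) f n.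
  rewrite big_seq; apply: sumr_ge0 => n; rewrite mem_filter => /andP[_ nb].
  exact: f0 (box_pos qsp nb).
have zmono K L : (K <= L)%N -> \sum_(n <- box qs K) f n - 0 <= \sum_(n <- box qs L) f n.
  by move=> KL; rewrite (mono K L KL) subr0 lerDl pos.
have small0 (c : R) : 0 < c -> exists K0, forall K, (K0 <= K)%N -> (0 : R) <= c.
  by move=> c0; exists 0%N => _ _; exact: ltW.
have [M0 HM] := almost_nondecreasing_cauchy zmono fB (fun=> lexx 0) small0 d0.
have main K L t : (M0 <= K)%N -> (K <= L)%N ->
    cmod (ev (boxd f qs K) (nchar t) - ev (boxd f qs L) (nchar t)) <= d.
  move=> MK KL; apply: le_trans (HM K L MK KL); rewrite (mono K L KL) addrAC subrr add0r.
  rewrite !ev_boxd (perm_big _ (box_split qsp u KL)) big_cat opprD addrA subrr add0r cmodN.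
  apply: (le_trans (cmod_sum _ _ _)); rewrite big_seq [leRHS]big_seq; apply: ler_sum => n.
  rewrite mem_filter => /andP[_ nb]; rewrite cmodM cmod_nchar mulr1 cmod_real ger0_norm //.
  exact: f0 (box_pos qsp nb).
exists M0 => K L MK ML t; have [KL|/ltnW LK] := leqP K L; first exact: main.
by rewrite -cmodN opprB; exact: main.
Qed.

(** [d] depends on the bound [B] only, hence serves all truncations at once. *)
Lemma pmean_close p (B e : R) : 0 < p -> 0 <= B -> 0 < e -> exists2 d, 0 < d & forall D E,
  dpos D -> dpos E -> (forall t, cmod (ev D (nchar t)) <= B) ->
  (forall t, cmod (ev E (nchar t)) <= B) ->
  (forall t, cmod (ev D (nchar t) - ev E (nchar t)) <= d) -> pmean p D <= pmean p E + e.
Proof.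
move=> p0 B0 e0; have [d d0 Hd] := powR_unif_cont p0 B0 e0; exists d => // D E D0 E0 DB EB DE.
have := @pmean_le_sum R nat [:: 0%N] (fun=> 1) (fun=> p) (fun=> E) e p D D0 p0.
rewrite big_seq1 mul1r addrC; apply=> // t; rewrite big_seq1 mul1r.
have /ler_normlP[_] := Hd _ _ (cmod_ge0 _) (DB t) (cmod_ge0 _) (EB t) (le_trans (cmod_dist _ _) (DE t)).
lra.
Qed.

Lemma collect_coef D n : (0 < n)%N -> dcoef (collect D) n = \sum_(x <- D | x.2 == n) x.1.
Proof.
move=> n0; rewrite /dcoef /collect; set M := \max_(x <- D) x.2.
have [nM|Mn] := ltnP n.-1 M; first by rewrite nth_mkseq // prednK.
rewrite nth_default ?size_mkseq // big_seq_cond big1 // => x /andP[xD /eqP xn].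
have : (x.2 <= M)%N by rewrite (leq_bigmax_seq (F := fun x : C * nat => x.2)).
by rewrite xn leqNgt -(prednK n0) ltnS Mn.
Qed.

Lemma collect_boxd f N K n : (0 < n)%N -> (n <= N)%N -> (n <= K)%N ->
  dcoef (collect (boxp f N K)) n = (f n)%:C.
Proof.
move=> n0 nN nK; rewrite collect_coef // big_map big_mkcond /=.
rewrite (bigD1_seq n) ?mem_box_plist ?box_uniq ?plist_prime ?plist_uniq //= eqxx.
by rewrite big1 ?addr0 // => m /negPf->.
Qed.


Lemma inv_nat_small d : 0 < d -> exists M0, forall M, (M0 <= M)%N -> M.+1%:R^-1 <= d :> R.
Proof.
move=> d0; exists (Num.truncn d^-1) => M MM.
rewrite -[leRHS]invrK lef_pV2 ?posrE ?invr_gt0 ?ltr0n //.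
by apply: (le_trans (ltW (truncnS_gt _))); rewrite ler_nat ltnS.
Qed.

(** The truncations of [phi] to the numbers composed of primes up to [N] form a
    martingale with bounded norms by [phi_box_bound]; the norms increase, and
    [box_increment] makes the sequence Cauchy. The comparison of two members needs
    the same bound [K] on the exponents, so [K] is chosen large enough, depending
    on [N], for a change of [K] to be negligible. *)
Lemma phi_Hp_sufficient p beta : 2 <= p -> p / 4 < beta -> phi_in_Hp p beta.
Proof.
move=> p2 pb; have p0 : 0 < p by lra.
have p1 : 1 <= p by lra.
have b0 : 0 < beta by apply: le_lt_trans pb; rewrite divr_ge0 // ltW.
have [Y Y0 HY] := phi_box_bound p2 pb.
pose f := phi_coef beta : nat -> R; pose y N K := pmean p (boxp f N K).
pose e N : R := N.+1%:R^-1.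
have e0 N : 0 < e N by rewrite invr_gt0 ltr0n.
have f0 n : (0 < n)%N -> 0 <= f n by move=> _; exact: phi_coef_ge0.
have pos N K : dpos (boxp f N K) by apply: boxd_pos; exact: plist_prime.
have /choice[k0 Hk0] : forall N, exists K0, forall K, (K0 <= K)%N -> y N K <= Y /\
    forall L, (K0 <= L)%N -> y N K <= y N L + e N /\
    forall t, cmod (ev (boxp f N K) (nchar t) - ev (boxp f N L) (nchar t)) <= e N.
  move=> N; have [qsp u] := (plist_prime N, plist_uniq N).
  have [K1 H1] := HY _ qsp u.
  pose B : R := 2 `^ beta * 4 ^+ size (plist N).
  have B0 : 0 <= B by rewrite mulr_ge0 ?powR_ge0 ?exprn_ge0.
  have zB K : \sum_(n <- box (plist N) K) f n <= B.
    apply: le_trans (ler_wpM2l (powR_ge0 _ _) (box_rpow_sum_le K qsp)).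
    rewrite mulr_sumr big_seq [leRHS]big_seq; apply: ler_sum => n nb.
    by apply: phi_coef_le => //; exact: box_pos nb.
  have evB K t : cmod (ev (boxp f N K) (nchar t)) <= B.
    apply: le_trans (zB K); rewrite ev_boxd; apply: (le_trans (cmod_sum _ _ _)).
    rewrite big_seq [leRHS]big_seq; apply: ler_sum => n nb.
    by rewrite cmodM cmod_nchar mulr1 cmod_real ger0_norm // f0 // (box_pos qsp nb).
  have [d d0 Hd] := pmean_close p0 B0 (e0 N).
  have dm : 0 < Num.min d (e N) by rewrite lt_min d0 e0.
  have [K2 H2] := box_trunc qsp u f0 zB dm.
  exists (maxn K1 K2) => K; rewrite geq_max => /andP[K1K K2K]; split; first exact: H1.
  move=> L; rewrite geq_max => /andP[_ K2L].
  have h t : _ := H2 K L K2K K2L t.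
  split; last by move=> t; have := h t; rewrite le_min => /andP[].
  by apply: Hd => // t; have := h t; rewrite le_min => /andP[].
(* Larger than [k0 M] for every [M <= N], and at least [N] so that every fixed
   coefficient is eventually present. *)
pose Kf N := (N + \sum_(i < N.+1) k0 i)%N.
have kK M N : (M <= N)%N -> (k0 M <= Kf N)%N.
  move=> MN; rewrite /Kf (bigD1 (Ordinal (MN : (M < N.+1)%N))) //=.
  by rewrite addnCA leq_addr.
exists (fun N => collect (boxp f N (Kf N))); split; last first.
  move=> n n1; apply/cvgrPdist_le => d d0; exists n => // N /= nN.
  rewrite collect_boxd //; last exact: leq_trans (leq_addr _ _).
  by rewrite subrr cmod0 subrr normr0 ltW.
have mono M N : (M <= N)%N -> y M (Kf M) - e M <= y N (Kf N).
  move=> MN; apply: (@le_trans _ _ (y M (Kf N))); last exact: pmean_box_le.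
  by rewrite lerBlDr; have [_ /(_ _ (kK _ _ MN))[]] := Hk0 M (Kf M) (kK _ _ (leqnn M)).
have yY N : y N (Kf N) <= Y by have [] := Hk0 N (Kf N) (kK _ _ (leqnn N)).
move=> d d0.
(* Two uses of [powRD_le] and [box_increment] cost the powers of [2]. *)
pose g : R := (d / 2) `^ p / (2 `^ p * (2 `^ p + 2 `^ p)).
have pp : 0 < 2 `^ p :> R by rewrite powR_gt0.
have g0 : 0 < g by rewrite divr_gt0 ?mulr_gt0 ?addr_gt0 ?powR_gt0 ?divr_gt0.
have g20 : 0 < g / 2 by rewrite divr_gt0.
have [M1 H1] := almost_nondecreasing_cauchy mono yY (fun N => ltW (e0 N)) (@inv_nat_small) g20.
have [M2 H2] := inv_nat_small g20.
pose M0 := maxn M1 M2.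
have main M N : (M0 <= M)%N -> (M <= N)%N ->
   pmean p (dsub (boxp f N (Kf N)) (boxp f M (Kf M))) <= (d / 2) `^ p.
  rewrite geq_max => /andP[M1M M2M] MN.
  have [_ /(_ _ (kK _ _ (leqnn M)))[y1 _]] := Hk0 M (Kf N) (kK _ _ MN).
  have [_ /(_ _ (kK _ _ MN))[y2 _]] := Hk0 M (Kf M) (kK _ _ (leqnn M)).
  have [_ /(_ _ (kK _ _ (leqnn M)))[_ y3]] := Hk0 M (Kf N) (kK _ _ MN).
  have y4 := H1 _ _ M1M MN; have y5 := H2 _ M2M.
  have inc := box_increment f (Kf N) p2 MN.
  set D := dsub (boxp f N (Kf N)) (boxp f M (Kf N)) in inc.
  have D0 : dpos D by exact: dsub_pos.
  have h1 : pmean p (dsub (boxp f N (Kf N)) (boxp f M (Kf M))) <= 2 `^ p * e M + 2 `^ p * pmean p D.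
    have := @pmean_le_sum R nat [:: 0%N] (fun=> 2 `^ p) (fun=> p) (fun=> D) (2 `^ p * e M) p
      (dsub (boxp f N (Kf N)) (boxp f M (Kf M))) (dsub_pos (pos _ _) (pos _ _)) p0.
    rewrite big_seq1; apply=> // t; rewrite big_seq1.
    have tri : cmod (ev (dsub (boxp f N (Kf N)) (boxp f M (Kf M))) (nchar t)) <= e M + cmod (ev D (nchar t)).
      rewrite !ev_dsub; set a := ev _ _; set b := ev _ _; set c := ev _ _.
      have -> : a - b = (c - b) + (a - c) by ring.
      by apply: (le_trans (cmodD _ _)); rewrite lerD2r; exact: y3.
    apply: (le_trans (ler_powR2 (ltW p0) (cmod_ge0 _) tri)).
    apply: (le_trans (powRD_le (ltW p0) (ltW (e0 M)) (cmod_ge0 _))).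
    rewrite mulrDr lerD2r ler_wpM2l ?powR_ge0 //.
    have e1 : 0 < e M <= 1 by rewrite e0 /e invf_le1 ?ltr0n // ler1n.
    by have := @ger_powR R (e M) e1 1 p; rewrite powRr1 ?(ltW (e0 M)) //; apply.
  apply: (le_trans h1).
  have inc2 : pmean p D <= 2 `^ p * g.
    apply: (le_trans inc); rewrite ler_wpM2l ?powR_ge0 // -/(y _ _) -/(y _ _).
    rewrite -/(e M) in y5.
    by move: y2 y4 y5 g0; clear; move: (y _ _) (y _ _) (y _ _) (e M) => *; lra.
  have eg : e M <= 2 `^ p * g.
    apply: (@le_trans _ _ g); first by move: y5 g0; rewrite -/(e M); clear; move: (e M) => *; lra.
    rewrite ler_peMl ?(ltW g0) //.
    have two : (1 : R) <= 2 by rewrite ler1n.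
    by have := ler_powR two (ltW p0); rewrite powRr0.
  rewrite -mulrDr; apply: (le_trans (ler_wpM2l (ltW pp) (lerD eg inc2))).
  rewrite /g; move: pp; move: (2 `^ p) ((d / 2) `^ p) => v w v0.
  by rewrite le_eqVlt; apply/orP; left; apply/eqP; field; rewrite !gt_eqF // addr_gt0.
have both M N : (M0 <= M)%N -> (M0 <= N)%N ->
   pmean p (dsub (boxp f N (Kf N)) (boxp f M (Kf M))) <= (d / 2) `^ p.
  move=> MM MN; have [h|/ltnW h] := leqP M N; first exact: main.
  apply: le_trans (main _ _ MN h); rewrite le_eqVlt; apply/orP; left; apply/eqP.
  apply: pmean_ext => //; try exact: dsub_pos.
  by move=> t; rewrite !ev_dsub -cmodN opprB.
exists M0 => N M MN MM; rewrite Hp_norm_sub.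
have -> : pmean p (dsub (terms (collect (boxp f N (Kf N)))) (terms (collect (boxp f M (Kf M))))) =
    pmean p (dsub (boxp f N (Kf N)) (boxp f M (Kf M))).
  apply: pmean_ext => //; try by apply: dsub_pos; try exact: terms_pos.
  by move=> t; rewrite !ev_dsub !ev_collect.
apply: (@le_lt_trans _ _ (((d / 2) `^ p) `^ p^-1)).
  apply: ler_powR2; rewrite ?invr_ge0 ?(ltW p0) ?both //.
  by apply: pmean_ge0 => //; exact: dsub_pos.
rewrite -powRrM mulfV ?gt_eqF // powRr1 ?divr_ge0 ?(ltW d0) //.
by rewrite ltr_pdivrMr // ltr_pMr // ltr1n.
Qed.

End Sufficiency.

Theorem theorem3p1 (R : realType) (beta : R) (hbeta : 0 < beta) :
  (forall p : R, 2 <= p -> (phi_in_Hp p beta <-> p / 4 < beta)) /\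
  (forall p : R, 0 < p -> p <= 2 ->
     (p^-1 < beta -> phi_in_Hp_dual p beta) /\
     (beta < p^-1 -> ~ phi_in_Hp_dual p beta)).
Proof.
split=> p; last by split; [exact: phi_dual_bounded|exact: phi_dual_unbounded].
by split; [exact: phi_Hp_necessary|exact: phi_Hp_sufficient].
Qed.
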